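(* Let $X$ be a real Banach space with separable dual $X^\star$. Then any convex continuous function $f:G\to\mathbb{R}$ on an open subset $G$ of $X$ is $\Gamma$-almost everywhere Fréchet differentiable; that is, the set of points of $G$ at which $f$ is not Fréchet differentiable is $\Gamma$-null.
   Context: A function $f:G\to\mathbb{R}$ on an open set $G$ is convex if $f(\lambda x+(1-\lambda)y)\le\lambda f(x)+(1-\lambda)f(y)$ for $\lambda\in[0,1]$ whenever the segment joining $x$ and $y$ lies in $G$. $f$ is Fréchet differentiable at $x$ if there is $x^\star\in X^\star$ with $f(x+u)=f(x)+x^\star(u)+o(\|u\|)$ as $\|u\|\to0$. $\Gamma$-null sets. $T=[0,1]^{\mathbb{N}}$ carries the product topology and the product Lebesgue (probability) measure $\mu$. $\Gamma(X)$ is the space of continuous maps $\gamma:T\to X$ having continuous partial derivatives $D_j\gamma:T\to X$ for all $j\in\mathbb{N}$ (one-sided where the $j$-th coordinate is $0$ or $1$), with the topology generated by the seminorms $\|\gamma\|_0=\sup_{t\in T}\|\gamma(t)\|$ and $\|\gamma\|_k=\sup_{t\in T}\|D_k\gamma(t)\|$, $k\ge1$. A Borel set $N\subset X$ is $\Gamma$-null if $\mu\{t\in T:\gamma(t)\in N\}=0$ for all $\gamma$ in a residual (comeager) subset of $\Gamma(X)$. An arbitrary set is $\Gamma$-null if it is contained in a Borel $\Gamma$-null set. *)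

(* Defs.v *)
From HB Require Import structures.
From mathcomp Require Import all_boot all_order all_algebra.
From mathcomp Require Import all_classical all_reals all_analysis.
From mathcomp Require Import measurable_realfun borel_hierarchy lra.
Set Implicit Arguments.
Unset Strict Implicit.
Unset Printing Implicit Defensive.
Import Order.TTheory GRing.Theory Num.Theory.
Import numFieldNormedType.Exports.
Local Open Scope classical_set_scope.
Local Open Scope ring_scope.

Definition unit_interval (R : realType) : Type :=
  set_type (`[0%R, 1%R]%classic : set R).
HB.instance Definition _ (R : realType) := PseudoMetric.on (unit_interval R).

Lemma unit_interval0 (R : realType) : (0%R : R) \in (`[0%R, 1%R]%classic : set R).
Proof. by rewrite inE /= in_itv /= lexx ler01. Qed.
HB.instance Definition _ (R : realType) :=
  isPointed.Build (unit_interval R) (exist _ 0%R (unit_interval0 R)).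

Definition cube (R : realType) : Type :=
  prod_topology (fun _ : nat => unit_interval R).
HB.instance Definition _ (R : realType) := PseudoMetric.on (cube R).
HB.instance Definition _ (R : realType) :=
  isPointed.Build (cube R) (fun=> point).

Definition cylinders (R : realType) : set (set (cube R)) :=
  [set C | exists (i : nat) (B : set R), measurable B /\
    C = [set t : cube R | B (\val (t i))]].

Definition cube_display (R : realType) := sigma_display (@cylinders R).
HB.instance Definition _ (R : realType) :=
  Measurable.copy (cube R) (g_sigma_algebraType (@cylinders R)).

(* The subsets of the cube depending on finitely many coordinates through
   measurable sets form a pi-system generating the product sigma-algebra, so
   at most one probability satisfies this property. *)
Definition is_product_lebesgue (R : realType) (mu : probability (cube R) R) :=
  forall (n : nat) (A : nat -> set R), (forall i, measurable (A i)) ->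
  mu [set t : cube R | forall i, (i < n)%N -> A i (\val (t i))] =
  (\prod_(i < n) lebesgue_measure (A i `&` `[0%R, 1%R]))%E.

Section product_lebesgue_existence.
Variable R : realType.
Local Open Scope ereal_scope.
Notation lam := (@lebesgue_measure R).
Let I : set R := `[0%R, 1%R]%classic.
Let mI : measurable (I : set (measurableTypeR R)).
Proof. exact: measurable_itv. Qed.
Let P := mrestr lam mI.
HB.instance Definition _ := Measure.on P.

Let P1 : P setT = 1.
Proof. by rewrite /P /mrestr setTI lebesgue_measure_itv /= lte_fin ltr01 oppr0 adde0. Qed.
Let PE E : P E = lam (E `&` I). Proof. by []. Qed.

HB.instance Definition _ := Measure_isProbability.Build _ _ _ P P1.

Let pushm d (T : measurableType d) (m : {measure set (measurableTypeR R) -> \bar R})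
    (f : measurableTypeR R -> T) (mf : measurable_fun setT f) :=
  measure_function_pushforward__canonical__measure_function_Measure m mf.

Let mhalf (c : R) : measurable_fun setT (fun x : R => (2 * x - c)%R).
Proof. by apply: measurable_funB => //; apply: measurable_funM. Qed.

Let halving (c : R) (E : set R) : measurable E ->
  lam ((fun x : R => (2 * x - c)%R) @^-1` E) = (2^-1)%:E * lam E.
Proof.
move=> mE.
pose g : measurableTypeR R -> measurableTypeR R := fun x : R => (2 * x - c)%R.
have mg : measurable_fun setT g := mhalf c.
pose m : {measure set (measurableTypeR R) -> \bar R} :=
  mscale (NngNum (ler0n R 2)) (pushm lam mg).
have -> : lam E = m E.
  apply: (@lebesgue_measure_unique R m) => // X [[a b] /= _ <-].
  rewrite /m/= /mscale /= /pushforward.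
  have -> : g @^-1` `]a, b]%classic = `]((a + c) / 2)%R, ((b + c) / 2)%R]%classic.
    apply/seteqP; split => x /=; rewrite /g !in_itv/= => /andP[h1 h2].
      by apply/andP; split; lra.
    by apply/andP; split; lra.
  rewrite !lebesgue_measure_itv /= !lte_fin.
  have -> : ((a + c) / 2 < (b + c) / 2)%R = (a < b)%R.
    by apply/idP/idP => ?; lra.
  case: ifP => _; last by rewrite mule0.
  by rewrite -!EFinB -EFinM; congr (_%:E); lra.
rewrite /m /= /mscale /= /pushforward muleA -EFinM mulVf ?mul1e//.
Qed.

Let b (x : R) : R := if (x < 2^-1)%R then 0%R else 1%R.
Let D (x : R) : R := (2 * x - b x)%R.

Let mb : measurable_fun setT b.
Proof. by apply: measurable_fun_ifT => //; apply: measurable_fun_ltr. Qed.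
Let mD : measurable_fun setT D.
Proof. by apply: measurable_funB => //; apply: measurable_funM. Qed.

(* The doubling map preserves P conditionally on the first binary digit. *)
Let doubling (c : bool) (E : set R) : measurable E ->
  P ([set x | b x = c%:R%R] `&` D @^-1` E) = (2^-1)%:E * P E.
Proof.
move=> mE; rewrite !PE.
have b0 x : b x = (if (x < 2^-1)%R then 0%R else 1%R) by [].
have mEI : measurable (E `&` I) by apply: measurableI.
case: c => /=.
  rewrite -(halving 1%R mEI); congr (lam _); apply/seteqP; split => x /=;
    rewrite /I /= !in_itv /= /D b0; case: (ltP x 2^-1%R) => h.
  - by move=> [[/eqP]]; rewrite eq_sym oner_eq0.
  - by move=> [[_ ?] /andP[? ?]]; split => //; apply/andP; split; lra.
  - by move=> [_ /andP[? ?]]; lra.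
  - by move=> [? /andP[? ?]]; split => //; apply/andP; split; lra.
pose J : set R := `[0%R, 1%R[%classic.
have mEJ : measurable (E `&` J) by apply: measurableI => //; exact: measurable_itv.
have -> : lam (E `&` I) = lam (E `&` J).
  have -> : I = J `|` [set 1%R].
    apply/seteqP; split => x; rewrite /I /J /= !in_itv /=.
      by move=> /andP[-> /=]; rewrite le_eqVlt => /orP[/eqP ->|]; [right|left].
    by case=> [/andP[-> /ltW ->]|->] //; rewrite ler01 lexx.
  rewrite setIUr; apply/eqP; rewrite eq_le; apply/andP; split; last first.
    apply: le_measure; rewrite ?inE//; apply: measurableU => //.
    by apply: measurableI.
  rewrite (le_trans (measureU2 _ _ _))//; first by apply: measurableI.
  rewrite -[leRHS]adde0 leeD//.
  rewrite -(lebesgue_measure_set1 1%R); apply: le_measure; rewrite ?inE//.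
  by apply: measurableI.
rewrite -(halving 0%R mEJ); congr (lam _); apply/seteqP; split => x /=;
    rewrite /I /J /= !in_itv /= /D b0; case: (ltP x 2^-1%R) => h.
- by move=> [[_ ?] /andP[? ?]]; split => //; apply/andP; split; lra.
- by move=> [[/eqP]]; rewrite oner_eq0.
- by move=> [? /andP[? ?]]; split => //; apply/andP; split; lra.
- by move=> [_ /andP[? ?]]; lra.
Qed.

(* Upper approximations of the numbers p x and q x whose binary digits are the
   digits of x of even rank and of odd rank; under P, p and q are independent
   and uniformly distributed, and the sequence p, p \o q, p \o q \o q, etc has
   the product Lebesgue measure as its law. *)
Let F := fix F n (x : R) : R * R :=
  if n is n'.+1 then (((b x + (F n' (D x)).2) / 2)%R, (F n' (D x)).1)
  else (1%R, 1%R).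

Let b01 x : (0 <= b x <= 1)%R.
Proof. by rewrite /b; case: ifP; rewrite ?lexx ?ler01. Qed.

Let F01 n x : (0 <= (F n x).1 <= 1)%R /\ (0 <= (F n x).2 <= 1)%R.
Proof.
elim: n x => [x|n ih x] /=; first by rewrite lexx ler01.
have := b01 x; have [/andP[? ?] /andP[? ?]] := ih (D x) => /andP[? ?].
by split; apply/andP; split; lra.
Qed.

Let Fdec n x : ((F n.+1 x).1 <= (F n x).1)%R /\ ((F n.+1 x).2 <= (F n x).2)%R.
Proof.
elim: n x => [x|n ih x].
  by have [/andP[_ ?] /andP[_ ?]] := F01 1 x.
by have [h1 h2] := ih (D x); rewrite [F _.+2 x]/= [F n.+1 x]/=; split => //=; lra.
Qed.

Let mF n : measurable_fun setT (fun x => (F n x).1) /\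
           measurable_fun setT (fun x => (F n x).2).
Proof.
elim: n => [|n [ih1 ih2]] /=; first by split; exact: measurable_cst.
split; last by apply: (measurableT_comp ih1 mD).
apply: measurable_funM => //; apply: measurable_funD => //.
exact: (measurableT_comp ih2 mD).
Qed.

Let H := fix H n : (R -> R) * (R -> R) :=
  if n is n'.+1 then
    ((fun a => ((H n').2 (2 * a)%R + (H n').2 (2 * a - 1)%R) / 2)%R, (H n').1)
  else ((fun a => if a <= 1 then 1 else 0)%R, (fun a => if a <= 1 then 1 else 0)%R).

Let A n a c := [set x | (a <= (F n x).1)%R] `&` [set x | (c <= (F n x).2)%R].

Let mA n a c : measurable (A n a c).
Proof.
have [h1 h2] := mF n.
apply: measurableI.
  have := h1 measurableT _ (measurable_itv `[a, +oo[); rewrite setTI.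
  by congr measurable; apply/seteqP; split => x /=; rewrite in_itv/= andbT.
have := h2 measurableT _ (measurable_itv `[c, +oo[); rewrite setTI.
by congr measurable; apply/seteqP; split => x /=; rewrite in_itv/= andbT.
Qed.

Let PA n a c : P (A n a c) = ((H n).1 a * (H n).2 c)%:E.
Proof.
elim: n a c => [a c|n ih a c].
  have AE : A 0 a c = if (a <= 1)%R && (c <= 1)%R then setT else set0.
    apply/seteqP; split => x; rewrite /A /=; first by move=> [-> ->].
    by case: ifP => // /andP[? ?].
  rewrite AE /=; case: (a <= 1)%R; case: (c <= 1)%R => /=;
    by rewrite ?measure0 ?mulr0 ?mul0r// P1 mulr1.
have -> : A n.+1 a c =
    ([set x | b x = (true%:R : R)] `&` D @^-1` (A n c (2 * a - 1)%R)) `|`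
    ([set x | b x = (false%:R : R)] `&` D @^-1` (A n c (2 * a)%R)).
  apply/seteqP; split => x; rewrite /A /=.
    move=> [h1 h2]; have : b x = 1%R \/ b x = 0%R.
      by rewrite /b; case: ifP; [right|left].
    by case => bx; [left|right]; rewrite bx in h1 *; split => //; split => //; lra.
  by move=> [[-> [h1 h2]]|[-> [h1 h2]]]; split => //; lra.
have mbs (e : bool) : measurable ([set x | b x = (e%:R : R)] : set (measurableTypeR R)).
  have := mb measurableT (measurable_set1 (e%:R : R)); rewrite setTI.
  by congr measurable; apply/seteqP; split.
have mDA a' : measurable (D @^-1` A n c a' : set (measurableTypeR R)).
  by have := mD measurableT (mA n c a'); rewrite setTI.
rewrite measureU.
- rewrite -[LHS]/(P _ + P _)  (doubling true) // (doubling false) // !ih /=.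
  by rewrite -!EFinM -EFinD; congr (_%:E); lra.
- by apply: measurableI; [exact: (mbs true)|exact: mDA].
- by apply: measurableI; [exact: (mbs false)|exact: mDA].
- by apply/seteqP; split => x //= [[-> _] [/eqP]]; rewrite oner_eq0.
Qed.

Let cl (a : R) : R := Num.max 0%R (1 - Num.max 0 a)%R.

Let clE a : cl a = if (a < 0)%R then 1%R else if (a < 1)%R then (1 - a)%R else 0%R.
Proof.
rewrite /cl /Num.max; case: (ltP 0%R a) => ?; case: (ltP a 0%R) => ?; case: (ltP a 1%R) => ?; case: ltP => ?; lra.
Qed.

Let cl_half a : cl a = ((cl (2 * a) + cl (2 * a - 1)) / 2)%R.
Proof.
rewrite !clE; case: (ltP a 0%R) => ?; case: (ltP a 1%R) => ?; case: (ltP (2 * a)%R 0%R) => ?; case: (ltP (2 * a)%R 1%R) => ?; case: (ltP (2 * a - 1)%R 0%R) => ?; case: (ltP (2 * a - 1)%R 1%R) => ?; lra.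
Qed.

Let err n (a : R) : R := if (0 < a <= 1)%R then ((2^-1 : R) ^+ n)%R else 0%R.

Let err_half n a : ((err n (2 * a) + err n (2 * a - 1)) / 2 <= err n.+1 a)%R.
Proof.
have e0 : (0 <= (2^-1 : R) ^+ n)%R by rewrite exprn_ge0// invr_ge0.
rewrite /err exprS; move: ((2^-1 : R) ^+ n)%R e0 => e e0.
case: (ltP 0%R a) => ?; case: (leP a 1%R) => ?; case: (ltP 0%R (2 * a)%R) => ?;
  case: (leP (2 * a)%R 1%R) => ?; case: (ltP 0%R (2 * a - 1)%R) => ?;
  case: (leP (2 * a - 1)%R 1%R) => ? /=; lra.
Qed.

Let H_err n a : (`|(H n.*2).1 a - cl a| <= err n a)%R /\
                (`|(H n.*2).2 a - cl a| <= err n a)%R.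
Proof.
elim: n a => [a|n ih a].
  rewrite /err expr0 /= clE; case: (ltP 0%R a) => ?; case: (leP a 1%R) => ?;
    case: (ltP a 0%R) => ?; case: (ltP a 1%R) => ? /=;
    by split; rewrite ler_norml; apply/andP; split; lra.
rewrite doubleS /= (cl_half a).
have [h1 h2] := ih (2 * a)%R; have [h3 h4] := ih (2 * a - 1)%R.
have h := err_half n a.
have key (e e' e'' x y u v : R) : ((e + e') / 2 <= e'' -> `|x - u| <= e ->
    `|y - v| <= e' -> `|(x + y) / 2 - (u + v) / 2| <= e'')%R.
  by rewrite !ler_norml => ? /andP[? ?] /andP[? ?]; apply/andP; split; lra.
by split; apply: (key _ _ _ _ _ _ _ h).
Qed.

Let H_cl n a : (`|(H n.*2).1 a - cl a| <= (2^-1 : R) ^+ n)%R /\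
               (`|(H n.*2).2 a - cl a| <= (2^-1 : R) ^+ n)%R.
Proof.
have h : (err n a <= (2^-1 : R) ^+ n)%R.
  by rewrite /err; case: ifP => // _; rewrite exprn_ge0// invr_ge0.
by have [h1 h2] := H_err n a; split; apply: le_trans h.
Qed.

Let H_cvg a : (H n.*2).1 a @[n --> \oo] --> cl a /\ (H n.*2).2 a @[n --> \oo] --> cl a.
Proof.
have g0 : ((2^-1 : R) ^+ n)%R @[n --> \oo] --> (0 : R)%R.
  by apply: cvg_expr; rewrite gtr0_norm ?invr_gt0// invf_lt1// ltr1n.
have g1 : (cl a - (2^-1 : R) ^+ n)%R @[n --> \oo] --> cl a.
  by rewrite -[X in _ --> X]subr0; apply: cvgB => //; exact: cvg_cst.
have g2 : (cl a + (2^-1 : R) ^+ n)%R @[n --> \oo] --> cl a.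
  by rewrite -[X in _ --> X]addr0; apply: cvgD => //; exact: cvg_cst.
split; apply: squeeze_cvgr g1 g2; apply: nearW => n; have [h1 h2] := H_cl n a.
  by move: h1; rewrite ler_norml => /andP[? ?]; apply/andP; split; lra.
by move: h2; rewrite ler_norml => /andP[? ?]; apply/andP; split; lra.
Qed.

Let p x : R := limn (fun n => (F n x).1).
Let q x : R := limn (fun n => (F n x).2).

Let nF1 x : nonincreasing_seq (fun n => (F n x).1).
Proof. by apply/nonincreasing_seqP => n; have [] := Fdec n x. Qed.
Let nF2 x : nonincreasing_seq (fun n => (F n x).2).
Proof. by apply/nonincreasing_seqP => n; have [] := Fdec n x. Qed.
Let cF1 x : cvgn (fun n => (F n x).1).
Proof.
apply: nonincreasing_is_cvgn => //; exists 0%R => _ [n _ <-].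
by have [/andP[]] := F01 n x.
Qed.
Let cF2 x : cvgn (fun n => (F n x).2).
Proof.
apply: nonincreasing_is_cvgn => //; exists 0%R => _ [n _ <-].
by have [_ /andP[]] := F01 n x.
Qed.

Let p01 x : p x \in I.
Proof.
rewrite inE /I /= in_itv /=; apply/andP; split.
  by apply: limr_ge => //; apply: nearW => n; have [/andP[]] := F01 n x.
by apply: limr_le => //; apply: nearW => n; have [/andP[]] := F01 n x.
Qed.

Let mp : measurable_fun setT p.
Proof.
by apply: (@measurable_fun_cvg _ _ _ setT (fun n x => (F n x).1)) => [n|x _];
  [have [] := mF n|exact: cF1].
Qed.
Let mq : measurable_fun setT q.
Proof.
by apply: (@measurable_fun_cvg _ _ _ setT (fun n x => (F n x).2)) => [n|x _];
  [have [] := mF n|exact: cF2].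
Qed.

Let pq_half a c : P ([set x | (a <= p x)%R] `&` [set x | (c <= q x)%R]) =
  (cl a * cl c)%:E.
Proof.
have -> : [set x | (a <= p x)%R] `&` [set x | (c <= q x)%R] =
    \bigcap_n A n.*2 a c.
  apply/seteqP; split => x /=.
    move=> [h1 h2] n _; split => /=; [apply: le_trans h1 _|apply: le_trans h2 _].
      exact: nonincreasing_cvgn_ge.
    exact: nonincreasing_cvgn_ge.
  have le2 n : (n <= n.*2)%N by rewrite -addnn leq_addr.
  move=> h; split.
    apply: limr_ge => //; apply: nearW => n; have [h1 _] := h n Logic.I.
    exact: le_trans h1 (nF1 _ (le2 n)).
  apply: limr_ge => //; apply: nearW => n; have [_ h1] := h n Logic.I.
  exact: le_trans h1 (nF2 _ (le2 n)).
have : P \o (fun n => A n.*2 a c) @ \oo --> P (\bigcap_n A n.*2 a c).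
  apply: nonincreasing_cvg_mu => //.
  - rewrite -[X in (X < _)%E]/(P _) PA ltey//.
  - by move=> n; exact: mA.
  - by apply: bigcapT_measurable => n; exact: mA.
  - apply/nonincreasing_seqP => n; apply/subsetPset => x [h1 h2].
    have le2 : (n.*2 <= n.*2.+2)%N by exact: leq_trans (leqnSn _) (leqnSn _).
    by split; [exact: le_trans h1 (nF1 x le2)|exact: le_trans h2 (nF2 x le2)].
move=> h1; have h2 : P \o (fun n => A n.*2 a c) @ \oo --> (cl a * cl c)%:E.
  have -> : P \o (fun n => A n.*2 a c) = fun n => ((H n.*2).1 a * (H n.*2).2 c)%:E.
    by apply/funext => n /=; rewrite PA.
  apply: cvg_EFin; first exact: nearW.
  by apply: cvgM; [have [] := H_cvg a|have [] := H_cvg c].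
exact: (cvg_unique _ h1 h2).
Qed.

Let P_half a : P `[a, +oo[%classic = (cl a)%:E.
Proof.
have -> : P `[a, +oo[%classic = lam `[Num.max 0%R a, 1%R]%classic.
  rewrite PE; congr (lam _); apply/seteqP; split => x /=;
    rewrite /I /= !in_itv /= ge_max andbT; first by move=> [-> /andP[-> ->]].
  by move=> /andP[/andP[-> ->] ->].
rewrite lebesgue_measure_itv /= lte_fin /cl -EFinB.
case: ltP => h; congr (_%:E).
  by rewrite /Num.max subr_gt0 h.
by rewrite max_l// subr_le0.
Qed.

Let Gi := [set B : set (measurableTypeR R) | exists x : R, B = `[x, +oo[%classic].
Let GiI : setI_closed Gi.
Proof.
move=> _ _ [x ->] [y ->]; exists (Num.max x y).
by apply/seteqP; split => z /=; rewrite !in_itv/= !andbT ge_max;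
  [move=> [-> ->]|move=> /andP[-> ->]].
Qed.
Let Gc : \bigcup_k (`[(- k%:R : R)%R, +oo[%classic) = setT.
Proof.
apply/seteqP; split => // x _.
exists (Num.bound `|x|%R) => //=; rewrite in_itv /= andbT.
rewrite lerNl ltW// (le_lt_trans (ler_norm _))// normrN archi_boundP//.
Qed.

Let uniq_half (m1 m2 : {measure set (measurableTypeR R) -> \bar R}) :
  (forall a : R, m1 `[a, +oo[%classic = m2 `[a, +oo[%classic) ->
  m1 setT < +oo ->
  forall E, measurable E -> m1 E = m2 E.
Proof.
move=> h hf E mE.
apply: (measure_unique Gi (fun k : nat => `[(- k%:R : R)%R, +oo[%classic)) => //.
- exact: RGenCInfty.measurableE.
- by move=> i; eexists.
- by move=> _ [x ->].
- move=> k; apply: le_lt_trans hf; apply: le_measure; rewrite ?inE//.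
Qed.

Let pq_indep (B C : set R) : measurable B -> measurable C ->
  P (p @^-1` B `&` q @^-1` C) = P B * P C.
Proof.
have mpre (f : R -> R) (E : set R) : measurable_fun setT f -> measurable E ->
    measurable (f @^-1` E : set (measurableTypeR R)).
  by move=> mf mE; have := mf measurableT _ mE; rewrite setTI.
have Pfin (E : set R) : measurable E -> P E = (fine (P E))%:E.
  move=> mE; rewrite fineK// ge0_fin_numE//.
  by rewrite (le_lt_trans (probability_le1 P mE)) ?ltey.
have prep (E : set R) (mE : measurable (E : set (measurableTypeR R)))
    (f : measurableTypeR R -> measurableTypeR R) (mf : measurable_fun setT f)
    (r : R) (r0 : (0 <= r)%R) :
    (forall a : R, P (f @^-1` `[a, +oo[%classic `&` E) = P `[a, +oo[%classic * r%:E) ->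
    forall B, measurable B -> P (f @^-1` B `&` E) = P B * r%:E.
  move=> h B' mB'.
  pose m1 : {measure set (measurableTypeR R) -> \bar R} :=
    pushm (mrestr P mE) mf.
  pose m2 : {measure set (measurableTypeR R) -> \bar R} :=
    mscale (NngNum r0) P.
  have := @uniq_half m1 m2 _ _ B' mB'.
  rewrite /m1 /m2 /= /mscale /= /pushforward /mrestr /= muleC; apply.
    by move=> a; rewrite h muleC.
  rewrite preimage_setT setTI (le_lt_trans (probability_le1 P mE))// ltey//.
move=> mB mC.
have half (a : R) : [set x | (a <= p x)%R] = p @^-1` `[a, +oo[%classic.
  by apply/seteqP; split => x /=; rewrite in_itv /= andbT.
have half' (a : R) : [set x | (a <= q x)%R] = q @^-1` `[a, +oo[%classic.
  by apply/seteqP; split => x /=; rewrite in_itv /= andbT.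
rewrite (Pfin C)//; apply: (prep (q @^-1` C)) => //.
- exact: mpre.
- exact: fine_ge0.
move=> a; rewrite -Pfin// setIC muleC (Pfin `[a, +oo[%classic); last exact: measurable_itv.
apply: (prep (p @^-1` `[a, +oo[%classic)) => //.
- by apply: mpre => //; exact: measurable_itv.
- exact: fine_ge0.
by move=> a'; rewrite -Pfin ?measurable_itv// setIC -half -half' pq_half !P_half -EFinM mulrC.
Qed.

Let seqf (x : R) : cube R := fun n => exist _ (p (iter n q x)) (p01 (iter n q x)).

Let mseqf : measurable_fun setT (seqf : measurableTypeR R -> cube R).
Proof.
apply: (@measurability _ _ _ _ _ _ (@cylinders R)) => //.
move=> _ [_ [i [B [mB ->]]] <-]; rewrite setTI.
have mit : measurable_fun setT (fun x => p (iter i q x)).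
  apply: measurableT_comp => //; elim: i => [|i ih]; first exact: measurable_id.
  exact: (measurableT_comp mq ih).
by have := mit measurableT _ mB; rewrite setTI.
Qed.

Let S n (A' : nat -> set R) : set (measurableTypeR R) :=
  [set x | forall i, (i < n)%N -> A' i (p (iter i q x))].

Let SS n A' : S n.+1 A' = p @^-1` (A' 0%N) `&` q @^-1` (S n (A' \o succn)).
Proof.
apply/seteqP; split => x.
  by move=> h; split => [|i ? /=]; [exact: (h 0%N)|rewrite -iterSr; exact: h].
by move=> [h0 h] [_ //|i ? ]; rewrite iterSr; exact: h.
Qed.

Let mS n A' : (forall i, measurable (A' i)) -> measurable (S n A').
Proof.
elim: n A' => [A' _|n ih A' mA'].
  by have -> : S 0 A' = setT by apply/seteqP; split.
rewrite SS; apply: measurableI.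
  by have := mp measurableT (mA' 0%N); rewrite setTI.
by have := mq measurableT (ih _ (fun i => mA' i.+1)); rewrite setTI.
Qed.

Let PS n A' : (forall i, measurable (A' i)) ->
  P (S n A') = \prod_(i < n) P (A' i).
Proof.
elim: n A' => [A' _|n ih A' mA'].
  have -> : S 0 A' = setT by apply/seteqP; split.
  by rewrite big_ord0 P1.
rewrite SS pq_indep//; last exact: (mS _ (fun i => mA' i.+1)).
by rewrite big_ord_recl ih // => i; exact: mA'.
Qed.

Let Q : set (cube R) -> \bar R := pushforward P seqf.
Let Qm := pushm P mseqf.
Let Q0 : Q set0 = 0. Proof. exact: (measure0 Qm). Qed.
Let Q_ge0 E : 0 <= Q E. Proof. exact: (measure_ge0 Qm). Qed.
Let Q_sigma : semi_sigma_additive Q.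
Proof. exact: (@measure_semi_sigma_additive _ _ _ Qm). Qed.
HB.instance Definition _ := isMeasure.Build _ _ _ Q Q0 Q_ge0 Q_sigma.
Let Q1 : Q setT = 1. Proof. exact: P1. Qed.
HB.instance Definition _ := Measure_isProbability.Build _ _ _ Q Q1.

Lemma product_lebesgue_exists :
  exists mu : probability (cube R) R, is_product_lebesgue mu.
Proof. by exists Q => n A' mA'; exact: PS. Qed.

End product_lebesgue_existence.

Definition cube_measure (R : realType) : probability (cube R) R :=
  sval (cid (product_lebesgue_exists R)).

Lemma cube_measureP (R : realType) : is_product_lebesgue (cube_measure R).
Proof. exact: svalP (cid (product_lebesgue_exists R)). Qed.

Section gamma_space.
Variables (R : realType) (X : completeNormedModType R).
Implicit Types (f : cube R -> X) (t : cube R).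

Definition move_coord t (j : nat) (s : unit_interval R) : cube R :=
  fun i => if i == j then s else t i.

(* The increment is restricted to [0,1] by the type of s, so the limit as
   s --> t j is one-sided when t j is 0 or 1. *)
Definition partial_quotient (j : nat) f t (s : unit_interval R) : X :=
  (\val s - \val (t j))^-1 *: (f (move_coord t j s) - f t).

Definition partial_derivable (j : nat) f t : Prop :=
  cvg (partial_quotient j f t s @[s --> (t j)^']).

Definition partial (j : nat) f t : X :=
  lim (partial_quotient j f t s @[s --> (t j)^']).

Definition gamma_smooth f : Prop :=
  continuous f /\
  forall j, (forall t, partial_derivable j f t) /\ continuous (partial j f).

Record gamma_space := GammaSpace {
  gamma_fun :> cube R -> X;
  gamma_funP : gamma_smooth gamma_fun }.

HB.instance Definition _ := gen_eqMixin gamma_space.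
HB.instance Definition _ := gen_choiceMixin gamma_space.

(* gamma_seminorm 0 is the sup norm of f, gamma_seminorm j.+1 that of the
   partial derivative with respect to the coordinate of index j. *)
Definition gamma_seminorm (k : nat) f : R :=
  if k is j.+1 then sup (range (fun t => `|partial j f t|))
  else sup (range (fun t => `|f t|)).

Definition gamma_ball (n : nat) (e : R) (g : gamma_space) : set gamma_space :=
  [set h : gamma_space | forall k, (k <= n)%N ->
    gamma_seminorm k (fun t => h t - g t) < e].

Definition gamma_open : set (set gamma_space) :=
  [set U | forall g, U g ->
    exists (n : nat) (e : R), 0 < e /\ gamma_ball n e g `<=` U].

Lemma gamma_openT : gamma_open setT.
Proof. by move=> g _; exists 0, 1; split. Qed.

Lemma gamma_openI : setI_closed gamma_open.
Proof.
move=> U V oU oV g [/oU[n [e [e0 nU]]] /oV[m [d [d0 mV]]]].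
exists (maxn n m), (Num.min e d); split; first by rewrite lt_min e0 d0.
move=> h gh; split; [apply: nU|apply: mV] => k kn.
  have /gh : (k <= maxn n m)%N by rewrite leq_max kn.
  by rewrite lt_min => /andP[].
have /gh : (k <= maxn n m)%N by rewrite leq_max kn orbT.
by rewrite lt_min => /andP[].
Qed.

Lemma gamma_open_bigU (I : Type) (U : I -> set gamma_space) :
  (forall i, gamma_open (U i)) -> gamma_open (\bigcup_i U i).
Proof.
move=> oU g [i _ /oU[n [e [e0 nU]]]]; exists n, e; split => // h /nU Uh.
by exists i.
Qed.

HB.instance Definition _ := isOpenTopological.Build gamma_space
  gamma_openT gamma_openI gamma_open_bigU.

End gamma_space.

Definition residual (T : topologicalType) (A : set T) : Prop :=
  exists2 S : set T, Gdelta_dense S & S `<=` A.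

Section gamma_null.
Variables (R : realType) (X : completeNormedModType R).

Definition gamma_null_borel (N : set X) : Prop :=
  exists2 A : set (gamma_space X), residual A &
    forall g, A g -> cube_measure R [set t | N (g t)] = 0%E.

Definition gamma_null (E : set X) : Prop :=
  exists N : set X, [/\ <<s open >> N, gamma_null_borel N & E `<=` N].

(* The operator norm of a bounded linear functional. *)
Definition dual_norm (phi : X -> R) : R :=
  sup [set `|phi x| | x in [set x : X | `|x| <= 1]].

Definition separable_dual : Prop :=
  exists D : set {linear X -> R^o},
    [/\ countable D, (forall phi, D phi -> continuous phi) &
      forall phi : {linear X -> R^o}, continuous phi ->
      forall e : R, 0 < e ->
      exists2 psi, D psi & dual_norm (fun x => phi x - psi x) < e].

Definition convex_on (G : set X) (f : X -> R) : Prop :=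
  forall x y : X,
    (forall l : R, 0 <= l <= 1 -> G (l *: x + (1 - l) *: y)) ->
    forall l : R, 0 <= l <= 1 ->
      f (l *: x + (1 - l) *: y) <= l * f x + (1 - l) * f y.

End gamma_null.
Arguments separable_dual {R} X.

(* Main.v *)
Require Import Defs.
From HB Require Import structures.
From mathcomp Require Import all_boot all_order all_algebra.
From mathcomp Require Import all_classical all_reals all_analysis.
From mathcomp Require Import finmap measurable_realfun borel_hierarchy ring lra zify.
Set Implicit Arguments.
Unset Strict Implicit.
Unset Printing Implicit Defensive.
Import Order.TTheory GRing.Theory Num.Theory.
Import numFieldNormedType.Exports.
Local Open Scope classical_set_scope.
Local Open Scope ring_scope.

(* Since [X] has a separable dual, the points of nondifferentiability are covered
   by countably many closed sets [C], on which [f] is uniformly Lipschitz and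
   uniformly rough and a fixed functional [d] is a near subgradient.  The measure
   of the preimage of [C] under a surface is upper semicontinuous, so it suffices
   that surfaces with small preimage are dense.  Otherwise take, in an open set of
   surfaces, an almost minimizing one depending on finitely many coordinates.
   Split the cube into small cells; most cells meeting the preimage have all their
   subcells meeting it.  On such a cell the surface is nearly affine; push it there
   by a bump in a direction in which [f], at the center, grows faster than its
   linearization.  By convexity at least one of every two symmetric subcells then
   leaves [C].  The bumps are [C^1]-small because their height is a small multiple
   of the cell size, and the measure of the preimage drops by a fixed factor. *)

(** * The Hahn-Banach theorem *)

Section hahn_banach.
Variables (R : realType) (V : lmodType R).

Definition sublinear (p : V -> R) :=
  (forall (c : R) (u : V), 0 < c -> p (c *: u) = c * p u) /\
  (forall u v : V, p (u + v) <= p u + p v).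

Definition dominated_graph (p : V -> R) (A : set (V * R)) :=
  (forall (c : R) (x y : V * R), A x -> A y ->
     A (c *: x.1 + y.1, c * x.2 + y.2)) /\
  (forall x : V * R, A x -> x.2 <= p x.1).

Lemma sublinear0 p : sublinear p -> p 0 = 0.
Proof.
move=> [pZ _]; have : p (2 *: 0) = 2 * p 0 by exact: pZ.
by rewrite scaler0; lra.
Qed.

Lemma dominated_graph_extend p (A : set (V * R)) (v : V) :
  sublinear p -> dominated_graph p A -> A !=set0 ->
  exists2 a : R, dominated_graph p
    [set z | exists (c : R) (x : V * R), A x /\
       z = (c *: v + x.1, c * a + x.2)] &
    forall z : V * R, A z -> exists (c : R) (x : V * R), A x /\
       z = (c *: v + x.1, c * a + x.2).
Proof.
move=> [pZ pD] [Al Ap] [x0 Ax0].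
have A2 x y : A x -> A y -> A (x.1 + y.1, x.2 + y.2).
  by move=> Ax Ay; have := Al 1 _ _ Ax Ay; rewrite scale1r mul1r.
have A0 : A (0, 0).
  have := Al (-1) _ _ Ax0 Ax0.
  by rewrite scaleN1r mulN1r !addNr.
have AZ c x : A x -> A (c *: x.1, c * x.2).
  by move=> Ax; have := Al c _ _ Ax A0; rewrite !addr0.
pose B := [set x.2 - p (x.1 - v) | x in A].
have Bub y : A y -> ubound B (p (y.1 + v) - y.2).
  move=> Ay _ [x Ax <-].
  have /= := Ap _ (A2 _ _ Ax Ay).
  have -> : x.1 + y.1 = (x.1 - v) + (y.1 + v) by rewrite addrACA addNr addr0.
  by have := pD (x.1 - v) (y.1 + v); lra.
have Bsup : has_sup B.
  split; first by exists (0 - p (0 - v)); exists (0, 0).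
  by exists (p (0 + v) - 0); exact: (Bub (0, 0)).
pose a := sup B.
have alo x : A x -> x.2 - a <= p (x.1 - v).
  move=> Ax; have : x.2 - p (x.1 - v) <= a.
    by apply: ub_le_sup; [case: Bsup|exists x].
  by lra.
have ahi y : A y -> y.2 + a <= p (y.1 + v).
  move=> Ay; have : a <= p (y.1 + v) - y.2.
    by apply: ge_sup; [case: Bsup|exact: Bub].
  by lra.
exists a; last by move=> z Az; exists 0, z; rewrite scale0r mul0r !add0r -surjective_pairing.
split.
  move=> c _ _ [c1 [x1 [Ax1 ->]]] [c2 [x2 [Ax2 ->]]] /=.
  exists (c * c1 + c2), (c *: x1.1 + x2.1, c * x1.2 + x2.2); split; first exact: Al.
  congr (_, _); last by rewrite /=; ring.
  by rewrite /= scalerDr scalerA scalerDl addrACA.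
move=> _ [c [x [Ax ->]]] /=.
have [c0|c0|->] := ltrgtP c 0; last by rewrite scale0r mul0r !add0r; exact: Ap.
- have := alo _ (AZ (- c)^-1 _ Ax); rewrite /=.
  have nc0 : 0 < - c by rewrite oppr_gt0.
  rewrite -(ler_pM2l nc0) -pZ// scalerBr scalerA mulfV ?gt_eqF// scale1r.
  rewrite scaleNr opprK mulrBr mulrA mulfV ?gt_eqF// mul1r mulNr opprK.
  by rewrite addrC [x.1 + _]addrC.
- have := ahi _ (AZ c^-1 _ Ax); rewrite /=.
  rewrite -(ler_pM2l c0) -pZ// scalerDr scalerA mulfV ?gt_eqF// scale1r.
  rewrite mulrDr mulrA mulfV ?gt_eqF// mul1r.
  by rewrite addrC [x.1 + _]addrC.
Qed.

Theorem hahn_banach_graph p (A0 : set (V * R)) :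
  sublinear p -> dominated_graph p A0 -> A0 (0, 0) ->
  exists phi : {linear V -> R^o},
    (forall u, phi u <= p u) /\ (forall x, A0 x -> phi x.1 = x.2).
Proof.
move=> sp dA0 A00.
pose P (A : set (V * R)) := dominated_graph p A /\ (A !=set0 -> A0 `<=` A).
have [F FP Ftot|A [[dA AA0] Amax]] := @Zorn_bigcup _ P.
  split; [split|].
  - move=> c x y [B FB Bx] [C FC Cy].
    have [BC|CB] := Ftot _ _ FB FC.
      by exists C => //; have [[+ _] _] := FP _ FC; apply => //; exact: BC.
    by exists B => //; have [[+ _] _] := FP _ FB; apply => //; exact: CB.
  - by move=> x [B FB Bx]; have [[_ +] _] := FP _ FB; exact.
  - move=> [x [B FB Bx]] y A0y; exists B => //.
    by have [_ +] := FP _ FB; apply => //; exists x.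
have Ane : A !=set0.
  apply: contrapT => nA; apply: (Amax A0); last by split => // _ [].
  split; first by move=> x Ax; exfalso; apply: nA; exists x.
  by move=> /(_ _ A00) Ax; apply: nA; exists (0, 0).
have A0A := AA0 Ane.
have Atot v : exists a, A (v, a).
  have [a da Aa] := dominated_graph_extend v sp dA Ane.
  exists a; set A' := [set z | _] in da.
  have AA' : A `<=` A' by [].
  have : ~ (A `<` A').
    move=> AA'lt; apply: (Amax _ AA'lt); split => // _.
    exact: subset_trans A0A AA'.
  move=> nAA'; apply: contrapT => nAv; apply: nAA'; split => // A'A.
  apply: nAv; apply: A'A; exists 1, (0, 0); split; first exact: A0A.
  by rewrite scale1r mul1r !addr0.
have [Al Ap] := dA.
have Auniq v a b : A (v, a) -> A (v, b) -> a = b.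
  have key c d : A (v, c) -> A (v, d) -> c <= d.
    move=> Ac Ad; have := Ap _ (Al (-1) _ _ Ad Ac).
    rewrite /= scaleN1r mulN1r addNr sublinear0//; lra.
  by move=> Aa Ab; apply/eqP; rewrite eq_le !key.
pose phi v : R^o := sval (cid (Atot v)).
have phiP v : A (v, phi v) by exact: svalP (cid (Atot v)).
have phil : linear phi.
  move=> c u v; apply: (Auniq (c *: u + v)) => //.
  exact: (Al c _ _ (phiP u) (phiP v)).
pose phiL : {linear V -> R^o} := HB.pack phi (@GRing.isLinear.Build _ _ _ _ phi phil).
exists phiL; split; first by move=> u; exact: (Ap _ (phiP u)).
move=> [v a] /A0A Ava; exact: (Auniq v).
Qed.

Corollary hahn_banach p : sublinear p ->
  exists phi : {linear V -> R^o}, forall u, phi u <= p u.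
Proof.
move=> sp; have [] := @hahn_banach_graph p [set (0, 0)] sp _ erefl.
  split; first by move=> c _ _ -> ->; rewrite /= scaler0 mulr0 !addr0.
  by move=> _ -> /=; rewrite sublinear0.
by move=> phi [phip _]; exists phi.
Qed.

End hahn_banach.

Lemma norming_functional (R : realType) (X : normedModType R) (z : X) :
  exists phi : {linear X -> R^o}, (forall u, `|phi u| <= `|u|) /\ phi z = `|z|.
Proof.
pose A0 := [set x : X * R | exists c : R, x = (c *: z, c * `|z|)].
have [] := @hahn_banach_graph R X (fun x => `|x|) A0.
- split; last exact: ler_normD.
  by move=> c u c0; rewrite normrZ gtr0_norm.
- split.
    move=> c _ _ [a ->] [b ->]; exists (c * a + b).
    by rewrite /= scalerA mulrA -scalerDl -mulrDl.
  by move=> _ [c ->] /=; rewrite normrZ ler_wpM2r// ler_norm.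
- by exists 0; rewrite scale0r mul0r.
move=> phi [phile phiA]; exists phi; split; last first.
  by have := phiA (z, `|z|); apply; exists 1; rewrite scale1r mul1r.
move=> u; rewrite ler_norml phile andbT lerNl -linearN -normrN.
exact: phile.
Qed.

(* Reduces vector identities in [X] to ring identities in [R]. *)
Lemma functional_ext (R : realType) (X : normedModType R) (a b : X) :
  (forall phi : X -> R, (forall x y, phi (x + y) = phi x + phi y) ->
    (forall x, phi (- x) = - phi x) -> (forall c x, phi (c *: x) = c * phi x) ->
    phi 0 = 0 -> phi a = phi b) -> a = b.
Proof.
move=> h; have [phi [_ phiz]] := norming_functional (a - b).
apply/eqP; rewrite -subr_eq0 -normr_eq0 -phiz linearB subr_eq0; apply/eqP.
apply: (h phi).
- exact: linearD.
- exact: linearN.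
- by move=> c x; rewrite linearZ.
- exact: linear0.
Qed.

Ltac vector_ring :=
  apply: functional_ext;
  let phi := fresh in let pD := fresh in let pN := fresh in
  let pZ := fresh in let p0 := fresh in
  intros phi pD pN pZ p0; rewrite ?(pD, pN, pZ, p0); first [ring | by field].

(** * The cube and its smooth surfaces *)

Section cube_topology.
Variable R : realType.
Implicit Types s t : cube R.

Definition uval (x : unit_interval R) : R := \val x.

Lemma uval_inj : injective uval.
Proof. exact: val_inj. Qed.

Definition cube_near (k : nat) (e : R) t s : Prop :=
  forall i, (i < k)%N -> `|uval (s i) - uval (t i)| < e.

Lemma unit_intervalP (x : unit_interval R) : 0 <= uval x <= 1.
Proof. by case: x => x h; rewrite /uval /=; move: (set_mem h); rewrite /= in_itv. Qed.

Lemma unit_interval_nbhs (x : unit_interval R) (e : R) : 0 < e ->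
  open_nbhs x [set y : unit_interval R | `|uval x - uval y| < e].
Proof.
move=> e0; split; last by rewrite /= subrr normr0.
exists (ball (uval x : R) e); first exact: ball_open.
by apply/seteqP; split.
Qed.

Lemma coord_near i (t : cube R) (e : R) : 0 < e ->
  nbhs t [set s : cube R | `|uval (t i) - uval (s i)| < e].
Proof.
move=> e0; have [oW tW] := unit_interval_nbhs (t i) e0.
set W := [set y | _] in oW tW.
pose F : set_system (cube R) := nbhs t.
have FF : Filter F by exact: nbhs_filter.
have Ft : F --> t by exact: cvg_id.
have h := (@cvg_sup (cube R) nat _ F t FF).1 Ft i.
apply: (h [set s | W (s i)]).
exists [set s | W (s i)]; split => //.
by exists W.
Qed.

Lemma coord_continuous i : continuous (fun t : cube R => uval (t i) : R).
Proof.
move=> t B /nbhs_ballP[e /= e0 eB].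
by apply: (filterS _ (coord_near i t e0)) => s; exact: eB.
Qed.

Lemma nbhs_cubeP t (A : set (cube R)) : nbhs t A <->
  exists (k : nat) (e : R), 0 < e /\ cube_near k e t `<=` A.
Proof.
split; last first.
  move=> [k [e [e0 kA]]]; apply: filterS kA _.
  suff H : forall j, (j <= k)%N -> nbhs t (cube_near j e t) by exact: (H k).
  elim=> [_|j IH jk]; first by apply: filterE => s i.
  have h1 := IH (ltnW jk).
  apply: filterS2 h1 (coord_near j t e0) => s h1 h2 i; rewrite ltnS leq_eqVlt => /orP[/eqP ->|].
    by rewrite distrC.
  exact: h1.
pose F : set_system (cube R) :=
  [set B | exists (k : nat) (e : R), 0 < e /\ cube_near k e t `<=` B].
have FF : Filter F.
  split.
  - by exists 0%N, 1; split => // s.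
  - move=> P Q [k [e [e0 kP]]] [l [d [d0 lQ]]].
    exists (maxn k l), (Num.min e d); split; first by rewrite lt_min e0.
    move=> s st; split; [apply: kP|apply: lQ] => i ik.
      by have := st i; rewrite leq_max ik lt_min => /(_ isT) /andP[].
    by have := st i; rewrite leq_max ik orbT lt_min => /(_ isT) /andP[].
  - move=> P Q PQ [k [e [e0 kP]]]; exists k, e; split => //.
    exact: subset_trans kP PQ.
suff : F --> t by move=> /(_ A).
apply/(@cvg_sup (cube R) nat _ F t) => i B [_ [[W oW <-] /= Wt WB]].
have [V /= oV VW] := oW.
have Vt : V (uval (t i)) by rewrite -VW in Wt.
move: oV; rewrite openE => /(_ _ Vt); rewrite /interior => /nbhs_ballP[e /= e0 eV].
exists i.+1, e; split => // s st; apply: WB => /=; rewrite -VW /=.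
by apply: eV; rewrite /ball /= distrC; exact: st.
Qed.

Lemma nbhs_unit_intervalP (x : unit_interval R) (B : set (unit_interval R)) :
  nbhs x B <-> exists e : R, 0 < e /\ forall y, `|uval y - uval x| < e -> B y.
Proof.
split; last first.
  move=> [e [e0 eB]]; apply: filterS (_ : nbhs x [set y | `|uval x - uval y| < e]).
    by move=> y; rewrite /= distrC; exact: eB.
  exact: (@cvgr_dist_lt _ _ _ _ _ _ _ (@initial_continuous _ _ set_val x)).
move=> [_ [[W oW <-] /= Wt WB]].
move: oW; rewrite openE => /(_ _ Wt); rewrite /interior => /nbhs_ballP[e /= e0 eV].
exists e; split => // s st; apply: WB => /=.
by apply: eV; rewrite /ball /= distrC.
Qed.

Lemma clip_subproof (x : R) : Num.max 0 (Num.min 1 x) \in (`[0, 1]%classic : set R).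
Proof.
by apply/mem_set; rewrite /= in_itv /= le_max lexx /= ge_max ler01 /= ge_min lexx.
Qed.

Definition clip (x : R) : unit_interval R :=
  exist (fun y : R => y \in (`[0, 1]%classic : set R)) _ (clip_subproof x).

Lemma clipE (x : R) : 0 <= x <= 1 -> uval (clip x) = x.
Proof. by move=> /andP[x0 x1]; rewrite /uval /= min_r// max_r. Qed.

Lemma clipK (x : unit_interval R) : clip (uval x) = x.
Proof. by apply/uval_inj; rewrite clipE// unit_intervalP. Qed.

Lemma clip_dist (x y : R) : `|uval (clip x) - uval (clip y)| <= `|x - y|.
Proof.
rewrite /uval /= /Num.max /Num.min.
case: (ltP 1 x) => ?; case: (ltP 1 y) => ?; rewrite ?ltr01;
case: (ltP 0 x) => ?; case: (ltP 0 y) => ?;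
rewrite ler_norml; have := ler_norm (x - y); have := lerNnormlW (lexx `|x - y|); lra.
Qed.

Lemma clip_continuous : continuous clip.
Proof.
move=> x B /nbhs_unit_intervalP[e [e0 eB]].
apply/nbhs_ballP; exists e => //= y; rewrite /ball /= => xy.
by apply: eB; apply: le_lt_trans (clip_dist _ _) _; rewrite distrC.
Qed.

Lemma cube_compact : compact [set: cube R].
Proof.
have cI : compact [set: unit_interval R].
  have -> : [set: unit_interval R] = clip @` `[0, 1]%classic.
    apply/seteqP; split => // x _; exists (uval x); last exact: clipK.
    by rewrite /= in_itv /= unit_intervalP.
  apply: continuous_compact; last exact: segment_compact.
  by apply: continuous_subspaceT; exact: clip_continuous.
have := @tychonoff nat (fun=> unit_interval R) (fun=> setT) (fun=> cI).
by congr compact; apply/seteqP; split.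
Qed.

Lemma cube_uniform_continuous (X : normedModType R) (F : cube R -> X) :
  continuous F -> forall e : R, 0 < e -> exists (k : nat) (d : R), 0 < d /\
  forall t s, cube_near k d t s -> `|F s - F t| < e.
Proof.
move=> cF e e0.
have [|N _ NP] := (compact_near_coveringP [set: cube R]).1 cube_compact nat \oo
  (fun k t => forall s, cube_near k k.+1%:R^-1 t s -> `|F s - F t| < e) _.
  move=> x _; have : nbhs x [set s | `|F x - F s| < e / 2].
    by apply: (@cvgr_dist_lt _ _ _ _ _ _ _ (cF x)); rewrite divr_gt0.
  move=> /nbhs_cubeP[k [d [d0 kd]]].
  have d20 : 0 < d / 2 by rewrite divr_gt0.
  have [N _ NP] : \forall n \near \oo, n.+1%:R^-1 < d / 2 by exact: (near_infty_natSinv_lt (PosNum d20)).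
  exists (cube_near k (d / 2) x, [set n | (maxn N k <= n)%N]) => /=.
    split; first by apply/nbhs_cubeP; exists k, (d / 2); split.
    by exists (maxn N k).
  move=> [t n] /= [xt]; rewrite geq_max => /andP[Nn kn] s ts.
  have Fxt : `|F x - F t| < e / 2.
    by apply: kd => i ik; have := xt _ ik; lra.
  have Fxs : `|F x - F s| < e / 2.
    apply: kd => i ik; have h1 := xt _ ik; have h2 := ts _ (leq_trans ik kn).
    have h3 : n.+1%:R^-1 < d / 2 by exact: (NP _ Nn).
    have h4 := ler_distD (uval (t i)) (uval (s i)) (uval (x i)).
    apply: le_lt_trans h4 _; rewrite [ltRHS](splitr d) ltrD//.
    exact: lt_trans h2 h3.
  apply: le_lt_trans (ler_distD (F x) _ _) _; rewrite [ltRHS](splitr e) ltrD//.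
  by rewrite distrC.
exists N, N.+1%:R^-1; split; first by rewrite invr_gt0.
move=> t s; exact: (NP N (leqnn N) t Logic.I s).
Qed.

Lemma cube_bounded (X : normedModType R) (F : cube R -> X) :
  continuous F -> exists2 M : R, 0 <= M & forall t, `|F t| <= M.
Proof.
move=> cF; have := continuous_compact (continuous_subspaceT cF) cube_compact.
move=> /compact_bounded [M [_ MP]].
exists (Num.max 0 (M + 1)); first by rewrite le_max lexx.
move=> t; apply: MP; last by exists t.
by rewrite lt_max; apply/orP; right; rewrite ltrDl.
Qed.

End cube_topology.

Lemma unit_point_near (R : realType) (x d : R) : 0 <= x <= 1 -> 0 < d ->
  exists y : R, [/\ 0 <= y <= 1, y != x & `|y - x| < d].
Proof.
move=> /andP[x0 x1] d0.
have [h [h0 h1 h2]] : exists h : R, [/\ 0 < h, h < d & h <= 1 / 2].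
  have [d1|d1] := leP d 1; [exists (d / 2)|exists (1 / 2)]; split; lra.
have [xl|xg] := leP x (1 / 2).
  exists (x + h); split; [lra|by apply/eqP; lra|].
  by rewrite addrC addKr gtr0_norm.
exists (x - h); split; [lra|by apply/eqP; lra|].
by rewrite addrC addKr normrN gtr0_norm.
Qed.

Lemma cube_continuousP (R : realType) (X : normedModType R) (F : cube R -> X) :
  continuous F <-> forall t (e : R), 0 < e -> exists (k : nat) (d : R), 0 < d /\
    forall s, cube_near k d t s -> `|F s - F t| < e.
Proof.
split=> [cF t e e0|h t B /nbhs_ballP[e /= e0 eB]].
  have : nbhs t [set s | `|F t - F s| < e].
    by apply: (@cvgr_dist_lt _ _ _ _ _ _ _ (cF t)).
  move=> /nbhs_cubeP[k [d [d0 kd]]]; exists k, d; split => // s ts.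
  by rewrite distrC; exact: kd.
have [k [d [d0 kd]]] := h t e e0.
apply/nbhs_cubeP; exists k, d; split => // s /kd Fst; apply: eB.
by rewrite -ball_normE /= distrC.
Qed.

Section partial_derivatives.
Variables (R : realType) (X : completeNormedModType R).
Implicit Types (f g : cube R -> X) (t : cube R) (l : X).

Definition is_partial (j : nat) f t l := forall e : R, 0 < e ->
  exists2 d : R, 0 < d & forall s : unit_interval R,
    `|uval s - uval (t j)| < d ->
    `|f (move_coord t j s) - f t - (uval s - uval (t j)) *: l| <=
    e * `|uval s - uval (t j)|.

Lemma move_coord_id t j : move_coord t j (t j) = t.
Proof. by apply/funext => i; rewrite /move_coord; case: eqP => // ->. Qed.

Lemma move_coordE t j s : move_coord t j s j = s.
Proof. by rewrite /move_coord eqxx. Qed.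

Lemma move_coordK t j s s' : move_coord (move_coord t j s) j s' = move_coord t j s'.
Proof. by apply/funext => i; rewrite /move_coord; case: eqP. Qed.

Lemma quotient_dist j f t l s : s != t j ->
  `|uval s - uval (t j)| * `|partial_quotient j f t s - l| =
  `|f (move_coord t j s) - f t - (uval s - uval (t j)) *: l|.
Proof.
move=> st; have h0 : uval s - uval (t j) != 0.
  by rewrite subr_eq0; apply: contra st => /eqP/uval_inj ->.
rewrite -normrZ scalerBr /partial_quotient -/(uval s) -/(uval (t j)) scalerA mulfV// scale1r.
by [].
Qed.

Lemma is_partialP j f t l :
  is_partial j f t l <-> partial_quotient j f t s @[s --> (t j)^'] --> l.
Proof.
split=> [h B /nbhs_ballP[e /= e0 eB]|h e e0].
  have [d d0 dP] := h (e / 2) (divr_gt0 e0 (ltr0Sn R 1)).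
  rewrite /nbhs /= /dnbhs /within /=; apply/nbhs_unit_intervalP.
  exists d; split => // s sd /= st; apply: eB.
  rewrite -ball_normE /= distrC.
  have h0 : 0 < `|uval s - uval (t j)|.
    by rewrite normr_gt0 subr_eq0; apply: contra st => /eqP/uval_inj ->.
  rewrite -(ltr_pM2l h0) quotient_dist//.
  by have := dP _ sd; nra.
have := h _ (nbhsx_ballx l _ e0).
rewrite /nbhs /= /dnbhs /within /= => /nbhs_unit_intervalP[d [d0 dP]].
exists d => // s sd; have [st|st] := eqVneq s (t j).
  by rewrite st move_coord_id !subrr scale0r subr0 !normr0 mulr0.
have := dP _ sd st; rewrite -ball_normE /= distrC => hh.
by rewrite -quotient_dist// mulrC ler_wpM2r// ltW.
Qed.

Lemma unit_interval_dnbhs (x : unit_interval R) : ProperFilter x^'.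
Proof.
apply: Build_ProperFilter_ex => A.
rewrite /dnbhs /within /= => /nbhs_unit_intervalP[d [d0 dP]].
have [y [y01 yx yd]] := unit_point_near (unit_intervalP x) d0.
exists (clip y); apply: dP; first by rewrite clipE.
by apply: contra yx => /eqP/(congr1 (@uval R)); rewrite clipE// => ->.
Qed.

Lemma is_partial_eq j f t l : is_partial j f t l ->
  partial_derivable j f t /\ partial j f t = l.
Proof.
move=> /is_partialP h; split; first by apply/cvg_ex; exists l.
have PF := unit_interval_dnbhs (t j).
by apply: cvg_lim => //; exact: norm_hausdorff.
Qed.

Lemma partial_is_partial j f t : partial_derivable j f t ->
  is_partial j f t (partial j f t).
Proof. by move=> h; apply/is_partialP. Qed.

Lemma gamma_smooth_intro f (D : nat -> cube R -> X) : continuous f ->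
  (forall j t, is_partial j f t (D j t)) -> (forall j, continuous (D j)) ->
  gamma_smooth f.
Proof.
move=> cf fD cD; split => // j; split; first by move=> t; case: (is_partial_eq (fD j t)).
by have -> : partial j f = D j by apply/funext => t; case: (is_partial_eq (fD j t)).
Qed.

Lemma is_partialD j f g t l m : is_partial j f t l -> is_partial j g t m ->
  is_partial j (fun t => f t + g t) t (l + m).
Proof.
move=> hf hg e e0; have e20 : 0 < e / 2 by rewrite divr_gt0.
have [d d0 dP] := hf _ e20; have [d' d'0 d'P] := hg _ e20.
exists (Num.min d d'); first by rewrite lt_min d0.
move=> s; rewrite lt_min => /andP[/dP h1 /d'P h2].
rewrite scalerDr; set a := f _ in h1 *; set b := g _ in h2 *.
set c := _ *: l in h1 *; set c' := _ *: m in h2 *.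
rewrite (_ : a + b - _ - _ = (a - f t - c) + (b - g t - c')); last first.
  by vector_ring.
by apply: le_trans (ler_normD _ _) _; lra.
Qed.

Lemma is_partialN j f t l : is_partial j f t l ->
  is_partial j (fun t => - f t) t (- l).
Proof.
move=> hf e e0; have [d d0 dP] := hf _ e0; exists d => // s /dP.
by rewrite -normrN scalerN !opprD !opprK.
Qed.

Lemma is_partial0 j t : is_partial j (fun=> 0) t 0.
Proof.
by move=> e e0; exists 1 => // s _; rewrite scaler0 !subr0 normr0 mulr_ge0// ltW.
Qed.

Lemma is_partial_sum j (I : Type) (r : seq I) (P : pred I) (F : I -> cube R -> X)
    (D : I -> X) t : (forall i, P i -> is_partial j (F i) t (D i)) ->
  is_partial j (fun t => \sum_(i <- r | P i) F i t) t (\sum_(i <- r | P i) D i).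
Proof.
move=> h; elim: r => [|i r ih].
  have -> : (fun t => \sum_(i <- [::] | P i) F i t) = (fun=> 0).
    by apply/funext => t'; rewrite big_nil.
  by rewrite big_nil; exact: is_partial0.
rewrite big_cons; have [Pi|Pi] := boolP (P i).
  have -> : (fun t => \sum_(i <- i :: r | P i) F i t) =
      (fun t => F i t + \sum_(i <- r | P i) F i t).
    by apply/funext => t'; rewrite big_cons Pi.
  by apply: is_partialD => //; exact: h.
have -> : (fun t => \sum_(i <- i :: r | P i) F i t) =
    (fun t => \sum_(i <- r | P i) F i t).
  by apply/funext => t'; rewrite big_cons (negPf Pi).
by [].
Qed.

Lemma is_partial_quadratic j f t l (C : R) :
  (forall s : unit_interval R,
    `|f (move_coord t j s) - f t - (uval s - uval (t j)) *: l| <=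
    C * (uval s - uval (t j)) ^+ 2) -> is_partial j f t l.
Proof.
move=> h e e0; pose C' := Num.max 1 C.
have C'0 : 0 < C' by rewrite lt_max ltr01.
exists (e / C'); first by rewrite divr_gt0.
move=> s; rewrite ltr_pdivlMr// => hs; apply: le_trans (h s) _.
have CC' : C <= C' by rewrite le_max lexx orbT.
rewrite -real_normK ?num_real// expr2 mulrA ler_wpM2r//.
by apply: le_trans (ltW hs); rewrite mulrC ler_wpM2l.
Qed.

Lemma is_partial_indep j f t :
  (forall s, f (move_coord t j s) = f t) -> is_partial j f t 0.
Proof.
move=> h; apply: (@is_partial_quadratic _ _ _ _ 0) => s.
by rewrite h subrr scaler0 subr0 normr0 mul0r.
Qed.

End partial_derivatives.

Section mean_value.
Variables (R : realType) (X : completeNormedModType R).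
Implicit Types (f : cube R -> X) (t : cube R) (l : X).

Lemma partial_mean_value f (D : cube R -> X) j t (s : unit_interval R) l (e : R) :
  continuous f -> (forall t, is_partial j f t (D t)) ->
  (forall x : unit_interval R,
     `|uval x - uval (t j)| <= `|uval s - uval (t j)| ->
     `|D (move_coord t j x) - l| <= e) ->
  `|f (move_coord t j s) - f t - (uval s - uval (t j)) *: l| <=
    e * `|uval s - uval (t j)|.
Proof.
move=> cf fD De.
set z := f (move_coord t j s) - f t - _.
have [phi [phile phiz]] := norming_functional z.
pose g (x : R) : R := phi (f (move_coord t j (clip x)) - x *: l).
have cg (x : R) : {for x, continuous g}.
  apply/cvgrPdist_lt => d d0.
  have d20 : 0 < d / 2 by rewrite divr_gt0.
  have [k [d' [d'0 kd]]] := (cube_continuousP f).1 cf (move_coord t j (clip x)) _ d20.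
  apply/nbhs_ballP; exists (Num.min d' (d / 2 / (1 + `|l|))).
    by rewrite /= lt_min d'0 /= divr_gt0// ltr_pwDl.
  move=> y; rewrite /ball /= lt_min => /andP[xy1].
  rewrite ltr_pdivlMr ?ltr_pwDl// => xy2.
  rewrite -linearB; apply: le_lt_trans (phile _) _.
  have h1 : `|f (move_coord t j (clip y)) - f (move_coord t j (clip x))| < d / 2.
    apply: kd => i _; rewrite /move_coord; case: eqP => _; last by rewrite subrr normr0.
    by apply: le_lt_trans (clip_dist _ _) _; rewrite distrC.
  have -> : f (move_coord t j (clip x)) - x *: l - (f (move_coord t j (clip y)) - y *: l)
     = (f (move_coord t j (clip x)) - f (move_coord t j (clip y))) + (y - x) *: l.
    by vector_ring.
  apply: le_lt_trans (ler_normD _ _) _; rewrite normrZ distrC.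
  by rewrite (distrC y x); have := normr_ge0 (x - y); have := normr_ge0 l; nra.
have dg (x : R) : 0 < x < 1 ->
    is_derive x 1 g (phi (D (move_coord t j (clip x)) - l)).
  move=> /andP[x0 x1].
  have cx : uval (clip x) = x by rewrite clipE// !ltW.
  suff H : h^-1 *: (g (h *: 1 + x) - g x) @[h --> 0^'] -->
      (phi (D (move_coord t j (clip x)) - l) : R).
    by split; [apply/cvg_ex; eexists; exact: H|apply: cvg_lim => //; exact: H].
  apply/cvgrPdist_le => d d0.
  have [d' d'0 d'P] := fD (move_coord t j (clip x)) d d0.
  rewrite near_withinE; apply/nbhs_ballP.
  exists (Num.min d' (Num.min x (1 - x))); first by rewrite /= !lt_min d'0 x0 subr_gt0.
  move=> h; rewrite /ball /= sub0r normrN !lt_min => /and3P[h1 h2 h3] h0.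
  have h' : 0 <= h%:A + x <= 1.
    rewrite [h%:A]mulr1; have := ler_norm h; have := ler_norm (- h).
    by rewrite normrN; lra.
  have := d'P (clip (h%:A + x)); rewrite !move_coordE move_coordK clipE// cx [h%:A]mulr1 addrK.
  move=> /(_ h1) h4.
  have -> : g (h + x) - g x = phi (f (move_coord t j (clip (h + x))) -
      f (move_coord t j (clip x)) - h *: l).
    by rewrite /g -linearB; congr (phi _); vector_ring.
  have hn : 0 < `|h| by rewrite normr_gt0.
  set V := (_ - h *: l).
  rewrite (_ : h^-1 *: _ = phi (h^-1 *: V)); last by rewrite linearZ.
  rewrite -linearB {}/V; apply: le_trans (phile _) _.
  rewrite -(ler_pM2l hn) -normrZ [_ * d]mulrC; apply: le_trans h4.
  rewrite -[X in _ <= X]normrN; rewrite le_eqVlt; apply/orP; left; apply/eqP.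
  congr `|_|; set A := f _; set A' := f _; set v := D _.
  rewrite !scalerBr !scalerA !mulfV// !scale1r; vector_ring.
have gz : `|z| = g (uval s) - g (uval (t j)).
  rewrite -phiz /g -linearB !clipK move_coord_id; congr (phi _).
  by rewrite /z; vector_ring.
have [a01 s01] := (unit_intervalP (t j), unit_intervalP s).
have key (a b : R) : 0 <= a -> b <= 1 -> a < b -> (forall x : R, a <= x <= b ->
    `|D (move_coord t j (clip x)) - l| <= e) -> `|g b - g a| <= e * (b - a).
  move=> a0 b1 ab De'.
  have [|c cab ->] := @MVT R g (fun x => phi (D (move_coord t j (clip x)) - l)) a b ab _
      (continuous_subspaceT cg).
    by move=> x; rewrite in_itv /= => /andP[ax xb]; apply: dg; lra.
  have ba : 0 <= b - a by rewrite subr_ge0 ltW.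
  rewrite normrM (ger0_norm ba) ler_wpM2r//; apply: le_trans (phile _) _.
  by apply: De'; move: cab; rewrite in_itv /= => /andP[? ?]; lra.
have zge := normr_ge0 z.
have [ts|st|ts] := ltgtP (uval (t j)) (uval s).
- have := key _ _ (andP a01).1 (andP s01).2 ts _.
  rewrite -gz normr_id (gtr0_norm (_ : 0 < uval s - uval (t j))) ?subr_gt0//.
  apply => x /andP[ax xb]; apply: De; rewrite clipE; last by lra.
  by rewrite !ger0_norm; lra.
- have := key _ _ (andP s01).1 (andP a01).2 st _.
  rewrite (distrC (g _)) -gz normr_id (distrC (uval s)) (gtr0_norm (_ : 0 < uval (t j) - uval s)) ?subr_gt0//.
  apply => x /andP[ax xb]; apply: De; rewrite clipE; last by lra.
  by rewrite !ler0_norm; lra.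
- by rewrite gz ts !subrr normr0 mulr0.
Qed.
End mean_value.

Lemma common_radius (R : realType) (n : nat) (P : nat -> R -> Prop) :
  (forall j (d d' : R), 0 < d' -> d' <= d -> P j d -> P j d') ->
  (forall j, (j < n)%N -> exists2 d : R, 0 < d & P j d) ->
  exists2 d : R, 0 < d & forall j, (j < n)%N -> P j d.
Proof.
move=> Pmono; elim: n => [|n ih] h; first by exists 1.
have [d d0 dP] := ih (fun j jn => h j (ltnW jn)).
have [d' d'0 d'P] := h n (ltnSn n).
have m0 : 0 < Num.min d d' by rewrite lt_min d0.
exists (Num.min d d') => // j; rewrite ltnS leq_eqVlt => /orP[/eqP ->|jn].
  by apply: Pmono d'P => //; rewrite ge_min lexx orbT.
by apply: Pmono (dP _ jn) => //; rewrite ge_min lexx.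
Qed.

Section truncation.
Variables (R : realType) (X : completeNormedModType R).
Implicit Types (f g : cube R -> X) (t s : cube R).

Definition truncate (n : nat) t : cube R := fun i => if (i < n)%N then t i else clip 0.

Lemma trunc_id n t : truncate n (truncate n t) = truncate n t.
Proof. by apply/funext => i; rewrite /truncate; case: (ltnP i n). Qed.

Lemma cube_near_trunc n k (d : R) t s : cube_near k d t s ->  0 < d ->
  cube_near k d (truncate n t) (truncate n s).
Proof.
move=> h d0 i ik; rewrite /truncate; case: ifP => _; first exact: h.
by rewrite subrr normr0.
Qed.

Lemma continuous_trunc n f : continuous f -> continuous (fun t => f (truncate n t)).
Proof.
move=> /cube_continuousP cf; apply/cube_continuousP => t e e0.
have [k [d [d0 kd]]] := cf (truncate n t) e e0.
by exists k, d; split => // s /(@cube_near_trunc n _ _ _ _)/(_ d0); exact: kd.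
Qed.

Lemma trunc_approx f (e : R) : continuous f -> 0 < e ->
  exists N, forall n, (N <= n)%N -> forall t, `|f (truncate n t) - f t| < e.
Proof.
move=> cf e0; have [k [d [d0 kd]]] := cube_uniform_continuous cf e0.
exists k => n kn t; apply: kd => i ik.
by rewrite /truncate (leq_trans ik kn) subrr normr0.
Qed.

Lemma is_partial_trunc n f j (D : cube R -> X) t :
  (forall t, is_partial j f t (D t)) ->
  is_partial j (fun t => f (truncate n t)) t (if (j < n)%N then D (truncate n t) else 0).
Proof.
move=> fD; case: ifP => jn; last first.
  apply: is_partial_indep => s; congr (f _); apply/funext => i.
  rewrite /truncate /move_coord; case: ifP => // iln; case: eqP => // ij.
  by move: jn; rewrite -ij iln.
move=> e e0; have [d d0 dP] := fD (truncate n t) e e0.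
exists d => // s; have tj : truncate n t j = t j by rewrite /truncate jn.
have := dP s; rewrite tj => h /h.
suff -> : move_coord (truncate n t) j s = truncate n (move_coord t j s) by [].
apply/funext => i; rewrite /truncate /move_coord.
by case: eqP => [->|//]; rewrite jn.
Qed.

Lemma uniform_affine_approx f (D : nat -> cube R -> X) n (e : R) :
  continuous f -> (forall j t, is_partial j f t (D j t)) ->
  (forall j, continuous (D j)) -> 0 < e ->
  exists2 d : R, 0 < d & forall t s,
    (forall i, (i < n)%N -> `|uval (s i) - uval (t i)| < d) ->
    (forall i, (n <= i)%N -> s i = t i) ->
    `|f s - f t - \sum_(j < n) (uval (s j) - uval (t j)) *: D j t| <=
      e * \sum_(j < n) `|uval (s j) - uval (t j)|.
Proof.
move=> cf fD cD e0.
have [d d0 dP] : exists2 d : R, 0 < d & forall j, (j < n)%N ->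
    forall t s : cube R, (forall i, `|uval (s i) - uval (t i)| < d) ->
      `|D j s - D j t| < e.
  apply: (@common_radius R n (fun j d => forall t s : cube R,
    (forall i, `|uval (s i) - uval (t i)| < d) -> `|D j s - D j t| < e)).
    move=> j d d' d'0 dd' h t s ts; apply: h => i.
    exact: lt_le_trans (ts i) dd'.
  move=> j _; have [k [d [d0 kd]]] := cube_uniform_continuous (@cD j) e0.
  by exists d => // t s ts; apply: kd => i _; exact: ts.
exists d => // t s st seq.
pose h k : cube R := fun i => if (i < k)%N then s i else t i.
have hn : h n = s.
  by apply/funext => i; rewrite /h; case: ltnP => // /seq ->.
suff H k : (k <= n)%N ->
    `|f (h k) - f t - \sum_(j < k) (uval (s j) - uval (t j)) *: D j t| <=
      e * \sum_(j < k) `|uval (s j) - uval (t j)| by have := H n (leqnn n); rewrite hn.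
elim: k => [_|k ih kn].
  have -> : h 0%N = t by apply/funext => i.
  by rewrite !big_ord0 subrr subr0 normr0 mulr0.
have hk : h k.+1 = move_coord (h k) k (s k).
  apply/funext => i; rewrite /h /move_coord ltnS leq_eqVlt.
  by case: eqP => [->|] //=.
have hkk : h k k = t k by rewrite /h ltnn.
have st' i : `|uval (s i) - uval (t i)| < d.
  by case: (ltnP i n) => [/st//|/seq ->]; rewrite subrr normr0.
rewrite !big_ord_recr /= mulrDr.
have := @partial_mean_value R X f (D k) k (h k) (s k) (D k t) e cf (fD k).
rewrite -hk hkk => mv.
set S := \sum_(j < k) _ *: _; set v := _ *: D k t in mv *.
have -> : f (h k.+1) - f t - (S + v) = (f (h k) - f t - S) + (f (h k.+1) - f (h k) - v).
  by vector_ring.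
apply: le_trans (ler_normD _ _) _; apply: lerD; first exact: ih (ltnW kn).
apply: mv => x xs; apply/ltW/dP => // i.
rewrite /move_coord; case: eqP => [->|_]; first exact: le_lt_trans xs (st' k).
by rewrite /h; case: ifP => // _; rewrite subrr normr0.
Qed.

End truncation.

Section gamma_extra.
Variables (R : realType) (X : completeNormedModType R).

Lemma gamma_smooth_is_partial (f : cube R -> X) j t : gamma_smooth f ->
  is_partial j f t (partial j f t).
Proof. by move=> [_ /(_ j)[h _]]; exact: partial_is_partial. Qed.

Lemma gamma_smooth_partial_continuous (f : cube R -> X) j : gamma_smooth f ->
  continuous (partial j f).
Proof. by move=> [_ /(_ j)[]]. Qed.

Lemma gamma_smoothB (f g : cube R -> X) : gamma_smooth f -> gamma_smooth g ->
  gamma_smooth (fun t => f t - g t) /\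
  forall j t, partial j (fun t => f t - g t) t = partial j f t - partial j g t.
Proof.
move=> sf sg.
have D j t : is_partial j (fun t => f t - g t) t (partial j f t - partial j g t).
  by apply: is_partialD; [|apply: is_partialN]; exact: gamma_smooth_is_partial.
split; last by move=> j t; case: (is_partial_eq (D j t)).
have cB (u v : cube R -> X) : continuous u -> continuous v ->
    continuous (fun t => u t - v t).
  by move=> cu cv t; apply: (@cvgB _ _ _ _ _ _ _ _ _ (cu t) (cv t)).
apply: (@gamma_smooth_intro _ _ _ (fun j t => partial j f t - partial j g t)) => //.
  by apply: cB; [case: sf|case: sg].
by move=> j; apply: cB; exact: gamma_smooth_partial_continuous.
Qed.

Lemma gamma_seminorm_le (f : cube R -> X) k (M : R) :
  (forall t, `|if k is j.+1 then partial j f t else f t| <= M) ->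
  gamma_seminorm k f <= M.
Proof.
case: k => [|k] h; rewrite /gamma_seminorm; apply: ge_sup.
- by exists `|f point|, point.
- by move=> _ [t _ <-].
- by exists `|partial k f point|, point.
- by move=> _ [t _ <-].
Qed.

Lemma gamma_seminorm_ge (f : cube R -> X) k t : gamma_smooth f ->
  `|if k is j.+1 then partial j f t else f t| <= gamma_seminorm k f.
Proof.
move=> sf.
have ub (g : cube R -> X) : continuous g -> `|g t| <= sup (range (fun t => `|g t|)).
  move=> cg; have [M _ MP] := cube_bounded cg.
  apply: ub_le_sup; last by exists t.
  by exists M => _ [s _ <-].
by case: k => [|k]; apply: ub; [case: sf|exact: gamma_smooth_partial_continuous].
Qed.

Lemma gamma_ballI n (e d : R) (g h : gamma_space X) : d < e ->
  (forall t, `|h t - g t| <= d) ->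
  (forall j t, (j < n)%N -> `|partial j h t - partial j g t| <= d) ->
  gamma_ball n e g h.
Proof.
move=> de h0 h1 k kn; apply: le_lt_trans de; apply: gamma_seminorm_le => t.
case: k kn => [_|j jn]; first exact: h0.
have [_ ->] := gamma_smoothB (gamma_funP h) (gamma_funP g); exact: h1.
Qed.

Lemma gamma_ball0 n (e : R) (g h : gamma_space X) t :
  gamma_ball n e g h -> `|h t - g t| < e.
Proof.
move=> /(_ 0%N (leq0n n)); apply: le_lt_trans.
by apply: (@gamma_seminorm_ge _ 0 t); case: (gamma_smoothB (gamma_funP h) (gamma_funP g)).
Qed.

End gamma_extra.

(** * Grids and measure *)

Section real_probability.
Variables (d : measure_display) (T : measurableType d) (R : realType).
Variable P : probability T R.
Implicit Types (A B E : set T).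

Definition pr A : R := fine (P A).

Lemma prE A : measurable A -> P A = (pr A)%:E.
Proof. by move=> mA; rewrite fineK// fin_num_measure. Qed.

Lemma pr_ge0 A : 0 <= pr A.
Proof. exact/fine_ge0. Qed.

Lemma pr0 : pr set0 = 0.
Proof. by rewrite /pr measure0. Qed.

Lemma pr_le A B : measurable A -> measurable B -> A `<=` B -> pr A <= pr B.
Proof.
move=> mA mB AB; have := le_measure P (mem_set mA) (mem_set mB) AB.
by rewrite -lee_fin -(prE mA) -(prE mB).
Qed.

Lemma prU_le A B : measurable A -> measurable B -> pr (A `|` B) <= pr A + pr B.
Proof.
move=> mA mB; rewrite -lee_fin EFinD -!prE//; first exact: measureU2.
exact: measurableU.
Qed.

Lemma prD A B : measurable A -> measurable B -> B `<=` A ->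
  pr (A `\` B) = pr A - pr B.
Proof.
move=> mA mB BA; apply: EFin_inj; rewrite EFinB -!prE//; last exact: measurableD.
have fA : (P A < +oo)%E by rewrite prE// ltry.
by rewrite (measureD mA mB fA) setIidr.
Qed.

Lemma pr_cvg_down (F : (set T)^nat) (e : R) : (forall n, measurable (F n)) ->
  (forall n, F n.+1 `<=` F n) -> 0 < e ->
  exists N, forall n, (N <= n)%N -> pr (F n) < pr (\bigcap_n F n) + e.
Proof.
move=> mF Fd e0.
have mI : measurable (\bigcap_n F n) by exact: bigcapT_measurable.
have Fni : {homo F : n m / (n <= m)%N >-> (m <= n)%O}.
  by apply/nonincreasing_seqP => n; apply/subsetPset.
have F0 : (P (F 0%N) < +oo)%E by rewrite prE// ltry.
have h := nonincreasing_cvg_mu F0 mF mI Fni.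
have : \forall n \near \oo, (P (F n) < (pr (\bigcap_n F n) + e)%:E)%E.
  have : ((fine \o (P \o F)) @ \oo --> pr (\bigcap_n F n)) by apply: fine_cvg; rewrite -prE.
  move=> /cvgrPdist_lt /(_ e e0); apply: filterS => n /=; rewrite prE// lte_fin -/(pr (F n)).
  by rewrite ltr_norml => /andP[+ _]; rewrite ltrBrDl ltrBlDr addrC.
by move=> [N _ NP]; exists N => n /NP /=; rewrite prE// lte_fin.
Qed.

Lemma pr_cvg_up (F : (set T)^nat) (e : R) : (forall n, measurable (F n)) ->
  (forall n, F n `<=` F n.+1) -> 0 < e ->
  exists N, forall n, (N <= n)%N -> pr (\bigcup_n F n) < pr (F n) + e.
Proof.
move=> mF Fu e0.
have mU : measurable (\bigcup_n F n) by exact: bigcupT_measurable.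
have [||N NP] := @pr_cvg_down (fun n => \bigcup_n F n `\` F n) e _ _ e0.
- by move=> n; exact: measurableD.
- by move=> n t [tU nF]; split => // Ft; apply/nF/Fu.
exists N => n /NP.
have -> : \bigcap_n0 (\bigcup_n1 F n1 `\` F n0) = set0.
  by apply/seteqP; split => // t h; have [[k _ Fk] _] := h 0%N Logic.I; have [_ []] := h k Logic.I.
rewrite pr0 add0r prD//; last by move=> t Ft; exists n.
by rewrite ltrBlDl.
Qed.

Lemma count_le_pr (I : eqType) (s : seq I) (B : I -> set T) (c : R) E :
  measurable E -> uniq s -> (forall i, i \in s -> measurable (B i)) ->
  (forall i, i \in s -> c <= pr (B i)) -> (forall i, i \in s -> B i `<=` E) ->
  (forall i j t, i \in s -> j \in s -> B i t -> B j t -> i = j) ->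
  (size s)%:R * c <= pr E.
Proof.
elim: s E => [E *|i s ih E mE /andP[nis us] mB cB BE dis] /=.
  by rewrite mul0r pr_ge0.
have mBi : measurable (B i) by apply: mB; rewrite mem_head.
have h := ih (E `\` B i) (measurableD mE mBi) us.
have {h} h : (size s)%:R * c <= pr (E `\` B i).
  have sub j : j \in s -> j \in i :: s by move=> js; rewrite in_cons js orbT.
  apply: h => [j js|j js|j js t Bjt|j k t js ks].
  - exact/mB/sub.
  - exact/cB/sub.
  - split; first exact: (BE _ (sub _ js)).
    move=> Bit; have ij := dis i j t (mem_head _ _) (sub _ js) Bit Bjt.
    by move: nis; rewrite ij js.
  - by apply: dis; exact: sub.
rewrite prD// in h; last by apply: BE; rewrite mem_head.
have := cB i (mem_head _ _); rewrite -natr1 mulrDl mul1r; lra.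
Qed.

Lemma pr_le_count (I : eqType) (s : seq I) (B : I -> set T) (c : R) E :
  measurable E -> (forall i, i \in s -> measurable (B i)) ->
  (forall i, i \in s -> pr (B i) <= c) ->
  (forall t, E t -> exists2 i, i \in s & B i t) ->
  pr E <= (size s)%:R * c.
Proof.
elim: s E => [E mE _ _ EB|i s ih E mE mB cB EB] /=.
  have -> : E = set0 by apply/seteqP; split => // t /EB[].
  by rewrite pr0 mul0r.
have mBi : measurable (B i) by apply: mB; rewrite mem_head.
have sub j : j \in s -> j \in i :: s by move=> js; rewrite in_cons js orbT.
have h : pr (E `\` B i) <= (size s)%:R * c.
  apply: ih => [|j /sub|j /sub|t [Et nB]]; [exact: measurableD|exact: mB|exact: cB|].
  have [j] := EB _ Et; rewrite in_cons => /orP[/eqP ->//|js Bj].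
  by exists j.
have : pr E <= pr (B i) + pr (E `\` B i).
  have mD : measurable (E `\` B i) by exact: measurableD.
  apply: le_trans (prU_le mBi mD); apply: pr_le => //; first exact: measurableU.
  by move=> t Et; have [Bt|nB] := pselect (B i t); [left|right].
have := cB i (mem_head _ _); rewrite -natr1 mulrDl mul1r; lra.
Qed.

End real_probability.

Section cube_boxes.
Variable R : realType.
Implicit Types (t s : cube R) (F : set (cube R)).
Local Notation mu := (cube_measure R).
Local Notation m := (pr mu).

Lemma cylinder_measurable n (A : nat -> set R) : (forall i, measurable (A i)) ->
  measurable [set t : cube R | forall i, (i < n)%N -> A i (uval (t i))].
Proof.
move=> mA; elim: n => [|n ih].
  by have -> : [set t : cube R | forall i, (i < 0)%N -> A i (uval (t i))] = setT
    by apply/seteqP; split.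
have -> : [set t : cube R | forall i, (i < n.+1)%N -> A i (uval (t i))] =
    [set t : cube R | forall i, (i < n)%N -> A i (uval (t i))] `&`
    [set t : cube R | A n (\val (t n))].
  apply/seteqP; split=> [t h|t [h hn] i].
    by split=> [i /ltnW|]; [exact: h|exact: h].
  by rewrite ltnS leq_eqVlt => /orP[/eqP ->|/h].
by apply: measurableI => //; apply: sub_sigma_algebra; exists n, (A n).
Qed.

(* Closed for [b = false], and open on the right for [b = true]: the closed
   boxes of a grid cover the cube, the half-open ones are disjoint. *)
Definition box (b : bool) (n : nat) (lo : 'I_n -> R) (len : R) : set (cube R) :=
  [set t | forall i : 'I_n,
     uval (t i) \in Interval (BLeft (lo i)) (BSide b (lo i + len))].

Definition box_side (b : bool) (n : nat) (lo : 'I_n -> R) (len : R) (i : nat) : set R :=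
  if insub i is Some k then [set` Interval (BLeft (lo k)) (BSide b (lo k + len))]
  else setT.

Lemma box_side_measurable b n (lo : 'I_n -> R) len i :
  measurable (box_side b lo len i).
Proof. by rewrite /box_side; case: insubP => //= *; exact: measurable_itv. Qed.

Lemma boxE b n (lo : 'I_n -> R) len : box b lo len =
  [set t : cube R | forall i, (i < n)%N -> box_side b lo len i (uval (t i))].
Proof.
rewrite /box_side; apply/seteqP; split=> t h i.
  by case: insubP => // k _ <- _; exact: h.
by have := h i (ltn_ord i); rewrite valK.
Qed.

Lemma box_measurable b n (lo : 'I_n -> R) len : measurable (box b lo len).
Proof.
by rewrite boxE; apply: cylinder_measurable => i; exact: box_side_measurable.
Qed.

Lemma pr_box b n (lo : 'I_n -> R) (len : R) : 0 < len ->
  (forall i, 0 <= lo i /\ lo i + len <= 1) -> m (box b lo len) = len ^+ n.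
Proof.
move=> len0 h; have hA := box_side_measurable b lo len.
transitivity (fine (\prod_(i < n) lebesgue_measure (box_side b lo len i `&` `[0%R, 1%R]%classic))%E).
  by rewrite /pr boxE; congr fine; exact: (cube_measureP n hA).
have -> : len ^+ n = fine (len ^+ n)%:E by [].
congr fine; rewrite -[in RHS](card_ord n) -prodr_const -prodEFin.
apply: eq_bigr => i _; rewrite /box_side valK.
have -> : [set` Interval (BLeft (lo i)) (BSide b (lo i + len))] `&` `[0, 1]%classic =
    [set` Interval (BLeft (lo i)) (BSide b (lo i + len))].
  apply/seteqP; split => [x []//|x]; rewrite /= !in_itv /= => hx; split => //.
  have [h1 h2] := h i; move: hx; case: b {hA} => /= /andP[h3 h4]; apply/andP; split; lra.
rewrite lebesgue_measure_itv /= lte_fin ltrDl len0 -EFinB; congr (_%:E).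
by rewrite addrC addKr.
Qed.

Lemma grid_cover (k : nat) (x : R) : (0 < k)%N -> 0 <= x <= 1 ->
  exists a : 'I_k, a%:R / k%:R <= x <= a%:R / k%:R + k%:R^-1.
Proof.
move=> k0 /andP[x0 x1]; have k0' : 0 < k%:R :> R by rewrite ltr0n.
have kx0 : 0 <= x * k%:R by rewrite mulr_ge0// ltW.
have /andP[h1 h2] := truncn_itv kx0; set a := Num.trunc _ in h1 h2.
have [ak|ka] := ltnP a k.
  exists (Ordinal ak); rewrite ler_pdivrMr// h1 /= -[X in _ + X]mul1r -mulrDl ler_pdivlMr//.
  by rewrite natr1 ltW.
have pk : (k.-1 < k)%N by rewrite prednK.
exists (Ordinal pk); rewrite /= -[X in _ + X]mul1r -mulrDl natr1 prednK//.
rewrite divff ?gt_eqF// x1 andbT ler_pdivrMr//; apply: le_trans h1.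
by rewrite ler_nat (leq_trans (leq_pred k)).
Qed.

Lemma closed_cube_near F t : closed F ->
  (forall k (e : R), 0 < e -> exists2 s, F s & cube_near k e t s) -> F t.
Proof.
move=> cF h; apply: contrapT => nF.
have : nbhs t (~` F) by apply: open_nbhs_nbhs; split => //; exact: closed_openC.
move=> /nbhs_cubeP[k [e [e0 kF]]]; have [s Fs ts] := h k e e0.
exact: (kF s ts).
Qed.

Definition coarse (b : bool) (n k : nat) (a : {ffun 'I_n -> 'I_k}) : set (cube R) :=
  box b (fun i => (a i)%:R / k%:R) k%:R^-1.

Lemma coarse_cover n k t : (0 < k)%N -> exists a : {ffun 'I_n -> 'I_k}, coarse false a t.
Proof.
move=> k0.
have h (i : 'I_n) := grid_cover k0 (unit_intervalP (t i)).
exists [ffun i => sval (cid (h i))] => i; rewrite ffunE.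
by rewrite in_itv /=; exact: svalP (cid (h i)).
Qed.

Definition grid_hull (n k : nat) F : set (cube R) :=
  [set t | exists2 a : {ffun 'I_n -> 'I_k}, coarse false a t & coarse false a `&` F !=set0].

Lemma grid_hull_measurable n k F : measurable (grid_hull n k F).
Proof.
have -> : grid_hull n k F =
    \bigcup_(a in [set a | coarse false a `&` F !=set0]) @coarse false n k a.
  by apply/seteqP; split => [t [a at_ aF]|t [a aF at_]]; exists a.
apply: fin_bigcup_measurable; first exact: finite_finset.
by move=> a _; exact: box_measurable.
Qed.

Lemma sub_grid_hull n k F : (0 < k)%N -> F `<=` grid_hull n k F.
Proof.
by move=> k0 t Ft; have [a at_] := coarse_cover n t k0; exists a => //; exists t.
Qed.

Lemma coarse_dist n k (a : {ffun 'I_n -> 'I_k}) t s (i : 'I_n) :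
  coarse false a t -> coarse false a s -> `|uval (s i) - uval (t i)| <= k%:R^-1.
Proof.
move=> /(_ i) + /(_ i); rewrite !in_itv /= => /andP[? ?] /andP[? ?].
by rewrite ler_norml; apply/andP; split; lra.
Qed.

Lemma closed_measurable F : closed F -> measurable F.
Proof.
move=> cF; have -> : F = \bigcap_k grid_hull k k.+1 F.
  apply/seteqP; split=> [t Ft k _|t h]; first exact: sub_grid_hull.
  apply: (closed_cube_near cF) => k e e0.
  have [N _ NP] := near_infty_natSinv_lt (PosNum e0).
  pose K := maxn N k; have [a ta [s [sa Fs]]] := h K Logic.I.
  exists s => // i ik; have iK : (i < K)%N by rewrite (leq_trans ik)// leq_maxr.
  apply: le_lt_trans (coarse_dist (Ordinal iK) ta sa) _.
  exact: NP (leq_maxl _ _).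
by apply: bigcapT_measurable => k; exact: grid_hull_measurable.
Qed.

Definition depends_on (n : nat) F := forall t s,
  (forall i, (i < n)%N -> t i = s i) -> F t -> F s.

Lemma grid_hull_dyadic n k F : grid_hull n (2 ^ k.+1) F `<=` grid_hull n (2 ^ k) F.
Proof.
have half (a : 'I_(2 ^ k.+1)) : (a./2 < 2 ^ k)%N.
  by rewrite ltn_half_double -mul2n -expnS.
move=> t [a ta [s [sa Fs]]].
pose a' := [ffun i => Ordinal (half (a i))].
have key u : coarse false a u -> coarse false a' u.
  move=> h i; move: (h i); rewrite !in_itv /= ffunE /=.
  have k0 : 0 < (2 ^ k)%:R :> R by rewrite ltr0n expn_gt0.
  rewrite -[X in _ + X]mul1r -[X in _ -> _ <= _ <= _ + X]mul1r -!mulrDl !natr1.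
  rewrite !ler_pdivrMr// ?ler_pdivlMr// ?ltr0n ?expn_gt0//.
  move: (nat_of_ord (a i)) (uval (u i)) => b x.
  rewrite expnS natrM mulrCA => /andP[h1 h2].
  have eb : b%:R = (odd b)%:R + 2 * b./2%:R :> R.
    by rewrite -{1}(odd_double_half b) natrD -mul2n natrM.
  have e1 : b.+1%:R = b%:R + 1 :> R by rewrite natr1.
  rewrite e1 eb in h2; rewrite eb in h1; rewrite -natr1.
  by case: (odd b) h1 h2 => /= h1 h2; apply/andP; split; lra.
by exists a'; [exact: key|exists s; split => //; exact: key].
Qed.

Lemma pr_grid_hull n F (e : R) : closed F -> depends_on n F -> 0 < e ->
  exists N, forall k, (N <= k)%N -> m (grid_hull n (2 ^ k) F) < m F + e.
Proof.
move=> cF dF e0.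
have [||N NP] := @pr_cvg_down _ _ _ mu (fun k => grid_hull n (2 ^ k) F) e _ _ e0.
- by move=> k; exact: grid_hull_measurable.
- by move=> k; exact: grid_hull_dyadic.
exists N => k /NP; congr (_ < m _ + _); apply/seteqP; split=> [t h|t Ft k' _]; last first.
  by apply: sub_grid_hull => //; rewrite expn_gt0.
apply: (closed_cube_near cF) => l d d0.
have [M _ MP] := near_infty_natSinv_lt (PosNum d0).
have [a ta [s [sa Fs]]] := h M Logic.I.
exists (fun i => if (i < n)%N then s i else t i).
  by apply: (dF s) => // i ->.
move=> i _; case: ltnP => [ik|_]; last by rewrite subrr normr0.
apply: le_lt_trans (coarse_dist (Ordinal ik) ta sa) _.
apply: le_lt_trans (MP M (leqnn M)) => /=.
by rewrite lef_pV2 ?posrE ?ltr0n ?expn_gt0// ler_nat ltn_expl.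
Qed.

End cube_boxes.

(** * Bump perturbations *)

Section continuity_on_a_space.
Variables (R : realType) (X : normedModType R) (T : topologicalType).

Lemma continuous_cst_fun (c : X) : continuous (fun _ : T => c).
Proof. by move=> t; exact: cvg_cst. Qed.

Lemma continuous_add (f g : T -> X) : continuous f -> continuous g ->
  continuous (fun t => f t + g t).
Proof. by move=> cf cg t; apply: (@cvgD _ _ _ _ _ _ _ _ _ (cf t) (cg t)). Qed.

Lemma continuous_scale (f : T -> R) (g : T -> X) : continuous f -> continuous g ->
  continuous (fun t => f t *: g t).
Proof. by move=> cf cg t; exact: cvgZ (cf t) (cg t). Qed.

Lemma continuous_sum (I : Type) (r : seq I) (f : I -> T -> X) :
  (forall i, continuous (f i)) -> continuous (fun t => \sum_(i <- r) f i t).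
Proof.
move=> cf; elim: r => [|i r ih].
  have -> : (fun t => \sum_(i <- [::]) f i t) = fun=> 0.
    by apply/funext => t; rewrite big_nil.
  exact: continuous_cst_fun.
have -> : (fun t => \sum_(i <- i :: r) f i t) = fun t => f i t + \sum_(i <- r) f i t.
  by apply/funext => t; rewrite big_cons.
exact: continuous_add.
Qed.

End continuity_on_a_space.

Section real_continuity.
Variables (R : realType) (T : topologicalType).

Lemma continuous_mul (f g : T -> R) : continuous f -> continuous g ->
  continuous (fun t => f t * g t).
Proof. by move=> cf cg t; exact: cvgM (cf t) (cg t). Qed.

Lemma continuous_max0 (f : T -> R) : continuous f ->
  continuous (fun t => Num.max 0 (f t)).
Proof.
move=> cf t; apply: (@continuous_comp _ _ _ f (fun x => Num.max 0 x) t (cf t)).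
apply/cvgrPdist_lt => e e0; apply/nbhs_ballP; exists e => //= y.
rewrite /ball /=; apply: le_lt_trans; rewrite /Num.max.
case: (ltP 0 (f t)) => ?; case: (ltP 0 y) => ?; rewrite ?subrr ?normr0 ?normr_ge0// ler_norml;
have := ler_norm (f t - y); have := lerNnormlW (lexx `|f t - y|); lra.
Qed.

End real_continuity.

Section bump.
Variable R : realType.
Implicit Types (a s x y : R).

Definition pospart x : R := Num.max 0 x.
Definition possq x : R := pospart x ^+ 2.

Lemma pospart_ge0 x : 0 <= pospart x.
Proof. by rewrite le_max lexx. Qed.

Lemma pospart_le0 x : x <= 0 -> pospart x = 0.
Proof. by move=> x0; rewrite /pospart max_l. Qed.

Lemma pospart_le x (c : R) : 0 <= c -> x <= c -> pospart x <= c.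
Proof. by move=> c0 xc; rewrite ge_max c0. Qed.

Lemma possq_taylor x y :
  `|possq y - possq x - (y - x) * (2 * pospart x)| <= (y - x) ^+ 2.
Proof.
have sq := sqr_ge0 (y - x); rewrite /possq /pospart /Num.max.
case: (ltP 0 x) => x0; case: (ltP 0 y) => y0.
- by rewrite ler_norml; apply/andP; split; lra.
- have xy : x * y <= 0 by rewrite mulr_ge0_le0// ltW.
  have x2 := sqr_ge0 x; have y2 := sqr_ge0 y.
  by rewrite ler_norml expr0n /=; apply/andP; split; lra.
- have xy : x * y <= 0 by rewrite mulr_le0_ge0// ltW.
  have x2 := sqr_ge0 x; have y2 := sqr_ge0 y.
  by rewrite ler_norml expr0n /=; apply/andP; split; lra.
- have x2 := sqr_ge0 (y - x).
  by rewrite ler_norml expr0n /=; apply/andP; split; lra.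
Qed.

Definition edge a s : R := possq ((a - s) / a) + possq ((s - 1 + a) / a).
Definition dedge a s : R :=
  (2 * pospart ((s - 1 + a) / a) - 2 * pospart ((a - s) / a)) / a.

Lemma edge_ge0 a s : 0 <= edge a s.
Proof. by rewrite addr_ge0// sqr_ge0. Qed.

Lemma edge_outside a s : 0 < a -> (s <= 0) || (1 <= s) -> 1 <= edge a s.
Proof.
move=> a0 h; have sq x : 1 <= x -> 1 <= possq x.
  by move=> x1; rewrite /possq /pospart max_r; [rewrite exprn_ege1|lra].
have p2 x : 0 <= possq x by exact: sqr_ge0.
case/orP: h => h; rewrite /edge.
  by rewrite -[1]addr0 lerD// sq// ler_pdivlMr//; lra.
by rewrite -[1]add0r lerD// sq// ler_pdivlMr//; lra.
Qed.

Lemma edge_inside a s : 0 < a -> a <= s <= 1 - a -> edge a s = 0.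
Proof.
move=> a0 /andP[h1 h2]; rewrite /edge /possq !pospart_le0 ?expr0n ?addr0//.
  by rewrite ler_pdivrMr//; lra.
by rewrite ler_pdivrMr//; lra.
Qed.

Lemma edge_taylor a x y : 0 < a ->
  `|edge a y - edge a x - (y - x) * dedge a x| <= 2 / a ^+ 2 * (y - x) ^+ 2.
Proof.
move=> a0; rewrite /edge /dedge.
have h1 := possq_taylor ((a - x) / a) ((a - y) / a).
have h2 := possq_taylor ((x - 1 + a) / a) ((y - 1 + a) / a).
have a' : a != 0 by rewrite gt_eqF.
move: h1 h2; move: (possq ((a - y) / a)) (possq ((y - 1 + a) / a)) (possq ((a - x) / a))
  (possq ((x - 1 + a) / a)) (pospart ((a - x) / a)) (pospart ((x - 1 + a) / a)).
move=> A B C D E F.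
have -> : (a - y) / a - (a - x) / a = - ((y - x) / a) by field.
have -> : (y - 1 + a) / a - (x - 1 + a) / a = (y - x) / a by field.
have -> : 2 / a ^+ 2 * (y - x) ^+ 2 = ((y - x) / a) ^+ 2 + ((y - x) / a) ^+ 2 by field.
have -> : (y - x) * ((2 * F - 2 * E) / a) = ((y - x) / a) * (2 * F - 2 * E) by field.
rewrite sqrrN; move: ((y - x) / a) => z h1 h2.
have -> : A + B - (C + D) - z * (2 * F - 2 * E) =
  (A - C - (- z) * (2 * E)) + (B - D - z * (2 * F)) by ring.
by apply: le_trans (ler_normD _ _) _; apply: lerD.
Qed.

Lemma dedge_bound a s : 0 < a -> 0 <= s <= 1 -> `|dedge a s| <= 2 / a.
Proof.
move=> a0 /andP[s0 s1]; rewrite /dedge normrM (gtr0_norm (_ : 0 < a^-1)) ?invr_gt0//.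
apply: ler_wpM2r; first by rewrite invr_ge0 ltW.
have h1 : pospart ((s - 1 + a) / a) <= 1.
  by apply: pospart_le => //; rewrite ler_pdivrMr//; lra.
have h2 : pospart ((a - s) / a) <= 1.
  by apply: pospart_le => //; rewrite ler_pdivrMr//; lra.
have := pospart_ge0 ((s - 1 + a) / a); have := pospart_ge0 ((a - s) / a).
by rewrite ler_norml; lra.
Qed.

Variables (n k : nat) (a : R).
Hypotheses (k0 : (0 < k)%N) (a0 : 0 < a).
Implicit Types (t : cube R) (c : {ffun 'I_n -> 'I_k}).

Definition cell_coord c t (i : 'I_n) : R := k%:R * uval (t i) - (c i)%:R.

Definition bump_arg c t : R := 1 - \sum_(i < n) edge a (cell_coord c t i).
Definition bump c t : R := possq (bump_arg c t).
Definition dbump c (j : nat) t : R :=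
  if insub j is Some i
  then 2 * pospart (bump_arg c t) * (- (k%:R * dedge a (cell_coord c t i))) else 0.

Lemma bump_arg_le1 c t : bump_arg c t <= 1.
Proof. by rewrite lerBlDr lerDl sumr_ge0// => i _; exact: edge_ge0. Qed.

Lemma bump_arg_gt0 c t i : 0 < bump_arg c t -> 0 < cell_coord c t i < 1.
Proof.
move=> h; apply: contraT; rewrite negb_and -!leNgt => /(edge_outside a0) e1.
suff : bump_arg c t <= 0 by rewrite leNgt h.
rewrite /bump_arg (bigD1 i)//= subr_le0.
by rewrite -[1]addr0 lerD// sumr_ge0// => j _; exact: edge_ge0.
Qed.

Lemma bump_le1 c t : 0 <= bump c t <= 1.
Proof.
rewrite sqr_ge0 /= /bump /possq expr_le1// ?pospart_ge0//.
by apply: pospart_le => //; exact: bump_arg_le1.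
Qed.

Lemma bump_out c t : bump_arg c t <= 0 -> bump c t = 0.
Proof. by move=> h; rewrite /bump /possq pospart_le0// expr0n. Qed.

Lemma dbump_out c j t : bump_arg c t <= 0 -> dbump c j t = 0.
Proof.
by move=> h; rewrite /dbump; case: insubP => // i _ _; rewrite pospart_le0// mulr0 mul0r.
Qed.

Lemma bump_inside c t : (forall i, a <= cell_coord c t i <= 1 - a) -> bump c t = 1.
Proof.
move=> h; rewrite /bump /bump_arg big1 ?subr0 => [|i _]; last exact: edge_inside.
by rewrite /possq /pospart max_r// expr1n.
Qed.

Lemma dbump_bound c j t : `|dbump c j t| <= 4 * k%:R / a.
Proof.
have B0 : 0 <= 4 * k%:R / a by rewrite divr_ge0 ?mulr_ge0 ?ler0n// ltW.
have [h|h] := leP (bump_arg c t) 0; first by rewrite dbump_out// normr0.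
rewrite /dbump; case: insubP => [i _ _|_]; last by rewrite normr0.
have /andP[c0 c1] := bump_arg_gt0 i h.
have : `|dedge a (cell_coord c t i)| <= 2 / a by apply: dedge_bound => //; rewrite !ltW.
have h2 : pospart (bump_arg c t) <= 1 by apply: pospart_le => //; exact: bump_arg_le1.
move: (dedge _ _) => D h1.
rewrite !(normrM, normrN) (ger0_norm (ler0n R 2)) (ger0_norm (pospart_ge0 _)).
rewrite (ger0_norm (ler0n R k)).
have -> : 4 * k%:R / a = 2 * 1 * (k%:R * (2 / a)) :> R by ring.
apply: ler_pM; [|by rewrite mulr_ge0|by rewrite ler_wpM2l|by rewrite ler_wpM2l].
by rewrite mulr_ge0// pospart_ge0.
Qed.

Lemma bump_taylor c (j : nat) t : exists C : R, forall s : unit_interval R,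
  `|bump c (move_coord t j s) - bump c t - (uval s - uval (t j)) * dbump c j t| <=
   C * (uval s - uval (t j)) ^+ 2.
Proof.
have [jn|nj] := ltnP j n; last first.
  exists 0 => s; rewrite mul0r /dbump insubF ?ltnNge ?nj// mulr0 subr0.
  have -> : bump c (move_coord t j s) = bump c t; last by rewrite subrr normr0.
  rewrite /bump /bump_arg; do 2 congr (_ _); congr (- _); apply: eq_bigr => i _.
  rewrite /cell_coord /move_coord; case: eqP => // ij.
  by move: nj; rewrite -ij leqNgt ltn_ord.
pose i := Ordinal jn; pose K := k%:R : R.
pose A : R := 2 / a ^+ 2 * K ^+ 2.
pose b : R := K * dedge a (cell_coord c t i).
exists (2 * A + (`|b| + A) ^+ 2) => s.
have hdb : dbump c j t = 2 * pospart (bump_arg c t) * - b.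
  by rewrite /dbump; case: insubP => [i' _ ij|]; rewrite ?jn//;
     congr (_ * - (_ * dedge a (cell_coord _ _ _))); exact/val_inj.
set h := uval s - uval (t j); have h1 : `|h| <= 1.
  have := unit_intervalP s; have := unit_intervalP (t j); rewrite ler_norml /h.
  by move=> /andP[? ?] /andP[? ?]; apply/andP; split; lra.
have coord : cell_coord c (move_coord t j s) i = cell_coord c t i + K * h.
  by rewrite /cell_coord move_coordE /h /K; ring.
have e1 : `|bump_arg c (move_coord t j s) - bump_arg c t + h * b| <= A * h ^+ 2.
  rewrite /bump_arg (bigD1 i)//= [in X in _ - X](bigD1 i)//=.
  rewrite (eq_bigr (fun l => edge a (cell_coord c t l))); last first.
    move=> l li; congr edge; rewrite /cell_coord /move_coord; case: eqP => // lj.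
    by move: li; rewrite -val_eqE /= lj eqxx.
  have := edge_taylor (cell_coord c t i) (cell_coord c (move_coord t j s) i) a0.
  rewrite coord; set x := cell_coord c t i.
  have -> : x + K * h - x = K * h by ring.
   set S := \sum_(_ < _ | _) _ => et.
  rewrite -normrN; have -> : - (1 - (edge a (x + K * h) + S) - (1 - (edge a x + S)) + h * b) =
     edge a (x + K * h) - edge a x - K * h * dedge a x by rewrite /b /x; ring.
  by apply: le_trans et _; rewrite /A exprMn mulrA.
have A0 : 0 <= A by rewrite mulr_ge0 ?divr_ge0 ?sqr_ge0.
have hh : h ^+ 2 = `|h| ^+ 2 by rewrite real_normK ?num_real.
have e2 : `|bump_arg c (move_coord t j s) - bump_arg c t| <= (`|b| + A) * `|h|.
  have -> : bump_arg c (move_coord t j s) - bump_arg c t =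
    (bump_arg c (move_coord t j s) - bump_arg c t + h * b) - h * b by ring.
  apply: le_trans (ler_normB _ _) _; rewrite normrM; move: e1; rewrite hh.
  have Ah : A * `|h| ^+ 2 <= A * `|h| by rewrite ler_wpM2l// expr2 ler_piMl.
  by lra.
rewrite hdb; have := possq_taylor (bump_arg c t) (bump_arg c (move_coord t j s)).
rewrite -/(bump c t) -/(bump c (move_coord t j s)) => pt.
have p0 := pospart_ge0 (bump_arg c t).
have p1 : pospart (bump_arg c t) <= 1 by apply: pospart_le => //; exact: bump_arg_le1.
move: pt e1 e2 p0 p1; move: (pospart _) => p.
move: (bump_arg c (move_coord t j s) - bump_arg c t) (bump c (move_coord t j s) - bump c t).
move=> u v pt e1 e2 p0 p1.
have -> : v - h * (2 * p * - b) = (v - u * (2 * p)) + (2 * p) * (u + h * b) by ring.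
apply: le_trans (ler_normD _ _) _; rewrite [X in _ + X]normrM (ger0_norm (_ : 0 <= 2 * p)); last by rewrite mulr_ge0.
have u2 : u ^+ 2 <= (`|b| + A) ^+ 2 * h ^+ 2.
  rewrite -(real_normK (num_real u)) hh -exprMn ler_sqr// nnegrE ?normr_ge0//.
  by rewrite mulr_ge0// addr_ge0.
have : 2 * p * `|u + h * b| <= 2 * (A * h ^+ 2).
  apply: ler_pM => //; [by rewrite mulr_ge0|by rewrite -[leRHS]mulr1 ler_wpM2l].
move=> h3; rewrite (_ : (2 * A + (`|b| + A) ^+ 2) * h ^+ 2 =
  (`|b| + A) ^+ 2 * h ^+ 2 + 2 * (A * h ^+ 2)); last by ring.
by apply: lerD => //; exact: le_trans pt u2.
Qed.

Lemma cell_coord_continuous c i : continuous (fun t => cell_coord c t i).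
Proof.
apply: continuous_add; last exact: continuous_cst_fun.
by apply: continuous_mul; [exact: continuous_cst_fun|exact: coord_continuous].
Qed.

Lemma pospart_continuous (f : cube R -> R) (u v : R) : continuous f ->
  continuous (fun t => pospart ((u * f t + v) / a)).
Proof.
move=> cf; apply: continuous_max0; apply: continuous_mul; last exact: continuous_cst_fun.
apply: continuous_add; last exact: continuous_cst_fun.
by apply: continuous_mul => //; exact: continuous_cst_fun.
Qed.

Let p1 (f : cube R -> R) : continuous f -> continuous (fun t => pospart ((a - f t) / a)).
Proof.
move=> cf; have -> : (fun t => pospart ((a - f t) / a)) = fun t => pospart ((-1 * f t + a) / a).
  by apply/funext => t; rewrite mulN1r addrC.
exact: pospart_continuous.
Qed.

Let p2 (f : cube R -> R) : continuous f -> continuous (fun t => pospart ((f t - 1 + a) / a)).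
Proof.
move=> cf; have -> : (fun t => pospart ((f t - 1 + a) / a)) =
    fun t => pospart ((1 * f t + (a - 1)) / a).
  by apply/funext => t; congr (pospart (_ / _)); ring.
exact: pospart_continuous.
Qed.

Let opp_continuous (f : cube R -> R) : continuous f -> continuous (fun t => - f t).
Proof.
move=> cf; have -> : (fun t => - f t) = fun t => -1 * f t.
  by apply/funext => t; rewrite mulN1r.
by apply: continuous_mul => //; exact: continuous_cst_fun.
Qed.

Lemma bump_arg_continuous c : continuous (bump_arg c).
Proof.
apply: continuous_add; first exact: continuous_cst_fun.
apply: opp_continuous; apply: continuous_sum => i.
have cc := @cell_coord_continuous c i.
by apply: continuous_add; apply: continuous_mul; solve[exact: p1|exact: p2].
Qed.

Lemma bump_continuous c : continuous (bump c).
Proof.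
by apply: continuous_mul; apply: continuous_max0; exact: bump_arg_continuous.
Qed.

Lemma dbump_continuous c j : continuous (dbump c j).
Proof.
rewrite /dbump; case: insubP => [i _ _|_]; last exact: continuous_cst_fun.
have cc := @cell_coord_continuous c i.
apply: continuous_mul.
  apply: continuous_mul; first exact: continuous_cst_fun.
  by apply: continuous_max0; exact: bump_arg_continuous.
apply: opp_continuous; apply: continuous_mul; first exact: continuous_cst_fun.
apply: continuous_mul; last exact: continuous_cst_fun.
apply: continuous_add; last apply: opp_continuous.
  by apply: continuous_mul; [exact: continuous_cst_fun|exact: p2].
by apply: continuous_mul; [exact: continuous_cst_fun|exact: p1].
Qed.

Lemma coarseE c t i : coarse false c t -> 0 <= cell_coord c t i <= 1.
Proof.
move=> /(_ i); rewrite in_itv /= => /andP[h1 h2]; rewrite /cell_coord.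
have k0' : 0 < k%:R :> R by rewrite ltr0n.
rewrite subr_ge0 lerBlDr; apply/andP; split.
  by move: h1; rewrite ler_pdivrMr// mulrC.
by move: h2; rewrite -[X in _ + X]mul1r -mulrDl ler_pdivlMr// mulrC addrC.
Qed.

Lemma bump_other c c' t : (forall i, 0 <= cell_coord c t i <= 1) -> c' != c ->
  bump_arg c' t <= 0.
Proof.
move=> h cc'; rewrite leNgt; apply: contra cc' => h'.
apply/eqP/ffunP => i; have := h i; have := bump_arg_gt0 i h'.
rewrite /cell_coord; move: (uval _) => x /andP[h1 h2] /andP[h3 h4].
have h5 : (c' i < (c i).+1)%N by rewrite -(ltr_nat R) -natr1; lra.
have h6 : (c i < (c' i).+1)%N by rewrite -(ltr_nat R) -natr1; lra.
by apply/val_inj/eqP; rewrite /= eqn_leq -ltnS h5 -ltnS h6.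
Qed.

End bump.

Section perturbation.
Variables (R : realType) (X : completeNormedModType R) (n k : nat) (a : R).
Hypotheses (k0 : (0 < k)%N) (a0 : 0 < a).
Variables (w : {ffun 'I_n -> 'I_k} -> X) (B : R).
Hypothesis wB : forall c, `|w c| <= B.

Definition bumps (t : cube R) : X := \sum_c bump a c t *: w c.
Definition dbumps (j : nat) (t : cube R) : X := \sum_c dbump a c j t *: w c.

Lemma bumps_continuous : continuous bumps.
Proof.
apply: continuous_sum => c; apply: continuous_scale; last exact: continuous_cst_fun.
exact: bump_continuous.
Qed.

Lemma dbumps_continuous j : continuous (dbumps j).
Proof.
apply: continuous_sum => c; apply: continuous_scale; last exact: continuous_cst_fun.
exact: dbump_continuous.
Qed.

Lemma bumps_is_partial j t : is_partial j bumps t (dbumps j t).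
Proof.
apply: is_partial_sum => c _; have [C CP] := bump_taylor a0 c j t.
apply: (@is_partial_quadratic _ _ _ _ _ _ (C * `|w c|)) => s.
rewrite scalerA -!scalerBl normrZ mulrAC ler_wpM2r//; exact: CP.
Qed.

Lemma bumps_coarse c t : (forall i, 0 <= cell_coord c t i <= 1) ->
  bumps t = bump a c t *: w c.
Proof.
move=> h; rewrite /bumps (bigD1 c)//= big1 ?addr0// => c' cc'.
by rewrite bump_out ?scale0r//; exact: bump_other h cc'.
Qed.

Lemma bumps_bound t : `|bumps t| <= B.
Proof.
have [c /(coarseE k0) tc] := coarse_cover n t k0.
rewrite (bumps_coarse tc) normrZ; have /andP[b0 b1] := bump_le1 a c t.
rewrite (ger0_norm b0); apply: le_trans (wB c); rewrite -[leRHS]mul1r.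
by rewrite ler_wpM2r.
Qed.

Lemma dbumps_bound j t : `|dbumps j t| <= 4 * k%:R / a * B.
Proof.
have [c tc'] := coarse_cover n t k0; have tc i := coarseE k0 i tc'.
rewrite /dbumps (bigD1 c)//= big1 ?addr0; last first.
  by move=> c' cc'; rewrite dbump_out ?scale0r//; exact: bump_other tc cc'.
by rewrite normrZ; apply: ler_pM => //; exact: dbump_bound.
Qed.

End perturbation.

(** * Cells and their subdivisions *)

Section reflection_count.
Variables (R : realType) (n N q : nat).
Hypothesis qnN : (8 * q * n <= N)%N.
Hypothesis N0 : (0 < N)%N.
Local Notation index := {ffun 'I_n -> 'I_N}.

Definition reflect_index (o : index) : index := [ffun i => rev_ord (o i)].

Definition inner_index (o : index) : bool := [forall i, (q <= o i < N - q)%N].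

Lemma reflect_indexK : involutive reflect_index.
Proof. by move=> o; apply/ffunP => i; rewrite !ffunE rev_ordK. Qed.

Lemma bernoulli (x : R) (l : nat) : 0 <= x <= 1 -> 1 - l%:R * x <= (1 - x) ^+ l.
Proof.
move=> /andP[x0 x1]; elim: l => [|l ih]; first by rewrite mul0r subr0 expr0.
rewrite exprS -natr1; have l0 := ler0n R l.
have : (1 - x) * (1 - l%:R * x) <= (1 - x) * (1 - x) ^+ l by rewrite ler_wpM2l// subr_ge0.
apply: le_trans; have : 0 <= l%:R * x ^+ 2 by rewrite mulr_ge0 ?sqr_ge0.
by lra.
Qed.

Lemma card_inner_index :
  3 / 4 * N%:R ^+ n <= #|[set o | inner_index o]%SET|%:R :> R.
Proof.
pose A := [pred x : 'I_N | (q <= x < N - q)%N].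
have -> : #|[set o | inner_index o]%SET| = #|@ffun_on 'I_n A|.
  apply: eq_card => o; rewrite inE; apply/forallP/ffun_onP => h i; exact: h.
rewrite card_ffun_on card_ord.
have [n0|n0] := posnP n; first by rewrite n0 !expr0 expn0; lra.
have q2N : (2 * q <= N)%N by have := leq_pmulr q n0; lia.
have cA : (N - 2 * q <= #|A|)%N.
  have lt (i : 'I_(N - 2 * q)) : (q + i < N)%N by have := ltn_ord i; lia.
  pose f (i : 'I_(N - 2 * q)) : 'I_N := Ordinal (lt i).
  have injf : injective f by move=> i j /(congr1 val) /= /addnI/val_inj.
  rewrite -[X in (X <= _)%N]card_ord -(fintype.card_image injf); apply/subset_leq_card/fintype.subsetP => x.
  by move=> /fintype.imageP[i _ ->]; rewrite inE /=; have := ltn_ord i; lia.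
have N0' : 0 < N%:R :> R by rewrite ltr0n.
apply: (@le_trans _ _ ((N - 2 * q)%:R ^+ n)); last by rewrite -natrX ler_nat leq_exp2r.
have -> : (N - 2 * q)%:R = N%:R * (1 - (2 * q)%:R / N%:R) :> R.
  by rewrite natrB// mulrBr mulr1 mulrCA divff ?mulr1// gt_eqF.
rewrite exprMn mulrC ler_wpM2l ?exprn_ge0//.
apply: le_trans (bernoulli n _); last first.
  by rewrite divr_ge0//= ler_pdivrMr// mul1r ler_nat.
suff : n%:R * ((2 * q)%:R / N%:R) <= 1 / 4 :> R by lra.
rewrite mulrA ler_pdivrMr//.
have : (8 * q * n)%:R <= N%:R :> R by rewrite ler_nat.
by rewrite !natrM; lra.
Qed.

Lemma card_reflect (E : pred index) :
  (forall o, inner_index o -> E o || E (reflect_index o)) ->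
  #|[set o | ~~ E o]%SET|%:R <= 5 / 8 * N%:R ^+ n :> R.
Proof.
move=> h.
have h1 : (#|[set o | inner_index o]%SET| <= 2 * #|[set o | E o]%SET|)%N.
  have sub : ([set o | inner_index o] \subset
      [set o | E o] :|: [set reflect_index o | o in [set o | E o]])%SET.
    apply/fintype.subsetP => o; rewrite !inE => /h /orP[->//|Eo]; apply/orP; right.
    by apply/imsetP; exists (reflect_index o); rewrite ?inE ?reflect_indexK.
  apply: leq_trans (subset_leq_card sub) _; apply: leq_trans (leq_card_setU _ _) _.
  by rewrite mul2n -addnn leq_add2l leq_imset_card.
have h2 : (#|[set o | E o]%SET| + #|[set o | ~~ E o]%SET| = N ^ n)%N.
  have -> : ([set o | ~~ E o] = ~: [set o | E o])%SET by apply/setP => o; rewrite !inE.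
  by rewrite cardsC card_ffun !card_ord.
have h3 := card_inner_index.
have h4 : #|[set o | inner_index o]%SET|%:R <= 2 * #|[set o | E o]%SET|%:R :> R.
  by rewrite -natrM ler_nat.
have h5 : #|[set o | E o]%SET|%:R + #|[set o | ~~ E o]%SET|%:R = N%:R ^+ n :> R.
  by rewrite -natrD h2 natrX.
by lra.
Qed.

End reflection_count.

Section fine_cells.
Variables (R : realType) (n : nat).
Implicit Types (t s : cube R) (F : set (cube R)).
Local Notation m := (pr (cube_measure R)).

Definition fine (b : bool) (k N : nat) (c : {ffun 'I_n -> 'I_k}) (o : {ffun 'I_n -> 'I_N})
  : set (cube R) :=
  box b (fun i => ((c i)%:R + (o i)%:R / N%:R) / k%:R) (k%:R^-1 * N%:R^-1).

Lemma fineP b k N c o t : (0 < k)%N -> (0 < N)%N -> @fine b k N c o t <->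
  forall i, cell_coord c t i \in
    Interval (BLeft ((o i)%:R / N%:R)) (BSide b ((o i)%:R / N%:R + N%:R^-1)).
Proof.
move=> k0 N0; have k0' : 0 < k%:R :> R by rewrite ltr0n.
have key i : (cell_coord c t i \in
    Interval (BLeft ((o i)%:R / N%:R)) (BSide b ((o i)%:R / N%:R + N%:R^-1))) =
  (uval (t i) \in Interval (BLeft (((c i)%:R + (o i)%:R / N%:R) / k%:R))
    (BSide b (((c i)%:R + (o i)%:R / N%:R) / k%:R + k%:R^-1 * N%:R^-1))).
  rewrite !itv_boundlr /= !bnd_simp /cell_coord.
  have -> : ((c i)%:R + (o i)%:R / N%:R) / k%:R + k%:R^-1 * N%:R^-1 =
    ((c i)%:R + (o i)%:R / N%:R + N%:R^-1) / k%:R :> R by ring.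
  move: ((o i)%:R / N%:R) => z.
  by case: b; rewrite !bnd_simp ler_pdivrMr// ?ltr_pdivlMr// ?ler_pdivlMr//;
    apply/idP/idP => /andP[h1 h2]; apply/andP; split; lra.
by split=> h i; have := h i; rewrite key.
Qed.

Lemma fine_measurable b k N c o : measurable (@fine b k N c o).
Proof. exact: box_measurable. Qed.

Lemma pr_fine b k N c o : (0 < k)%N -> (0 < N)%N ->
  m (@fine b k N c o) = (k%:R^-1 * N%:R^-1) ^+ n.
Proof.
move=> k0 N0; have k0' : 0 < k%:R :> R by rewrite ltr0n.
have N0' : 0 < N%:R :> R by rewrite ltr0n.
apply: pr_box => [|i]; first by rewrite mulr_gt0 ?invr_gt0.
split; first by rewrite divr_ge0// addr_ge0// divr_ge0.
have -> : ((c i)%:R + (o i)%:R / N%:R) / k%:R + k%:R^-1 * N%:R^-1 =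
    ((c i)%:R + ((o i)%:R + 1) / N%:R) / k%:R :> R by ring.
rewrite ler_pdivrMr// mul1r natr1.
have h1 : (o i).+1%:R / N%:R <= 1 :> R by rewrite ler_pdivrMr// mul1r ler_nat ltn_ord.
have h2 : (c i)%:R + 1 <= k%:R :> R by rewrite natr1 ler_nat ltn_ord.
by lra.
Qed.

Lemma fine_cover k N c t : (0 < k)%N -> (0 < N)%N -> coarse false c t ->
  exists o, @fine false k N c o t.
Proof.
move=> k0 N0 tc.
have h i := grid_cover N0 (coarseE k0 i tc).
exists [ffun i => sval (cid (h i))]; apply/fineP => // i.
by rewrite ffunE in_itv; exact: svalP (cid (h i)).
Qed.

Lemma fine_half_open k N c o : @fine true k N c o `<=` fine false c o.
Proof. by move=> t h i; have := h i; rewrite !in_itv /= => /andP[-> /ltW]. Qed.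

Lemma fine_coord k N c o t i : (0 < k)%N -> (0 < N)%N -> @fine false k N c o t ->
  (o i)%:R / N%:R <= cell_coord c t i <= (o i)%:R / N%:R + N%:R^-1.
Proof. by move=> k0 N0 /fineP => /(_ k0 N0 i); rewrite in_itv. Qed.

Lemma coarse_of_coord k c t : (0 < k)%N ->
  (forall i, 0 <= cell_coord c t i <= 1) -> @coarse R false n k c t.
Proof.
move=> k0 h i; have k0' : 0 < k%:R :> R by rewrite ltr0n.
have := h i; rewrite in_itv /= /cell_coord.
have -> : (c i)%:R / k%:R + k%:R^-1 = ((c i)%:R + 1) / k%:R :> R by ring.
by rewrite ler_pdivrMr// ler_pdivlMr// mulrC; move=> /andP[? ?]; apply/andP; split; lra.
Qed.

Lemma fine_coarse k N c o : (0 < k)%N -> (0 < N)%N ->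
  @fine false k N c o `<=` coarse false c.
Proof.
move=> k0 N0 t tc; apply: coarse_of_coord => // i.
have N0' : 0 < N%:R :> R by rewrite ltr0n.
have /andP[h1 h2] := fine_coord i k0 N0 tc; apply/andP; split.
  by apply: le_trans h1; rewrite divr_ge0.
apply: le_trans h2 _; rewrite -[X in _ + X]mul1r -mulrDl natr1 ler_pdivrMr// mul1r.
by rewrite ler_nat ltn_ord.
Qed.

Lemma fine_disjoint k N c o c' o' t : (0 < k)%N -> (0 < N)%N ->
  @fine true k N c o t -> @fine true k N c' o' t -> c = c'.
Proof.
move=> k0 N0 /fineP => /(_ k0 N0) h /fineP => /(_ k0 N0) h'.
have N0' : 0 < N%:R :> R by rewrite ltr0n.
have key (a b : {ffun 'I_n -> 'I_k}) (u v : {ffun 'I_n -> 'I_N}) i :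
    (u i)%:R / N%:R <= cell_coord a t i -> cell_coord b t i < (v i)%:R / N%:R + N%:R^-1 ->
    (a i <= b i)%N.
  rewrite /cell_coord => h1 h2.
  have h3 : 0 <= (u i)%:R / N%:R :> R by rewrite divr_ge0.
  have h4 : (v i)%:R / N%:R + N%:R^-1 <= 1 :> R.
    by rewrite -[X in _ + X]mul1r -mulrDl natr1 ler_pdivrMr// mul1r ler_nat ltn_ord.
  by rewrite -ltnS -(ltr_nat R) -natr1; lra.
apply/ffunP => i; apply/val_inj/eqP; rewrite eqn_leq.
have := h i; have := h' i; rewrite !in_itv /= => /andP[a1 a2] /andP[b1 b2].
by rewrite (key _ _ _ _ _ b1 a2) (key _ _ _ _ _ a1 b2).
Qed.

Lemma pr_coarse b k (c : {ffun 'I_n -> 'I_k}) : (0 < k)%N ->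
  m (@coarse R b n k c) = k%:R^-1 ^+ n.
Proof.
move=> k0; have k0' : 0 < k%:R :> R by rewrite ltr0n.
apply: pr_box => [|i]; first by rewrite invr_gt0.
split; first by rewrite divr_ge0.
by rewrite -[X in _ + X]mul1r -mulrDl natr1 ler_pdivrMr// mul1r ler_nat ltn_ord.
Qed.

Definition full_cell k N (Fi : nat -> set (cube R)) (c : {ffun 'I_n -> 'I_k}) : Prop :=
  exists i, forall o, @fine false k N c o `&` Fi i !=set0.

Lemma count_bad_cells k N F : (0 < k)%N -> (0 < N)%N -> measurable F ->
  #|[pred c : {ffun 'I_n -> 'I_k} | `[< @coarse R false n k c `&` F !=set0 >] &&
     `[< exists o, ~ (@fine false k N c o `&` F !=set0) >]]|%:R * (k%:R^-1 * N%:R^-1) ^+ n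
  <= m (grid_hull n k F) - m F.
Proof.
move=> k0 N0 mF; set S := [pred c | _].
have mG := grid_hull_measurable n k F.
rewrite -prD//; last exact: sub_grid_hull.
have ex c : exists o, c \in S -> ~ (@fine false k N c o `&` F !=set0).
  have [cS|nS] := boolP (c \in S); last by exists [ffun=> Ordinal N0].
  by move: cS; rewrite inE => /andP[_ /asboolP[u hu]]; exists u.
pose o_ c := sval (cid (ex c)).
have oP c : c \in S -> ~ (@fine false k N c (o_ c) `&` F !=set0) := svalP (cid (ex c)).
rewrite cardE; apply: (@count_le_pr _ _ _ _ _ _ (fun c => @fine true k N c (o_ c))).
- exact: measurableD.
- exact: enum_uniq.
- by move=> c _; exact: fine_measurable.
- by move=> c _; rewrite pr_fine.
- move=> c; rewrite mem_enum => cS t /fine_half_open tc; split; last first.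
    by move=> Ft; apply: (oP c cS); exists t.
  exists c; first exact: fine_coarse tc.
  by move: cS; rewrite inE => /andP[/asboolP].
- by move=> c c' t _ _; exact: fine_disjoint.
Qed.

Lemma common_rank (P : nat -> nat -> Prop) M :
  (forall i, exists N, forall k, (N <= k)%N -> P i k) ->
  exists N, forall i k, (i < M)%N -> (N <= k)%N -> P i k.
Proof.
move=> h; elim: M => [|M [N NP]]; first by exists 0%N.
have [N' N'P] := h M; exists (maxn N N') => i k; rewrite ltnS leq_eqVlt geq_max.
by move=> /orP[/eqP ->|iM] /andP[Nk N'k]; [exact: N'P|exact: NP].
Qed.

Lemma full_cells F (Fi : nat -> set (cube R)) N (e : R) : (0 < N)%N -> 0 < e ->
  closed F -> depends_on n F -> (forall i, closed (Fi i)) ->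
  (forall i, depends_on n (Fi i)) -> F = \bigcup_i Fi i ->
  exists k0, forall l, (k0 <= l)%N ->
    let k := (2 ^ l)%N in
    m (F `\` \bigcup_(c in full_cell N Fi) @coarse R false n k c) <= e /\
    #|[pred c : {ffun 'I_n -> 'I_k} | `[< full_cell N Fi c >]]|%:R * k%:R^-1 ^+ n <= m F + e.
Proof.
move=> N0 e0 cF dF cFi dFi FE.
have mF := closed_measurable cF; have mFi i := closed_measurable (cFi i).
pose G M := \bigcup_(i in [set i | (i < M)%N]) Fi i.
have mG M : measurable (G M) by apply: bigcup_measurable => i _.
have GE : \bigcup_M G M = F.
  rewrite FE; apply/seteqP; split=> [t [M _ [i _ Fit]]|t [i _ Fit]]; first by exists i.
  by exists i.+1 => //; exists i => /=.
have e20 : 0 < e / 2 by rewrite divr_gt0.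
have [|M MP] := @pr_cvg_up _ _ _ (cube_measure R) G _ mG _ e20.
  by move=> j t [i /= ij Fit]; exists i => //=; exact: ltnW.
have {}MP : m F < m (G M) + e / 2 by rewrite -GE; exact: MP.
have GF : G M `<=` F by rewrite FE => t [i _ Fit]; exists i.
pose d := e / 2 / (M.+1%:R * N%:R ^+ n).
have N0' : 0 < N%:R :> R by rewrite ltr0n.
have D0 : 0 < M.+1%:R * N%:R ^+ n :> R by rewrite mulr_gt0 ?ltr0n ?exprn_gt0.
have d0 : 0 < d by rewrite divr_gt0.
have [k1 k1P] := @common_rank (fun i l => m (grid_hull n (2 ^ l) (Fi i)) < m (Fi i) + d) M
  (fun i => pr_grid_hull (cFi i) (dFi i) d0).
have [k2 k2P] := pr_grid_hull cF dF e0.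
exists (maxn k1 k2) => l; rewrite geq_max => /andP[kl1 kl2] k.
have k0 : (0 < k)%N by rewrite expn_gt0.
have k0' : 0 < k%:R :> R by rewrite ltr0n.
split; last first.
  apply: le_trans (ltW (k2P _ kl2)); rewrite cardE.
  apply: (@count_le_pr _ _ _ _ _ _ (@coarse R true n k)).
  - exact: grid_hull_measurable.
  - exact: enum_uniq.
  - by move=> c _; exact: box_measurable.
  - by move=> c _; rewrite pr_coarse.
  - move=> c; rewrite mem_enum inE => /asboolP[i ci] t tc; exists c.
      by move=> j; have := tc j; rewrite !in_itv /= => /andP[-> /ltW].
    have [s [sc Fs]] := ci [ffun=> Ordinal N0].
    by exists s; split; [exact: fine_coarse sc|rewrite FE; exists i].
  - move=> c c' t _ _ tc tc'.
    apply: (@fine_disjoint k 1 c [ffun=> ord0] c' [ffun=> ord0] t) => // i.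
      by rewrite ffunE mul0r addr0 invr1 mulr1; exact: tc.
    by rewrite ffunE mul0r addr0 invr1 mulr1; exact: tc'.
pose bad i := [pred c : {ffun 'I_n -> 'I_k} | `[< @coarse R false n k c `&` Fi i !=set0 >] &&
     `[< exists o, ~ (@fine false k N c o `&` Fi i !=set0) >]].
pose E i := \bigcup_(c in [set c | c \in bad i]) @coarse R false n k c.
have mE i : measurable (E i).
  apply: fin_bigcup_measurable; first exact: finite_finset.
  by move=> c _; exact: box_measurable.
have prE' i : (i < M)%N -> m (E i) <= d * N%:R ^+ n.
  move=> iM; have h1 : m (E i) <= #|bad i|%:R * k%:R^-1 ^+ n.
    rewrite cardE; apply: (@pr_le_count _ _ _ _ _ _ (@coarse R false n k)) => //.
    - by move=> c _; exact: box_measurable.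
    - by move=> c _; rewrite pr_coarse.
    - by move=> t [c /= cb tc]; exists c; rewrite ?mem_enum.
  apply: le_trans h1 _.
  have h2 := count_bad_cells k0 N0 (mFi i); have h3 := k1P _ _ iM kl1.
  have h4 : #|bad i|%:R * (k%:R^-1 * N%:R^-1) ^+ n <= d.
    by apply: le_trans h2 _; rewrite lerBlDl ltW.
  have -> : #|bad i|%:R * k%:R^-1 ^+ n =
      #|bad i|%:R * (k%:R^-1 * N%:R^-1) ^+ n * N%:R ^+ n :> R.
    by rewrite -mulrA -exprMn -mulrA mulVf ?mulr1// gt_eqF.
  by rewrite ler_wpM2r// exprn_ge0// ltW.
pose S := F `\` \bigcup_(c in full_cell N Fi) @coarse R false n k c.
have mS : measurable S.
  apply: measurableD => //; apply: fin_bigcup_measurable; first exact: finite_finset.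
  by move=> c _; exact: box_measurable.
pose U := \bigcup_(i in [set i | (i < M)%N]) E i.
have mU : measurable U by apply: bigcup_measurable => i _.
have SU : S `<=` (F `\` G M) `|` U.
  move=> t [Ft nt]; have [Gt|nG] := pselect (G M t); last by left.
  right; have [i /= iM Fit] := Gt; exists i => //.
  have [c tc] := coarse_cover n t k0; exists c => //=.
  rewrite inE; apply/andP; split; first by apply/asboolP; exists t.
  apply/asboolP; apply: contrapT => h; apply: nt; exists c => //; exists i => o.
  by apply: contrapT => ho; apply: h; exists o.
have hU : m U <= M%:R * (d * N%:R ^+ n).
  rewrite -[M in M%:R](size_iota 0); apply: (@pr_le_count _ _ _ _ _ _ E) => //.
    by move=> i; rewrite mem_iota add0n => /prE'.
  by move=> t [i /= iM Eit]; exists i; rewrite ?mem_iota.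
have hdN : M%:R * (d * N%:R ^+ n) <= e / 2.
  rewrite /d; have -> : M%:R * (e / 2 / (M.+1%:R * N%:R ^+ n) * N%:R ^+ n) =
     (e / 2) * (M%:R / M.+1%:R) :> R.
    have n1 : N%:R ^+ n != 0 :> R by rewrite gt_eqF// exprn_gt0.
    have n2 : M.+1%:R != 0 :> R by rewrite pnatr_eq0.
    move: (N%:R ^+ n) (M.+1%:R : R) n1 n2 => x y x0 y0.
    by field; rewrite ?x0 ?y0.
  rewrite -[leRHS]mulr1 ler_wpM2l//; first exact: ltW.
  by rewrite ler_pdivrMr ?ltr0n// mul1r ler_nat.
have mD : measurable (F `\` G M) by exact: measurableD.
apply: le_trans (pr_le (cube_measure R) mS (measurableU _ _ mD mU) SU) _.
apply: le_trans (prU_le (cube_measure R) mD mU) _; rewrite prD//; lra.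
Qed.

End fine_cells.

(** * Convex functions and bad sets *)

Lemma closed_approx (R : realType) (X : normedModType R) (A : set X) :
  (forall x, (forall e : R, 0 < e -> exists2 y, A y & `|y - x| < e) -> A x) -> closed A.
Proof.
move=> h x clx; apply: h => e e0.
have [y [Ay xy]] := clx _ (nbhsx_ballx x e e0).
by exists y => //; rewrite distrC; move: xy; rewrite -ball_normE.
Qed.

Section convex_functions.
Variables (R : realType) (X : completeNormedModType R) (G : set X) (f : X -> R).
Hypothesis convex_f : convex_on G f.
Implicit Types (x y u v w : X) (d phi : X -> R) (L dl rho M eps : R).

Definition is_linear phi := forall (c : R) u v, phi (c *: u + v) = c * phi u + phi v.

Lemma is_linear0 phi : is_linear phi -> phi 0 = 0.
Proof.
move=> h; have : phi (1 *: 0 + 0) = 1 * phi 0 + phi 0 by exact: h.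
by rewrite scaler0 addr0; lra.
Qed.

Lemma is_linearZ phi (c : R) u : is_linear phi -> phi (c *: u) = c * phi u.
Proof. by move=> h; rewrite -[c *: u]addr0 h is_linear0// addr0. Qed.

Lemma is_linearD phi u v : is_linear phi -> phi (u + v) = phi u + phi v.
Proof. by move=> h; rewrite -[u in LHS]scale1r h mul1r. Qed.

Lemma is_linearN phi u : is_linear phi -> phi (- u) = - phi u.
Proof. by move=> h; rewrite -scaleN1r is_linearZ// mulN1r. Qed.

Lemma is_linearB phi u v : is_linear phi -> phi (u - v) = phi u - phi v.
Proof. by move=> h; rewrite is_linearD// is_linearN. Qed.

Definition bounded_by M phi := forall u, `|phi u| <= M * `|u|.

Definition tame L dl : set X := [set x |
  (forall u, `|u| < dl -> G (x + u)) /\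
  (forall u v, `|u| < dl -> `|v| < dl -> `|f (x + u) - f (x + v)| <= L * `|u - v|)].

Definition near_subgradient dl d rho : set X := [set x |
  forall u, `|u| < dl -> f x + d u - rho * `|u| <= f (x + u)].

(* For convex [f], failure of Frechet differentiability at a point is roughness
   for some [eps > 0]; the quantification over [b < eps] makes the set closed. *)
Definition rough dl eps : set X := [set x |
  forall r b : R, 0 < r -> r < dl -> b < eps ->
  exists2 u, `|u| <= r & b * r <= f (x + u) + f (x - u) - 2 * f x].

Definition bad_set L dl d eps : set X :=
  [set x | [/\ tame L dl x, near_subgradient dl d (eps / 4) x & rough dl (4 * eps) x]].

Lemma tame_lip L dl x y u v : tame L dl x -> `|y - x + u| < dl -> `|y - x + v| < dl ->
  `|f (y + u) - f (y + v)| <= L * `|u - v|.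
Proof.
move=> [_ h] hu hv; have := h _ _ hu hv.
have e (z : X) : x + (y - x + z) = y + z by vector_ring.
rewrite !e; suff -> : y - x + u - (y - x + v) = u - v by [].
by vector_ring.
Qed.

Lemma tame_closed L dl : 0 < dl -> closed (tame L dl).
Proof.
move=> dl0; apply: closed_approx => x h.
have shift (y u : X) : x + u = y + (x - y + u) by vector_ring.
have small y u e : `|y - x| < e -> e <= dl - `|u| -> `|x - y + u| < dl.
  by move=> yx ue; apply: le_lt_trans (ler_normD _ _) _; rewrite distrC; lra.
split=> [u udl|u v udl vdl].
  have e0 : 0 < dl - `|u| by rewrite subr_gt0.
  have [y [yG _] yx] := h _ e0.
  by rewrite (shift y); apply: yG; exact: small yx _.
pose e := Num.min (dl - `|u|) (dl - `|v|).
have e0 : 0 < e by rewrite lt_min !subr_gt0 udl.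
have [y ty yx] := h _ e0.
by apply: tame_lip ty _ _; apply: small yx _; rewrite ge_min lexx ?orbT.
Qed.

Lemma near_subgradient_closed L dl d rho M : is_linear d -> 0 < dl -> 0 <= rho -> 0 <= L ->
  bounded_by M d -> 0 <= M -> closed (tame L dl `&` near_subgradient dl d rho).
Proof.
move=> ld dl0 rho0 L0 dM M0; apply: closed_approx => x h.
have tx : tame L dl x.
  apply: (tame_closed dl0) => B /nbhs_ballP[e /= e0 eB].
  have [y [ty _] yx] := h _ e0; exists y; split => //; apply: eB.
  by rewrite -ball_normE /= distrC.
split => // u udl; apply/ler_addgt0Pl => c c0.
pose K := L + M + rho + 1.
have K0 : 0 < K by rewrite /K; lra.
pose e := Num.min (dl - `|u|) (c / K).
have e0 : 0 < e by rewrite lt_min subr_gt0 udl divr_gt0.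
have [y [ty sy] yx] := h _ e0.
have [yx1 yx2] : `|y - x| < dl - `|u| /\ `|y - x| < c / K.
  by move: yx; rewrite lt_min => /andP.
have hu : `|u + (x - y)| < dl.
  by apply: le_lt_trans (ler_normD _ _) _; rewrite (distrC x y); lra.
have h1 := sy _ hu.
have e1 : y + (u + (x - y)) = x + u by vector_ring.
rewrite e1 in h1.
have h2 : `|f (x + (y - x)) - f (x + 0)| <= L * `|y - x - 0|.
  by case: tx => _; apply; rewrite ?normr0//; have := normr_ge0 u; lra.
rewrite addr0 subr0 (addrC x) subrK in h2.
have h3 : d (u + (x - y)) = d u + d (x - y) by exact: is_linearD.
have h4 := dM (x - y); rewrite distrC in h4.
have h5 : `|u + (x - y)| <= `|u| + `|y - x| by rewrite (distrC y x); exact: ler_normD.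
have h6 : rho * `|u + (x - y)| <= rho * (`|u| + `|y - x|) by rewrite ler_wpM2l.
have h7 : `|y - x| * K < c by rewrite -ltr_pdivlMr.
move: h1 h2 h4 h6 h7; rewrite h3 /K !ler_norml => h1 /andP[h2 _] /andP[h4 _] h6 h7.
have := normr_ge0 (y - x).
by lra.
Qed.

Lemma rough_closed L dl eps : 0 < dl -> 0 <= L ->
  closed (tame L dl `&` rough dl eps).
Proof.
move=> dl0 L0; apply: closed_approx => x h.
have tx : tame L dl x.
  apply: (tame_closed dl0) => B /nbhs_ballP[e /= e0 eB].
  have [y [ty _] yx] := h _ e0; exists y; split => //; apply: eB.
  by rewrite -ball_normE /= distrC.
split => // r b r0 rdl be.
pose b' := (b + eps) / 2; have bb' : b < b' by rewrite /b'; lra.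
have b'e : b' < eps by rewrite /b'; lra.
have c0 : 0 < (b' - b) * r by rewrite mulr_gt0// subr_gt0.
pose e := Num.min (dl - r) ((b' - b) * r / (4 * L + 1)).
have e0 : 0 < e by rewrite lt_min subr_gt0 rdl divr_gt0//; lra.
have [y [ty ry] yx] := h _ e0.
have [yx1 yx2] : `|y - x| < dl - r /\ `|y - x| < (b' - b) * r / (4 * L + 1).
  by move: yx; rewrite lt_min => /andP.
have [u ur h1] := ry r b' r0 rdl b'e.
exists u => //.
have key z : `|z| <= r -> `|f (x + z) - f (y + z)| <= L * `|y - x|.
  move=> zr; have := @tame_lip L dl x x z (y - x + z) tx.
  rewrite subrr !add0r; have -> : x + (y - x + z) = y + z by vector_ring.
  have -> : z - (y - x + z) = x - y by vector_ring.
  rewrite (distrC x y); apply; first by lra.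
  by apply: le_lt_trans (ler_normD _ _) _; lra.
have k1 := key u ur; have k2 := key (- u); rewrite normrN in k2; have {}k2 := k2 ur.
have k3 := key 0; rewrite normr0 !addr0 in k3; have {}k3 := k3 (ltW r0).
have h7 : `|y - x| * (4 * L + 1) < (b' - b) * r by rewrite -ltr_pdivlMr//; lra.
have := normr_ge0 (y - x).
by move: k1 k2 k3; rewrite !ler_norml => /andP[? ?] /andP[? ?] /andP[? ?]; lra.
Qed.

Lemma bad_set_closed L dl d eps M : is_linear d -> 0 < dl -> 0 <= L -> 0 < eps ->
  bounded_by M d -> 0 <= M -> closed (bad_set L dl d eps).
Proof.
move=> ld dl0 L0 e0 dM M0.
have -> : bad_set L dl d eps = (tame L dl `&` near_subgradient dl d (eps / 4)) `&`
    (tame L dl `&` rough dl (4 * eps)).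
  by apply/seteqP; split=> [x [? ? ?]|x [[? ?] [_ ?]]].
apply: closedI; last exact: rough_closed.
by apply: (near_subgradient_closed (M := M)) => //; rewrite divr_ge0// ltW.
Qed.

(* Sandwich theorem: the sublinear function below is the infimal convolution
   of the difference quotients of [f] at [x] and of [d + rho `|.|]. *)
Lemma subgradient_near L dl d rho x : is_linear d -> 0 < dl -> 0 <= rho ->
  tame L dl x -> near_subgradient dl d rho x ->
  exists phi : X -> R, is_linear phi /\
    (forall u, `|phi u - d u| <= rho * `|u|) /\ near_subgradient dl phi 0 x.
Proof.
move=> ld dl0 rho0 [xG _] xd.
pose val (u : X) (s : R) (w : X) : R :=
  (f (x + s *: w) - f x) / s + d (u - w) + rho * `|u - w|.
pose A u := [set z : R | exists (s : R) (w : X), [/\ 0 < s, `|s *: w| < dl & z = val u s w]].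
have lbA u : lbound (A u) (d u - rho * `|u|).
  move=> _ [s [w [s0 sw ->]]]; rewrite /val.
  have h1 := xd _ sw.
  have h2 : d w - rho * `|w| <= (f (x + s *: w) - f x) / s.
    rewrite ler_pdivlMr//; move: h1; rewrite is_linearZ// normrZ (gtr0_norm s0).
    by lra.
  have h3 : d (u - w) = d u - d w by exact: is_linearB.
  have h4 : rho * `|w| <= rho * `|u| + rho * `|u - w|.
    by rewrite -mulrDr ler_wpM2l//; have := ler_normB u (u - w); rewrite opprB addrC subrK.
  by rewrite h3; lra.
have A0 u : A u (d u + rho * `|u|).
  exists 1, 0; split => //; first by rewrite scaler0 normr0.
  by rewrite /val scaler0 addr0 subrr mul0r add0r subr0.
have infA u : has_inf (A u) by split; [exists (d u + rho * `|u|)|exists (d u - rho * `|u|)].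
pose p u := inf (A u).
have ple (u : X) (z : R) : A u z -> p u <= z by move=> Az; apply: ge_inf; case: (infA u).
have leA (u : X) (z : R) : (forall (s : R) (w : X), 0 < s -> `|s *: w| < dl -> z <= val u s w) -> z <= p u.
  move=> h; apply: lb_le_inf; first by case: (infA u).
  by move=> _ [s [w [s0 sw ->]]]; exact: h.
have pZ (c : R) u : 0 < c -> p (c *: u) <= c * p u.
  move=> c0; rewrite -ler_pdivrMl//; apply: leA => s w s0 sw.
  rewrite ler_pdivrMl//; apply: ple; exists (s / c), (c *: w); split.
  - by rewrite divr_gt0.
  - by rewrite scalerA divfK// gt_eqF.
  - rewrite /val scalerA divfK ?gt_eqF// -scalerBr is_linearZ// normrZ (gtr0_norm c0).
    by field; rewrite !gt_eqF.
have sp : sublinear p.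
  split.
    move=> c u c0; apply/eqP; rewrite eq_le pZ//=.
    have ci : 0 < c^-1 by rewrite invr_gt0.
    have := pZ c^-1 (c *: u) ci; rewrite scalerA mulVf ?gt_eqF// scale1r.
    by rewrite ler_pdivlMl.
  move=> u v; rewrite -lerBlDr; apply: (leA) => s w s0 sw.
  rewrite lerBlDr -lerBlDl; apply: leA => s' w' s'0 sw'.
  rewrite lerBlDl.
  pose l : R := s' / (s + s'); have ss0 : 0 < s + s' by rewrite addr_gt0.
  have l01 : 0 <= l <= 1.
    rewrite /l; apply/andP; split; first by rewrite divr_ge0// ltW.
    by rewrite ler_pdivrMr// mul1r; lra.
  have l1 : 1 - l = s / (s + s') by rewrite /l; field; rewrite gt_eqF.
  pose q : R := s * s' / (s + s').
  have q0 : 0 < q by rewrite divr_gt0// mulr_gt0.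
  have qe : q *: (w + w') = l *: (s *: w) + (1 - l) *: (s' *: w').
    rewrite l1 !scalerA scalerDr; congr (_ *: _ + _ *: _); rewrite /q /l; field;
    by rewrite gt_eqF.
  have seg (k : R) : 0 <= k <= 1 -> `|k *: (s *: w) + (1 - k) *: (s' *: w')| < dl.
    move=> /andP[k0 k1]; apply: le_lt_trans (ler_normD _ _) _.
    rewrite !normrZ (ger0_norm k0) (ger0_norm (_ : 0 <= 1 - k)) ?subr_ge0//.
    move: sw sw'; rewrite !normrZ.
    move: (`|s| * `|w|) (`|s'| * `|w'|) => a b al bl.
    have [k0'|k0'] := eqVneq k 0; first by rewrite k0'; lra.
    have kp : 0 < k by rewrite lt_neqAle eq_sym k0'.
    have : k * a < k * dl by rewrite ltr_pM2l.
    have : (1 - k) * b <= (1 - k) * dl by apply: ler_wpM2l; [rewrite subr_ge0|exact: ltW].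
    by lra.
  have xe (k : R) : k *: (x + s *: w) + (1 - k) *: (x + s' *: w') =
      x + (k *: (s *: w) + (1 - k) *: (s' *: w')) by vector_ring.
  have cv : f (x + q *: (w + w')) <= l * f (x + s *: w) + (1 - l) * f (x + s' *: w').
    rewrite qe -xe; apply: convex_f => // k k01.
    by rewrite xe; apply/xG/seg.
  apply: le_trans (ple (u + v) (val (u + v) q (w + w')) _) _.
    by exists q, (w + w'); split => //; rewrite qe seg.
  rewrite /val.
  have -> : u + v - (w + w') = (u - w) + (v - w') by vector_ring.
  have h1 : (f (x + q *: (w + w')) - f x) / q <=
      (f (x + s *: w) - f x) / s + (f (x + s' *: w') - f x) / s'.
    rewrite ler_pdivrMr//.
    have -> : ((f (x + s *: w) - f x) / s + (f (x + s' *: w') - f x) / s') * q =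
      l * (f (x + s *: w) - f x) + (1 - l) * (f (x + s' *: w') - f x).
      by rewrite l1 /q /l; field; rewrite !gt_eqF.
    by lra.
  have h2 : rho * `|u - w + (v - w')| <= rho * `|u - w| + rho * `|v - w'|.
    by rewrite -mulrDr ler_wpM2l// ler_normD.
  have h3 : d (u - w + (v - w')) = d (u - w) + d (v - w') by exact: is_linearD.
  by rewrite h3; lra.
have [phi' phip'] := hahn_banach sp; pose phi : X -> R := phi'.
have phip u : phi u <= p u by exact: phip'.
have lphi : is_linear phi by move=> c u v; rewrite /phi linearP.
have up u : phi u - d u <= rho * `|u|.
  by rewrite lerBlDl; apply: le_trans (phip u) _; exact/ple/A0.
exists phi; split => //; split=> [u|u udl].
  rewrite ler_norml up andbT.
  by have := up (- u); rewrite (is_linearN u lphi) (is_linearN u ld) normrN; lra.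
rewrite mul0r subr0 -lerBrDl; apply: le_trans (phip u) _; apply: ple.
exists 1, u; split => //; first by rewrite scale1r.
by rewrite /val scale1r divr1 subrr is_linear0// normr0 mulr0 !addr0.
Qed.

Lemma convex_midpoint L dl x u v : tame L dl x -> `|u| < dl -> `|v| < dl ->
  2 * f (x + 2^-1 *: (u + v)) <= f (x + u) + f (x + v).
Proof.
move=> [xG _] udl vdl.
have e (k : R) : k *: (x + u) + (1 - k) *: (x + v) = x + (k *: u + (1 - k) *: v).
  by vector_ring.
have := @convex_f (x + u) (x + v) _ 2^-1 _.
rewrite e; have -> : 1 - 2^-1 = 2^-1 :> R by field.
rewrite -scalerDr; move=> h; have {}h := h _ _.
suff H : f (x + 2^-1 *: (u + v)) <= 2^-1 * f (x + u) + 2^-1 * f (x + v) by lra.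
apply: h; last by apply/andP; split; lra.
move=> l /andP[l0 l1]; rewrite e; apply: xG; apply: le_lt_trans (ler_normD _ _) _.
rewrite !normrZ (ger0_norm l0) (ger0_norm (_ : 0 <= 1 - l)) ?subr_ge0//.
have := ler_wpM2l l0 (ltW udl).
have [->|l1'] := eqVneq l 1; first by lra.
have lp : 0 < 1 - l by rewrite subr_gt0 lt_neqAle l1'.
have : (1 - l) * `|v| < (1 - l) * dl by rewrite ltr_pM2l.
by lra.
Qed.

(* The shift by [w] raises [f] above its linearization at [x0], hence, by
   convexity, on average above it at [x1] and [x2], which are almost symmetric
   about [x0]; so [d] stays a near subgradient at most at one of [x1 + w], [x2 + w]. *)
Lemma escape L dl d d' eps rho M (B E12 e1 e3 : R) x0 x1 x2 z1 z2 w :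
  0 < dl -> 0 <= L -> 0 <= M -> 0 <= rho -> 0 <= e1 -> 0 < B -> 0 < eps ->
  is_linear d -> is_linear d' -> tame L dl x0 -> bounded_by M d' ->
  (forall u, `|d' u - d u| <= eps / 2 * `|u|) ->
  `|w| <= B -> f x0 + d' w + eps * B <= f (x0 + w) ->
  B <= dl / 4 -> `|x1 - x0| < dl / 4 -> `|x2 - x0| < dl / 4 ->
  `|z1 - x0| < dl / 4 -> `|z2 - x0| < dl / 4 ->
  `|x1 - z1| <= e1 -> `|x2 - z2| <= e1 -> `|z1 - x0| <= e3 -> `|z2 - x0| <= e3 ->
  `|x1 + x2 - 2 *: x0| <= E12 ->
  (L + M) * (E12 + 2 * e1) + 2 * rho * e3 < eps * B / 2 ->
  near_subgradient dl d (eps / 4) (x1 + w) -> near_subgradient dl d (eps / 4) (x2 + w) ->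
  near_subgradient dl d' rho z1 -> near_subgradient dl d' rho z2 -> False.
Proof.
move=> dl0 L0 M0 rho0 e10 B0 eps0 ld ld' tx0 d'M dd' wB hw Bdl x1x x2x z1x z2x x1z x2z z1e z2e xx small.
move=> s1 s2 t1 t2.
have lt4 (y : R) : y < dl / 4 -> y < dl.
  by move=> h; apply: lt_trans h _; rewrite ltr_pdivrMr// ltr_pMr// ltr1n.
have wdl : `|w| < dl by lra.
have down x : near_subgradient dl d (eps / 4) (x + w) ->
    f (x + w) <= f x + d w + eps / 4 * B.
  move=> /(_ (- w)); rewrite normrN addrK is_linearN// => /(_ wdl) h.
  have : eps / 4 * `|w| <= eps / 4 * B by rewrite ler_wpM2l// divr_ge0// ltW.
  by lra.
have h1 := down _ s1; have h2 := down _ s2.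
have nw x : `|x - x0| < dl / 4 -> `|x - x0 + w| < dl.
  by move=> xx0; apply: le_lt_trans (ler_normD _ _) _; lra.
have h3 := convex_midpoint tx0 (nw _ x1x) (nw _ x2x).
have ex x : x0 + (x - x0 + w) = x + w by vector_ring.
rewrite !ex in h3.
set mid := 2^-1 *: (_ + _) in h3.
have midE : mid - w = 2^-1 *: (x1 + x2 - 2 *: x0) by rewrite /mid; vector_ring.
have midn : `|mid - w| <= E12 / 2.
  by rewrite midE normrZ ger0_norm ?invr_ge0// mulrC ler_wpM2r.
have middl : `|mid| < dl.
  have -> : mid = 2^-1 *: (x1 - x0) + 2^-1 *: (x2 - x0) + w by rewrite /mid; vector_ring.
  apply: le_lt_trans (ler_normD _ _) _.
  have := ler_normD (2^-1 *: (x1 - x0)) (2^-1 *: (x2 - x0)).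
  by rewrite !normrZ !ger0_norm ?invr_ge0//; lra.
have h4 : f (x0 + w) - f (x0 + mid) <= L * (E12 / 2).
  have := tx0.2 _ _ middl wdl; have := ler_wpM2l L0 midn.
  by rewrite ler_norml => h /andP[h' _]; lra.
have h5 : `|d' w - d w| <= eps / 2 * B.
  by apply: le_trans (dd' w) _; rewrite ler_wpM2l// divr_ge0// ltW.
have lip x z : `|x - x0| < dl / 4 -> `|z - x0| < dl / 4 -> `|x - z| <= e1 ->
    f x - f z <= L * e1.
  move=> xx0 zx0 xz; have := tx0.2 (x - x0) (z - x0); rewrite !(addrC x0) !subrK.
  have -> : x - x0 - (z - x0) = x - z by vector_ring.
  move=> /(_ (lt4 _ xx0) (lt4 _ zx0)); have := ler_wpM2l L0 xz.
  by rewrite ler_norml => h /andP[_ h']; lra.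
have l1 := lip _ _ x1x z1x x1z; have l2 := lip _ _ x2x z2x x2z.
have up z : `|z - x0| < dl / 4 -> `|z - x0| <= e3 -> near_subgradient dl d' rho z ->
    f z <= f x0 + d' (z - x0) + rho * e3.
  move=> zx ze /(_ (x0 - z)); rewrite (addrC z) subrK (distrC x0 z).
  have -> : d' (x0 - z) = - d' (z - x0) by rewrite -is_linearN// opprB.
  by move=> /(_ (lt4 _ zx)); have := ler_wpM2l rho0 ze; lra.
have u1 := up _ z1x z1e t1; have u2 := up _ z2x z2e t2.
have hd : d' (z1 - x0) + d' (z2 - x0) <= M * (E12 + 2 * e1).
  have -> : d' (z1 - x0) + d' (z2 - x0) =
      d' (x1 + x2 - 2 *: x0 - (x1 - z1) - (x2 - z2)).
    by rewrite -is_linearD//; congr (d' _); vector_ring.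
  apply: le_trans (ler_norm _) _; apply: le_trans (d'M _) _; rewrite ler_wpM2l//.
  apply: le_trans (ler_normB _ _) _.
  by have := ler_normB (x1 + x2 - 2 *: x0) (x1 - z1); lra.
move: h5; rewrite ler_norml => /andP[h5 _].
have LE : (L + M) * (E12 + 2 * e1) = L * E12 + 2 * (L * e1) + M * (E12 + 2 * e1) by ring.
by lra.
Qed.

End convex_functions.

(** * One perturbation step *)

Section separable_dual_sequence.
Variables (R : realType) (X : completeNormedModType R).

Lemma linear_is_linear (phi : {linear X -> R^o}) : is_linear (phi : X -> R).
Proof. by move=> c u v; rewrite linearP. Qed.

Lemma continuous_linear_bound (phi : {linear X -> R^o}) : continuous phi ->
  exists2 M : R, 0 <= M & bounded_by M (phi : X -> R).
Proof.
move=> /(_ 0) /cvgrPdist_lt /(_ 1 ltr01); rewrite linear0 => /nbhs_ballP[e /= e0 eP].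
exists (2 / e); first by rewrite divr_ge0// ltW.
move=> u; have [->|u0] := eqVneq u 0; first by rewrite linear0 !normr0 mulr0.
have nu : 0 < `|u| by rewrite normr_gt0.
pose c := e / (2 * `|u|); have c0 : 0 < c by rewrite divr_gt0// mulr_gt0.
have : ball 0 e (c *: u).
  rewrite -ball_normE /= sub0r normrN normrZ gtr0_norm// /c invfM mulrA divfK ?gt_eqF//.
  by rewrite ltr_pdivrMr// ltr_pMr// ltr1n.
move=> /eP; rewrite /= sub0r normrN.
have -> : `|phi (c *: u)| = c * `|phi u : R|.
  by rewrite linearZ normrM gtr0_norm.
rewrite /c mulrAC ltr_pdivrMr ?mulr_gt0// mul1r => h.
by rewrite mulrAC ler_pdivlMr// mulrC ltW.
Qed.

Lemma is_linear_continuous (phi : {linear X -> R^o}) (M : R) :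
  bounded_by M (phi : X -> R) -> continuous phi.
Proof.
move=> h x; apply/cvgrPdist_lt => e e0; pose K := Num.max M 1.
have K0 : 0 < K by rewrite lt_max ltr01 orbT.
apply/nbhs_ballP; exists (e / K); first by rewrite /= divr_gt0.
move=> y; rewrite -ball_normE /= ltr_pdivlMr// => xy.
rewrite -linearB; apply: le_lt_trans (h _) _; apply: le_lt_trans xy.
by rewrite mulrC ler_wpM2l// le_max lexx.
Qed.

Lemma dual_norm_le (phi : X -> R) (M e : R) : is_linear phi -> bounded_by M phi ->
  dual_norm phi < e -> bounded_by e phi.
Proof.
move=> lp pM pe u; have [->|u0] := eqVneq u 0.
  by rewrite is_linear0// !normr0 mulr0.
have nu : 0 < `|u| by rewrite normr_gt0.
rewrite -ler_pdivrMr//; apply: le_trans (ltW pe); apply: ub_le_sup.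
  exists `|M| => _ [x /= x1 <-]; apply: le_trans (pM x) _.
  apply: (@le_trans _ _ (`|M| * `|x|)); first by rewrite ler_wpM2r// ler_norm.
  by rewrite -[leRHS]mulr1 ler_wpM2l.
exists (`|u|^-1 *: u) => /=.
  by rewrite normrZ gtr0_norm ?invr_gt0// mulVf// gt_eqF.
by rewrite is_linearZ// normrM gtr0_norm ?invr_gt0// mulrC.
Qed.

Lemma separable_dual_seq : separable_dual X -> exists dn : nat -> X -> R,
  [/\ forall i, is_linear (dn i), forall i, exists2 M : R, 0 <= M & bounded_by M (dn i) &
   forall (phi : X -> R) (M : R), is_linear phi -> bounded_by M phi -> forall e : R, 0 < e ->
   exists i, bounded_by e (fun u => phi u - dn i u)].
Proof.
move=> [D [cD Dc Dd]].
have cst0 : continuous (\0 : {linear X -> R^o}) by move=> x; exact: cvg_cst.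
have [z0 Dz0 _] := Dd _ cst0 1 ltr01.
have [g gP] : exists g : nat -> {linear X -> R^o}, D = range g.
  have /countable_injP[h hinj] := cD.
  have ex n : exists x, D x /\ (forall y, D y -> h y = n -> x = y).
    have [[y [Dy yn]]|nex] := pselect (exists y, D y /\ h y = n).
      exists y; split => // z Dz zn; by apply: hinj; [exact: mem_set|exact: mem_set|rewrite yn zn].
    by exists z0; split => // y Dy yn; exfalso; apply: nex; exists y.
  exists (fun n => sval (cid (ex n))); apply/seteqP; split=> [x Dx|_ [n _ <-]].
    by exists (h x) => //; have [_] := svalP (cid (ex (h x))); exact.
  by have [] := svalP (cid (ex n)).
exists (fun i => g i : X -> R); split=> [i|i|phi M lp pM e e0].
- exact: linear_is_linear.
- by apply/continuous_linear_bound/Dc; rewrite gP; exists i.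
have lphi : linear (phi : X -> R^o) by move=> c u v; exact: lp.
pose phiL : {linear X -> R^o} := HB.pack (phi : X -> R^o) (@GRing.isLinear.Build _ _ _ _ (phi : X -> R^o) lphi).
have cphi : continuous phiL by exact: (@is_linear_continuous phiL M).
have [psi Dpsi] := Dd phiL cphi e e0; have := Dpsi; rewrite gP => -[i _ gi] h.
exists i; have [N N0 NP] := continuous_linear_bound (Dc _ Dpsi).
rewrite gi; apply: (@dual_norm_le _ (M + N)) h.
  have lB (psi' : X -> R) : is_linear psi' -> is_linear (fun x => phi x - psi' x).
    by move=> lpsi c u v; rewrite lp lpsi; ring.
  exact: lB (linear_is_linear psi).
move=> u; apply: le_trans (ler_normB _ _) _; rewrite mulrDl.
by apply: lerD; [exact: pM|exact: NP].
Qed.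

End separable_dual_sequence.

Lemma inner_reflect (n N q : nat) (o : {ffun 'I_n -> 'I_N}) :
  inner_index q o -> inner_index q (reflect_index o).
Proof.
move=> /forallP h; apply/forallP => i; rewrite ffunE /=.
by have := h i; have := ltn_ord (o i); lia.
Qed.

Section cell_geometry.
Variables (R : realType) (n k N : nat).
Hypotheses (k0 : (0 < k)%N) (N0 : (0 < N)%N).
Implicit Types (t s : cube R) (c : {ffun 'I_n -> 'I_k}) (o : {ffun 'I_n -> 'I_N}).

Let k0' : 0 < k%:R :> R. Proof. by rewrite ltr0n. Qed.
Let N0' : 0 < N%:R :> R. Proof. by rewrite ltr0n. Qed.

Let ki : 0 <= k%:R^-1 :> R. Proof. by rewrite invr_ge0 ltW. Qed.
Let Ni : 0 <= N%:R^-1 :> R. Proof. by rewrite invr_ge0 ltW. Qed.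

Lemma uval_cell_coord c t (i : 'I_n) : uval (t i) = k%:R^-1 * (cell_coord c t i + (c i)%:R).
Proof. by rewrite /cell_coord subrK mulKf// gt_eqF. Qed.

Lemma fine_dist c o t s (i : 'I_n) : fine false c o t -> fine false c o s ->
  `|uval (t i) - uval (s i)| <= k%:R^-1 * N%:R^-1.
Proof.
move=> /(@fine_coord _ _ _ _ _ _ _ i k0 N0) /andP[h1 h2].
move=> /(@fine_coord _ _ _ _ _ _ _ i k0 N0) /andP[h3 h4].
rewrite !(uval_cell_coord c) -mulrBr normrM gtr0_norm ?invr_gt0//.
by rewrite ler_wpM2l// ler_norml; apply/andP; split; lra.
Qed.

Lemma reflected_fine_dist (p : 'I_N) c o t1 t2 t0 (i : 'I_n) : N = p.*2.+1 ->
  fine false c o t1 -> fine false c (reflect_index o) t2 ->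
  fine false c [ffun=> p] t0 ->
  `|uval (t1 i) + uval (t2 i) - 2 * uval (t0 i)| <= 2 * (k%:R^-1 * N%:R^-1).
Proof.
move=> Np /(@fine_coord _ _ _ _ _ _ _ i k0 N0) /andP[h1 h2].
move=> /(@fine_coord _ _ _ _ _ _ _ i k0 N0) /andP[h3 h4].
move=> /(@fine_coord _ _ _ _ _ _ _ i k0 N0) /andP[h5 h6].
move: h3 h4 h5 h6; rewrite !ffunE /= => h3 h4 h5 h6.
have eo : (o i)%:R + (N - (o i).+1)%:R = 2 * p%:R :> R.
  rewrite -natrD -[2]/(2%:R) -natrM; congr (_%:R); have := ltn_ord (o i); lia.
have eN : (o i)%:R / N%:R + (N - (o i).+1)%:R / N%:R = 2 * (p%:R / N%:R) :> R.
  by rewrite -mulrDl eo mulrA.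
rewrite !(uval_cell_coord c).
move: (cell_coord c t1 i) (cell_coord c t2 i) (cell_coord c t0 i) h1 h2 h3 h4 h5 h6.
move=> x y z h1 h2 h3 h4 h5 h6.
have -> : k%:R^-1 * (x + (c i)%:R) + k%:R^-1 * (y + (c i)%:R) - 2 * (k%:R^-1 * (z + (c i)%:R)) =
  k%:R^-1 * (x + y - 2 * z) :> R by ring.
rewrite normrM gtr0_norm ?invr_gt0// mulrCA ler_wpM2l//.
by rewrite ler_norml; apply/andP; split; lra.
Qed.

Lemma inner_cell_coord (q : nat) (a : R) c o t i : a <= q%:R / N%:R ->
  inner_index q o -> fine false c o t -> a <= cell_coord c t i <= 1 - a.
Proof.
move=> aq /forallP /(_ i) /andP[q1 q2] /(@fine_coord _ _ _ _ _ _ _ i k0 N0) /andP[h1 h2].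
have h3 : q%:R / N%:R <= (o i)%:R / N%:R :> R by rewrite ler_wpM2r ?ler_nat// invr_ge0 ltW.
have h4 : (o i)%:R / N%:R + N%:R^-1 <= (N%:R - q%:R) / N%:R :> R.
  rewrite -[X in _ + X]mul1r -mulrDl natr1 ler_wpM2r//.
  have qN : (q <= N)%N by lia.
  by rewrite -natrB// ler_nat; lia.
have h5 : (N%:R - q%:R) / N%:R = 1 - q%:R / N%:R :> R by rewrite mulrBl divff// gt_eqF.
by apply/andP; split; lra.
Qed.

End cell_geometry.

Section affine_estimates.
Variables (R : realType) (X : completeNormedModType R) (n : nat).
Variables (g : cube R -> X) (D : nat -> cube R -> X) (K tau r : R).
Implicit Types t s : cube R.
Hypothesis tau0 : 0 <= tau.
Hypothesis DK : forall j (t : cube R), `|D j t| <= K.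
Hypothesis gn : forall t : cube R, g (truncate n t) = g t.
Hypothesis gD : forall t s : cube R,
  (forall i, (i < n)%N -> `|uval (s i) - uval (t i)| < r) ->
  (forall i, (n <= i)%N -> s i = t i) ->
  `|g s - g t - \sum_(j < n) (uval (s j) - uval (t j)) *: D j t| <=
    tau * \sum_(j < n) `|uval (s j) - uval (t j)|.

Let sum_le (F : 'I_n -> R) (b : R) : (forall i, F i <= b) -> \sum_i F i <= n%:R * b.
Proof.
move=> h; apply: le_trans (ler_sum _ (fun i _ => h i)) _.
by rewrite sumr_const card_ord mulr_natl.
Qed.

Lemma affine_estimate t s (b : R) : b < r ->
  (forall i : 'I_n, `|uval (s i) - uval (t i)| <= b) ->
  `|g s - g t - \sum_(j < n) (uval (s j) - uval (t j)) *: D j (truncate n t)| <=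
    n%:R * b * tau.
Proof.
move=> br ts; have := @gD (truncate n t) (truncate n s).
have e (u : cube R) (i : 'I_n) : truncate n u i = u i by rewrite /truncate ltn_ord.
rewrite !gn; under eq_bigr do rewrite !e.
under [in X in _ -> _ -> _ <= X]eq_bigr do rewrite !e.
move=> h; apply: le_trans (h _ _) _.
- move=> i ilt; rewrite /truncate ilt; apply: le_lt_trans br.
  exact: (ts (Ordinal ilt)).
- by move=> i ni; rewrite /truncate ltnNge ni.
- by rewrite mulrC ler_wpM2r//; exact: sum_le.
Qed.

Lemma lipschitz_estimate t s (b : R) : b < r ->
  (forall i : 'I_n, `|uval (s i) - uval (t i)| <= b) ->
  `|g s - g t| <= (K + tau) * n%:R * b.
Proof.
move=> br ts; have h := affine_estimate br ts.
set S := \sum_(j < n) _ in h.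
have hS : `|S| <= n%:R * (b * K).
  apply: le_trans (ler_norm_sum _ _ _) _; apply: sum_le => i.
  by rewrite normrZ; apply: ler_pM.
rewrite -[g s - g t](subrK S); apply: le_trans (ler_normD _ _) _.
by lra.
Qed.

Lemma symmetric_estimate (t0 t1 t2 : cube R) (b b' : R) : b < r ->
  (forall i : 'I_n, `|uval (t1 i) - uval (t0 i)| <= b) ->
  (forall i : 'I_n, `|uval (t2 i) - uval (t0 i)| <= b) ->
  (forall i : 'I_n, `|uval (t1 i) + uval (t2 i) - 2 * uval (t0 i)| <= b') ->
  `|g t1 + g t2 - 2 *: g t0| <= 2 * (n%:R * b * tau) + n%:R * b' * K.
Proof.
move=> br h1 h2 h3.
have k1 := affine_estimate br h1; have k2 := affine_estimate br h2.
set S1 := \sum_(j < n) _ in k1; set S2 := \sum_(j < n) _ in k2.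
have hS : `|S1 + S2| <= n%:R * (b' * K).
  rewrite -big_split /=; apply: le_trans (ler_norm_sum _ _ _) _; apply: sum_le => i.
  rewrite -scalerDl normrZ; apply: ler_pM => //.
  by apply: le_trans (h3 i); rewrite le_eqVlt; apply/orP; left; apply/eqP; congr `|_|; ring.
have -> : g t1 + g t2 - 2 *: g t0 =
    (g t1 - g t0 - S1) + (g t2 - g t0 - S2) + (S1 + S2) by vector_ring.
apply: le_trans (ler_normD _ _) _.
have := ler_normD (g t1 - g t0 - S1) (g t2 - g t0 - S2).
by lra.
Qed.

End affine_estimates.

Section shrinking.
Variables (R : realType) (X : completeNormedModType R) (G : set X) (f : X -> R).
Hypothesis convex_f : convex_on G f.
Hypothesis sepX : separable_dual X.
Variables (L dl eps M : R) (d : X -> R).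
Hypotheses (L0 : 0 <= L) (dl0 : 0 < dl) (eps0 : 0 < eps) (M0 : 0 <= M).
Hypotheses (ld : is_linear d) (dM : bounded_by M d).
Local Notation C := (bad_set G f L dl d eps).
Local Notation m := (pr (cube_measure R)).

Lemma bad_set_split (rho : R) : 0 < rho -> exists D : nat -> X -> R,
  [/\ forall i, is_linear (D i), forall i, exists2 M : R, 0 <= M & bounded_by M (D i) &
  forall x, C x -> exists i, (forall u, `|D i u - d u| <= eps / 2 * `|u|) /\
    near_subgradient f dl (D i) rho x].
Proof.
move=> rho0; have [dn [dnl dnM dnd]] := separable_dual_seq sepX.
exists dn; split => // x [tx sx _].
have e40 : 0 <= eps / 4 by rewrite divr_ge0// ltW.
have [phi [lphi [phid sphi]]] := subgradient_near convex_f ld dl0 e40 tx sx.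
have phiM : bounded_by (M + eps / 4) phi.
  move=> u; have := phid u; have := dM u; rewrite !ler_norml mulrDl.
  by move=> /andP[? ?] /andP[? ?]; apply/andP; split; lra.
pose r := Num.min rho (eps / 4).
have r0 : 0 < r by rewrite lt_min rho0 divr_gt0.
have [i ir] := dnd phi _ lphi phiM r r0; exists i; split=> u.
  have := ir u; have := phid u.
  have : r * `|u| <= eps / 4 * `|u| by rewrite ler_wpM2r// ge_min lexx orbT.
  by rewrite !ler_norml => ? /andP[? ?] /andP[? ?]; apply/andP; split; lra.
move=> udl; have := sphi u udl; have := ir u.
have : r * `|u| <= rho * `|u| by rewrite ler_wpM2r// ge_min lexx.
by rewrite ler_norml => ? /andP[? ?]; lra.
Qed.

Lemma rough_direction (B : R) (d' : X -> R) x : is_linear d' -> C x -> 0 < B -> B < dl ->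
  exists2 w : X, `|w| <= B & f x + d' w + eps * B <= f (x + w).
Proof.
move=> ld' [_ _ rx] B0 Bdl.
have e24 : 2 * eps < 4 * eps by rewrite ltr_pM2r// ltr_nat.
have [u uB hu] := rx B (2 * eps) B0 Bdl e24.
have [h|h] := leP (f x + d' u + eps * B) (f (x + u)); first by exists u.
exists (- u); first by rewrite normrN.
by rewrite is_linearN//; lra.
Qed.

End shrinking.

Lemma grid_size_ge (n q p : nat) : p = (4 * n * q)%N -> (8 * q * n <= p.*2.+1)%N.
Proof. by move=> ->; lia. Qed.

Lemma grid_size_le (n q p : nat) : p = (4 * n * q)%N -> (0 < q)%N ->
  (p.*2.+1 <= q * (8 * n + 1))%N.
Proof. by move=> -> q0; lia. Qed.

Lemma grid_size_gt (n q p : nat) : p = (4 * n * q)%N -> (0 < n)%N -> (q <= p.*2.+1)%N.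
Proof. by move=> -> n0; have := leq_pmull q n0; lia. Qed.

Section shrinking_step.
Variables (R : realType) (X : completeNormedModType R) (G : set X) (f : X -> R).
Hypothesis convex_f : convex_on G f.
Variables (L dl eps M : R) (d : X -> R).
Hypotheses (L0 : 0 <= L) (dl0 : 0 < dl) (eps0 : 0 < eps) (M0 : 0 <= M).
Hypotheses (ld : is_linear d) (dM : bounded_by M d).
Local Notation C := (bad_set G f L dl d eps).

Lemma small_dyadic (b : R) (k0 : nat) : 0 < b -> exists2 l, (k0 <= l)%N & (2 ^ l)%:R^-1 < b.
Proof.
move=> b0; have [N _ NP] := near_infty_natSinv_lt (PosNum b0).
exists (maxn k0 N); first exact: leq_maxl.
apply: le_lt_trans (NP _ (leq_maxr k0 N)).
by rewrite lef_pV2 ?posrE ?ltr0n ?expn_gt0// ler_nat ltn_expl.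
Qed.

Lemma shrink_cells (g : cube R -> X) (n p q : nat) (K tau rho r sigma : R)
    (D : nat -> X -> R) (k : nat) (Dg : nat -> cube R -> X) :
  let N := p.*2.+1 in
  (0 < k)%N -> p = (4 * n * q)%N -> (0 < n)%N -> (0 < q)%N ->
  0 <= K -> 0 <= tau -> 0 < rho -> 0 < sigma ->
  (forall j t, `|Dg j t| <= K) ->
  (forall t, g (truncate n t) = g t) ->
  (forall t s : cube R,
    (forall i, (i < n)%N -> `|uval (s i) - uval (t i)| < r) ->
    (forall i, (n <= i)%N -> s i = t i) ->
    `|g s - g t - \sum_(j < n) (uval (s j) - uval (t j)) *: Dg j t| <=
    tau * \sum_(j < n) `|uval (s j) - uval (t j)|) ->
  k%:R^-1 < r -> sigma * k%:R^-1 <= dl / 4 -> (K + tau) * n%:R * k%:R^-1 < dl / 4 ->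
  (forall i, is_linear (D i)) ->
  (L + M + eps / 2) * (2 * (n%:R * tau) + n%:R * (2 * N%:R^-1) * K +
     2 * ((K + tau) * n%:R * N%:R^-1)) + 2 * rho * ((K + tau) * n%:R) < eps * sigma / 2 ->
  let Fi i := [set t | [/\ C (g t), forall u, `|D i u - d u| <= eps / 2 * `|u| &
    near_subgradient f dl (D i) rho (g t)]] in
  let a := (8 * n + 1)%:R^-1 : R in
  exists2 w : {ffun 'I_n -> 'I_k} -> X,
    forall c, `|w c| <= sigma * k%:R^-1 /\ (~ full_cell N Fi c -> w c = 0) &
    forall c : {ffun 'I_n -> 'I_k}, full_cell N Fi c ->
      #|[pred o : {ffun 'I_n -> 'I_N} |
        `[< exists2 t, @fine R n false k N c o t & C (g t + bumps a w t) >]]|%:R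
      <= 5 / 8 * N%:R ^+ n :> R.
Proof.
move=> N k0 pE n0 q0 K0 tau0 rho0 sigma0 DgK gn gD kr Bdl Kdl Dlin small Fi a.
have N0 : (0 < N)%N by [].
have k0' : 0 < k%:R :> R by rewrite ltr0n.
have N0' : 0 < N%:R :> R by rewrite ltr0n.
have ki0 : 0 < k%:R^-1 :> R by rewrite invr_gt0.
have Ni0 : 0 < N%:R^-1 :> R by rewrite invr_gt0.
have a0 : 0 < a by rewrite invr_gt0 ltr0n addn1.
have pN : (p < N)%N by rewrite /N ltnS -addnn leq_addr.
pose B := sigma * k%:R^-1; have B0 : 0 < B by rewrite mulr_gt0.
have Bdl' : B < dl by apply: le_lt_trans Bdl _; rewrite ltr_pdivrMr// ltr_pMr// ltr1n.
pose ctr : {ffun 'I_n -> 'I_N} := [ffun=> Ordinal pN].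
pose Q (c : {ffun 'I_n -> 'I_k}) (w : X) := exists i t0,
  [/\ forall o, @fine R n false k N c o `&` Fi i !=set0,
  @fine R n false k N c ctr t0, Fi i t0 & f (g t0) + D i w + eps * B <= f (g t0 + w)].
have exw (c : {ffun 'I_n -> 'I_k}) : exists w : X,
    [/\ `|w| <= B, ~ full_cell N Fi c -> w = 0 & full_cell N Fi c -> Q c w].
  have [fc|nfc] := pselect (full_cell N Fi c); last first.
    by exists 0; split => //; rewrite normr0 ltW.
  have [i hi] := fc; have [t0 [ct0 Fit0]] := hi ctr.
  have [w wB hw] := rough_direction eps0 (Dlin i) (let: And3 h _ _ := Fit0 in h) B0 Bdl'.
  by exists w; split => // _; exists i, t0.
pose w c := sval (cid (exw c)).
have wP c : [/\ `|w c| <= B, ~ full_cell N Fi c -> w c = 0 & full_cell N Fi c -> Q c (w c)]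
  := svalP (cid (exw c)).
exists w; first by move=> c; have [] := wP c.
move=> c fc; pose Esc (o : {ffun 'I_n -> 'I_N}) :=
  ~~ `[< exists2 t, @fine R n false k N c o t & C (g t + bumps a w t) >].
have -> : #|[pred o : {ffun 'I_n -> 'I_N} |
    `[< exists2 t, @fine R n false k N c o t & C (g t + bumps a w t) >]]| = #|[set o | ~~ Esc o]%SET|.
  by apply: eq_card => o; rewrite !inE /Esc negbK.
have qnN : (8 * q * n <= N)%N := grid_size_ge pE.
apply: (card_reflect R qnN) => // o inno.
have aq : a <= q%:R / N%:R.
  rewrite ler_pdivlMr// mulrC ler_pdivrMr ?ltr0n ?addn1// -natrM ler_nat.
  by rewrite -addn1; exact: grid_size_le pE q0.
rewrite /Esc -negb_and; apply/negP => /andP[/asboolP[t1 ct1 Ct1] /asboolP[t2 ct2 Ct2]].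
have [wB _ /(_ fc)[i [t0 [hi ct0 [Ct0 ddi st0] hw]]]] := wP c.
have [s1 [cs1 [_ _ ss1]]] := hi o.
have [s2 [cs2 [_ _ ss2]]] := hi (reflect_index o).
have ht (o' : {ffun 'I_n -> 'I_N}) t : inner_index q o' ->
    @fine R n false k N c o' t -> g t + bumps a w t = g t + w c.
  move=> ino' ct; have tc := @inner_cell_coord R n k N k0 N0 q a c o' t _ aq ino' ct.
  rewrite (bumps_coarse a0 w (c := c)); last first.
    move=> j; have /andP[h3 h4] := tc j.
    by rewrite (le_trans (ltW a0) h3) (le_trans h4)// gerBl ltW.
  by rewrite bump_inside// scale1r.
have in2 := inner_reflect inno.
rewrite (ht _ _ inno ct1) in Ct1; rewrite (ht _ _ in2 ct2) in Ct2.
have coarse_d u v : coarse false c u -> coarse false c v ->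
    `|g u - g v| <= (K + tau) * n%:R * k%:R^-1.
  move=> cu cv; apply: (lipschitz_estimate tau0 DgK gn gD kr) => j.
  exact: coarse_dist cv cu.
have fc' (o' : {ffun 'I_n -> 'I_N}) (u : cube R) : fine false c o' u ->
  coarse false c u by exact: fine_coarse.
have kNk : k%:R^-1 * N%:R^-1 <= k%:R^-1 :> R.
  by apply: ler_piMr; [exact: ltW|rewrite invf_le1// ler1n].
have kNr : k%:R^-1 * N%:R^-1 < r by apply: le_lt_trans kr.
have fine_d (o' : {ffun 'I_n -> 'I_N}) u v : fine false c o' u -> fine false c o' v ->
    `|g u - g v| <= (K + tau) * n%:R * (k%:R^-1 * N%:R^-1).
  move=> cu cv; apply: (lipschitz_estimate tau0 DgK gn gD kNr) => j.
  exact: fine_dist cu cv.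
have sym : `|g t1 + g t2 - 2 *: g t0| <=
    2 * (n%:R * k%:R^-1 * tau) + n%:R * (2 * (k%:R^-1 * N%:R^-1)) * K.
  apply: (symmetric_estimate tau0 DgK gn gD kr) => j.
  - exact: coarse_dist (fc' _ _ ct0) (fc' _ _ ct1).
  - exact: coarse_dist (fc' _ _ ct0) (fc' _ _ ct2).
  - exact: (reflected_fine_dist k0 N0 (p := Ordinal pN) (o := o) j erefl ct1 ct2 ct0).
have cd u : coarse false c u -> `|g u - g t0| < dl / 4.
  by move=> cu; apply: le_lt_trans Kdl; apply: coarse_d => //; exact: fc' ct0.
have Kt0 : 0 <= K + tau by rewrite addr_ge0.
have Kn0 : 0 <= (K + tau) * n%:R by rewrite mulr_ge0.
have L'0 : 0 <= M + eps / 2 by rewrite addr_ge0// divr_ge0// ltW.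
have [tame0 _ _] := Ct0; have [_ nt1 _] := Ct1; have [_ nt2 _] := Ct2.
have DM : bounded_by (M + eps / 2) (D i).
  move=> u; have := ddi u; have := dM u; rewrite !ler_norml mulrDl.
  by move=> /andP[? ?] /andP[? ?]; apply/andP; split; lra.
have e10 : 0 <= (K + tau) * n%:R * (k%:R^-1 * N%:R^-1).
  by rewrite mulr_ge0// mulr_ge0// ltW.
apply: (@escape R X G f convex_f L dl d (D i) eps rho (M + eps / 2) B
  (2 * (n%:R * k%:R^-1 * tau) + n%:R * (2 * (k%:R^-1 * N%:R^-1)) * K)
  ((K + tau) * n%:R * (k%:R^-1 * N%:R^-1)) ((K + tau) * n%:R * k%:R^-1)
  (g t0) (g t1) (g t2) (g s1) (g s2) (w c)) => //.
- exact: ltW.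
- exact: cd (fc' _ _ ct1).
- exact: cd (fc' _ _ ct2).
- exact: cd (fc' _ _ cs1).
- exact: cd (fc' _ _ cs2).
- exact: fine_d ct1 cs1.
- exact: fine_d ct2 cs2.
- exact: coarse_d (fc' _ _ cs1) (fc' _ _ ct0).
- exact: coarse_d (fc' _ _ cs2) (fc' _ _ ct0).
rewrite -(ltr_pM2r ki0) in small.
have eB : eps * B / 2 = eps * sigma / 2 * k%:R^-1 by rewrite /B; ring.
rewrite eB; apply: le_lt_trans small.
by rewrite le_eqVlt; apply/orP; left; apply/eqP; ring.
Qed.

End shrinking_step.

Lemma cell_size_bounds (R : realType) (K tau sigma dl v x : R) :
  0 < sigma -> 0 < v -> 0 < x -> 0 < K -> tau <= K ->
  x * (sigma + 2 * K * v) < dl / 4 ->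
  sigma * x <= dl / 4 /\ (K + tau) * v * x < dl / 4.
Proof.
move=> s0 v0 x0 K0 tK; rewrite mulrDr => h.
have sx0 : 0 < x * sigma by rewrite mulr_gt0.
have kx0 : 0 < x * (2 * K * v) by rewrite !mulr_gt0.
split; first by rewrite mulrC; lra.
apply: le_lt_trans (_ : x * (2 * K * v) < _); last by lra.
by rewrite mulrC ler_pM2l// ler_pM2r//; lra.
Qed.

Lemma error_bound (R : realType) (A K tau v y rho s : R) :
  0 <= A -> 0 < K -> 0 < tau -> tau <= K -> 0 < v -> 0 <= y -> 0 < rho -> 0 < s ->
  (A + 1) * (2 * (v * tau)) <= s / 8 -> (A + 1) * (6 * K * v * y) <= s / 8 ->
  4 * rho * K * v = s / 8 ->
  A * (2 * (v * tau) + v * (2 * y) * K + 2 * ((K + tau) * v * y)) +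
    2 * rho * ((K + tau) * v) < s / 2.
Proof.
move=> A0 K0 t0 tK v0 y0 r0 s0 h1 h2 h3.
have e1 : (K + tau) * v <= 2 * K * v by rewrite ler_pM2r//; lra.
have e2 : 2 * rho * ((K + tau) * v) <= s / 8.
  rewrite -h3 (_ : 4 * rho * K * v = 2 * rho * (2 * K * v)); last by ring.
  by rewrite ler_pM2l// mulr_gt0.
have e3 : v * (2 * y) * K + 2 * ((K + tau) * v * y) <= 6 * K * v * y.
  have := ler_wpM2r y0 e1; rewrite (_ : v * (2 * y) * K = 2 * K * v * y); last by ring.
  by rewrite (_ : 6 * K * v * y = 3 * (2 * K * v * y)); [lra|ring].
have z1 : 0 <= 2 * (v * tau) by rewrite !mulr_ge0// ltW.
have z2 : 0 <= 6 * K * v * y by rewrite !mulr_ge0// ltW.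
have e4 : A * (2 * (v * tau) + 6 * K * v * y) <=
    (A + 1) * (2 * (v * tau)) + (A + 1) * (6 * K * v * y).
  by rewrite -mulrDr ler_wpM2r ?addr_ge0// lerDl.
have e5 : A * (2 * (v * tau) + v * (2 * y) * K + 2 * ((K + tau) * v * y)) <=
    A * (2 * (v * tau) + 6 * K * v * y) by rewrite -addrA ler_wpM2l// lerD2l.
by move: (A * _) (A * _) (_ * (2 * (v * tau))) (_ * (6 * K * v * y)) (2 * rho * _)
  h1 h2 e2 e4 e5 => B1 B2 B3 B4 B5; lra.
Qed.

Section shrinking.
Variables (R : realType) (X : completeNormedModType R) (G : set X) (f : X -> R).
Hypothesis convex_f : convex_on G f.
Hypothesis sepX : separable_dual X.
Variables (L dl eps M : R) (d : X -> R).
Hypotheses (L0 : 0 <= L) (dl0 : 0 < dl) (eps0 : 0 < eps) (M0 : 0 <= M).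
Hypotheses (ld : is_linear d) (dM : bounded_by M d).
Local Notation C := (bad_set G f L dl d eps).
Local Notation m := (pr (cube_measure R)).

Lemma closed_preimage (T S : topologicalType) (h : T -> S) (A : set S) :
  continuous h -> closed A -> closed (h @^-1` A).
Proof. by move=> /continuous_closedP; exact. Qed.

Lemma archimedean_ge (b : R) : exists2 q : nat, (0 < q)%N & b <= q%:R.
Proof.
exists (Num.bound `|b|).+1 => //; apply: le_trans (ler_norm b) _.
have := archi_boundP (normr_ge0 b) => /ltW h; apply: le_trans h _.
by rewrite ler_nat.
Qed.

Lemma uniform_partial_bound (g : cube R -> X) n : gamma_smooth g ->
  (forall t, g (truncate n t) = g t) ->
  exists2 K : R, 1 <= K & forall j t, `|partial j g t| <= K.
Proof.
move=> sg gn.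
have ex j : exists M : R, 0 <= M /\ forall t, `|partial j g t| <= M.
  by have [B B0 BP] := cube_bounded (gamma_smooth_partial_continuous (j := j) sg); exists B.
pose b j := sval (cid (ex j)).
have bP j : 0 <= b j /\ forall t, `|partial j g t| <= b j := svalP (cid (ex j)).
have S0 : 0 <= \sum_(j < n) b j by apply: sumr_ge0 => j _; case: (bP j).
exists (1 + \sum_(j < n) b j); first by rewrite lerDl.
move=> j t; have [jn|nj] := ltnP j n.
  rewrite (bigD1 (Ordinal jn))//= addrA; apply: le_trans ((bP j).2 t) _.
  rewrite addrAC lerDr addr_ge0//; apply: sumr_ge0 => i _; by case: (bP i).
have /is_partial_eq[_ ->] : is_partial j g t 0.
  apply: is_partial_indep => s; rewrite -(gn t) -gn; congr (g _).
  apply/funext => i; rewrite /truncate /move_coord; case: ltnP => // iln.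
  by case: eqP => // ij; move: nj; rewrite leqNgt -ij iln.
by rewrite normr0 addr_ge0.
Qed.

Lemma shrink (g : cube R -> X) (n : nat) (eta : R) : (0 < n)%N -> 0 < eta ->
  gamma_smooth g -> (forall t, g (truncate n t) = g t) -> 0 < m (g @^-1` C) ->
  exists h : cube R -> X, [/\ gamma_smooth h, forall t, `|h t - g t| <= eta,
    forall j t, `|partial j h t - partial j g t| <= eta &
    m (h @^-1` C) <= 7 / 8 * m (g @^-1` C)].
Proof.
move: (L0) (dl0) (eps0) (M0) => L0' dl0' eps0' M0'.
move=> n0 eta0 sg gn mF0; set F := g @^-1` C in mF0 *.
have [cg _] := sg.
have cC : closed C := bad_set_closed ld dl0 L0 eps0 dM M0.
have cF : closed F by exact: closed_preimage.
have dep (A : set X) : depends_on n (g @^-1` A).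
  move=> t s ts; rewrite /= -(gn t) -(gn s); congr A; congr g.
  by apply/funext => i; rewrite /truncate; case: ltnP => // /ts.
have [K K1 DgK] := uniform_partial_bound sg gn.
have n0' : 0 < n%:R :> R by rewrite ltr0n.
pose a : R := (8 * n + 1)%:R^-1.
have a0 : 0 < a by rewrite invr_gt0 ltr0n addn1.
have a1 : a <= 1 by rewrite invf_le1 ?ltr0n ?ler1n addn1.
pose sigma : R := eta * a / 4.
have sigma0 : 0 < sigma by rewrite divr_gt0// mulr_gt0.
pose La : R := L + M + eps / 2 + 1.
have La0 : 0 < La by rewrite /La; lra.
pose s : R := eps * sigma; have s0 : 0 < s by rewrite mulr_gt0.
pose tau : R := Num.min 1 (s / (16 * La * n%:R)).
have tau0 : 0 < tau by rewrite lt_min ltr01 divr_gt0// !mulr_gt0.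
have tau1 : tau <= 1 by rewrite ge_min lexx.
have tau2 : La * (2 * (n%:R * tau)) <= s / 8.
  have : tau <= s / (16 * La * n%:R) by rewrite ge_min lexx orbT.
  by rewrite ler_pdivlMr ?mulr_gt0//; lra.
have K0 : 0 < K by lra.
have [q q0 qP] := archimedean_ge (48 * La * K * n%:R / s).
pose rho : R := s / (32 * K * n%:R).
have rho0 : 0 < rho by rewrite divr_gt0// !mulr_gt0.
have rhoE : 4 * rho * K * n%:R = s / 8 by rewrite /rho; field; rewrite !gt_eqF.
pose p := (4 * n * q)%N; pose N := p.*2.+1.
have N0' : 0 < N%:R :> R by rewrite ltr0n.
have qN : q%:R <= N%:R :> R by rewrite ler_nat; exact: (grid_size_gt (erefl p) n0).
have NP : La * (6 * K * n%:R / N%:R) <= s / 8.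
  have : 48 * La * K * n%:R <= N%:R * s by rewrite -ler_pdivrMr//; exact: le_trans qP qN.
  rewrite mulrA ler_pdivrMr//; lra.
have [D [Dlin Dbd Dcov]] := bad_set_split convex_f sepX L dl0 eps0 ld dM rho0.
pose Fi i := [set t | [/\ C (g t), forall u, `|D i u - d u| <= eps / 2 * `|u| &
    near_subgradient f dl (D i) rho (g t)]].
have FE : F = \bigcup_i Fi i.
  apply/seteqP; split=> [t Ct|t [i _ []]//].
  by have [i [h1 h2]] := Dcov _ Ct; exists i.
have FiE i : Fi i = set0 \/
    Fi i = g @^-1` (C `&` (tame G f L dl `&` near_subgradient f dl (D i) rho)).
  have [h|h] := pselect (forall u, `|D i u - d u| <= eps / 2 * `|u|); last first.
    by left; apply/seteqP; split => // t [].
  by right; apply/seteqP; split=> [t [Ct _ st]|t [Ct [_ st]]]; split => //; case: Ct.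
have cFi i : closed (Fi i).
  have [->|->] := FiE i; first exact: closed0.
  apply: closed_preimage => //; apply: closedI => //.
  have [M' M'0 M'P] := Dbd i.
  exact: (near_subgradient_closed (Dlin i) dl0 (ltW rho0) L0 M'P M'0).
have dFi i : depends_on n (Fi i) by have [->|->] := FiE i; [move=> ? ?|exact: dep].
pose kappa := m F / 8; have kappa0 : 0 < kappa by rewrite divr_gt0.
have [l0 l0P] := full_cells (isT : (0 < N)%N) kappa0 cF (dep C) cFi dFi FE.
have [r r0 rP] := uniform_affine_approx n cg (fun j t => gamma_smooth_is_partial j t sg)
  (fun j => gamma_smooth_partial_continuous (j := j) sg) tau0.
have b0 : 0 < Num.min r (dl / (4 * (sigma + 2 * K * n%:R))).
  by rewrite lt_min r0 divr_gt0// mulr_gt0// addr_gt0// !mulr_gt0.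
have [l l0l lP] := small_dyadic l0 b0.
have [] := l0P l l0l; set k := (2 ^ l)%N => mS cS.
have k0 : (0 < k)%N by rewrite expn_gt0.
have ki0 : 0 < k%:R^-1 :> R by rewrite invr_gt0 ltr0n.
have ki1 : k%:R^-1 <= 1 :> R by rewrite invf_le1 ?ltr0n// ler1n.
have [kr kdl] : k%:R^-1 < r /\ k%:R^-1 * (sigma + 2 * K * n%:R) < dl / 4.
  move: lP; rewrite lt_min => /andP[-> h]; split => //.
  have P0 : 0 < sigma + 2 * K * n%:R by rewrite addr_gt0// !mulr_gt0.
  move: h; rewrite ltr_pdivlMr ?mulr_gt0// mulrCA => h.
  by rewrite ltr_pdivlMr// mulrC.
have Ni0 : 0 <= N%:R^-1 :> R by rewrite invr_ge0 ltW.
have [h1 h2] : sigma * k%:R^-1 <= dl / 4 /\ (K + tau) * n%:R * k%:R^-1 < dl / 4.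
  by apply: cell_size_bounds => //; exact: le_trans tau1 K1.
have small : (L + M + eps / 2) * (2 * (n%:R * tau) + n%:R * (2 * N%:R^-1) * K +
     2 * ((K + tau) * n%:R * N%:R^-1)) + 2 * rho * ((K + tau) * n%:R) < eps * sigma / 2.
  apply: error_bound => //; first by rewrite !addr_ge0// divr_ge0// ltW.
  exact: le_trans tau1 K1.
have [w wP wesc] := shrink_cells convex_f L0 dl0 eps0 M0 ld dM k0 (erefl p) n0 q0
  (ltW K0) (ltW tau0) rho0 sigma0 DgK gn rP kr h1 h2 Dlin small.
have wB c : `|w c| <= sigma * k%:R^-1 by case: (wP c).
pose h t := g t + bumps a w t.
have dh j t : is_partial j h t (partial j g t + dbumps a w j t).
  by apply: is_partialD; [exact: gamma_smooth_is_partial|exact: bumps_is_partial].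
have ch : continuous h by apply: continuous_add => //; exact: bumps_continuous.
have sh : gamma_smooth h.
  apply: (gamma_smooth_intro ch dh) => j; apply: continuous_add.
    exact: gamma_smooth_partial_continuous.
  exact: dbumps_continuous.
exists h; split => //.
- move=> t; rewrite /h addrAC subrr add0r; apply: le_trans (bumps_bound k0 a0 wB t) _.
  apply: (@le_trans _ _ sigma); first by rewrite ler_piMr// ltW.
  rewrite /sigma ler_pdivrMr//; apply: (@le_trans _ _ eta); first by rewrite ler_piMr// ltW.
  by rewrite ler_peMr ?ler1n// ltW.
- move=> j t; have [_ ->] := is_partial_eq (dh j t).
  rewrite addrAC subrr add0r; apply: le_trans (dbumps_bound k0 a0 wB j t) _.
  by rewrite le_eqVlt; apply/orP; left; apply/eqP; rewrite /sigma; field;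
     rewrite !gt_eqF// ltr0n.
have mFF := closed_measurable cF.
have mH : measurable (h @^-1` C) by apply: closed_measurable; exact: closed_preimage.
pose Full := @full_cell R n k N Fi.
pose S := F `\` \bigcup_(c in Full) @coarse R false n k c.
have mSm : measurable S.
  apply: measurableD => //; apply: fin_bigcup_measurable; first exact: finite_finset.
  by move=> c _; exact: box_measurable.
pose P c (o : {ffun 'I_n -> 'I_N}) := `[< exists2 t, @fine R n false k N c o t & C (h t) >].
pose V c := \bigcup_(o in [set o | P c o]) @fine R n false k N c o.
have mV c : measurable (V c).
  apply: fin_bigcup_measurable; first exact: finite_finset.
  by move=> o _; exact: fine_measurable.
pose U := \bigcup_(c in Full) V c.
have mU : measurable U.
  by apply: fin_bigcup_measurable => [|c _]; [exact: finite_finset|exact: mV].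
have HSU : h @^-1` C `<=` S `|` U.
  move=> t Ct; have [[c fc tc]|nt] := pselect (exists2 c, Full c & @coarse R false n k c t).
    right; exists c => //; have [u tu] := fine_cover k0 (isT : (0 < N)%N) tc.
    by exists u => //=; apply/asboolP; exists t.
  have [c tc] := coarse_cover n t k0.
  have nfc : ~ Full c by move=> fc; apply: nt; exists c.
  have w0 : w c = 0 by case: (wP c) => _; exact.
  left; split; last by move=> [c' fc' tc']; apply: nt; exists c'.
  move: Ct; rewrite /= /h (bumps_coarse a0 w (c := c)) ?w0 ?scaler0 ?addr0//.
  by move=> i; exact: coarseE.
have VP c : Full c -> m (V c) <= 5 / 8 * k%:R^-1 ^+ n.
  move=> fc; have hV : m (V c) <= #|[pred o | P c o]|%:R * (k%:R^-1 * N%:R^-1) ^+ n.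
    rewrite cardE; apply: (@pr_le_count _ _ _ _ _ _ (@fine R n false k N c)) => //.
    - by move=> o _; exact: fine_measurable.
    - by move=> o _; rewrite pr_fine.
    - by move=> t [u /= Pu tu]; exists u; rewrite ?mem_enum.
  apply: le_trans hV _; have := wesc c fc.
  have kN0 : 0 <= (k%:R^-1 * N%:R^-1) ^+ n :> R.
    by rewrite exprn_ge0// mulr_ge0 ?invr_ge0.
  move=> /(ler_wpM2r kN0) hh; apply: le_trans hh _.
  have <- : N%:R ^+ n * (k%:R^-1 * N%:R^-1) ^+ n = k%:R^-1 ^+ n :> R.
    by rewrite -exprMn mulrCA divff ?mulr1// gt_eqF.
  by rewrite mulrA.
have hU : m U <= #|[pred c | `[< Full c >]]|%:R * (5 / 8 * k%:R^-1 ^+ n).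
  rewrite cardE; apply: (@pr_le_count _ _ _ _ _ _ V) => //.
    by move=> c; rewrite mem_enum inE => /asboolP; exact: VP.
  by move=> t [c fc Vt]; exists c => //; rewrite mem_enum inE; apply/asboolP.
apply: le_trans (pr_le _ mH (measurableU _ _ mSm mU) HSU) _.
apply: le_trans (prU_le _ mSm mU) _.
have mS' : m S <= m F / 8 := mS.
have cS' : #|[pred c | `[< Full c >]]|%:R * k%:R^-1 ^+ n <= m F + m F / 8 := cS.
move: mS' hU cS' mF0; move: (m S) (m U) (m F) (#|_|%:R) (_ ^+ n).
by move=> x y v z u ? ? ? ?; lra.
Qed.

End shrinking.

(** * The bad sets are null *)

Section null_bad_sets.
Variables (R : realType) (X : completeNormedModType R) (G : set X) (f : X -> R).
Hypothesis convex_f : convex_on G f.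
Hypothesis sepX : separable_dual X.
Local Notation m := (pr (cube_measure R)).

Lemma pr_preimage_usc (C : set X) (g : cube R -> X) (q : R) : closed C ->
  continuous g -> m (g @^-1` C) < q ->
  exists2 e : R, 0 < e & forall h : cube R -> X, continuous h ->
    (forall t, `|h t - g t| < e) -> m (h @^-1` C) < q.
Proof.
move=> cC cg mq.
pose Ce n := closure [set x | exists2 y, C y & `|x - y| < n.+1%:R^-1].
have cF n : closed (g @^-1` (Ce n)) by apply: closed_preimage => //; exact: closed_closure.
have mF n : measurable (g @^-1` (Ce n)) by exact: closed_measurable.
have e0 : 0 < q - m (g @^-1` C) by rewrite subr_gt0.
have [|N NP] := @pr_cvg_down _ _ _ (cube_measure R) (fun n => g @^-1` (Ce n)) _ mF _ e0.
  move=> n t; apply: closureS => x [y Cy xy]; exists y => //.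
  by apply: lt_le_trans xy _; rewrite lef_pV2 ?posrE ?ltr0n// ler_nat.
have I : \bigcap_n (g @^-1` (Ce n)) = g @^-1` C.
  apply/seteqP; split=> [t h|t Ct n _]; last first.
    by apply: subset_closure; exists (g t) => //; rewrite subrr normr0 invr_gt0.
  apply: cC => B /nbhs_ballP[e /= e1 eB].
  have e20 : 0 < e / 2 by rewrite divr_gt0.
  have [M _ MP] := near_infty_natSinv_lt (PosNum e20).
  have [x [[y Cy xy] xB]] := h M Logic.I _ (nbhsx_ballx (g t) _ e20).
  exists y; split => //; apply: eB; move: xB; rewrite -!ball_normE /= => xB.
  have := MP M (leqnn M); rewrite /= => h1.
  apply: le_lt_trans (ler_distD x _ _) _; rewrite [ltRHS](splitr e) ltrD//.
  exact: lt_trans xy h1.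
have {}NP := NP N (leqnn N); rewrite I addrC subrK in NP.
exists N.+1%:R^-1 => // h ch hg.
apply: le_lt_trans NP; apply: pr_le => //.
  by apply: closed_measurable; exact: closed_preimage.
by move=> t Ct; apply: subset_closure; exists (h t) => //; rewrite distrC.
Qed.

Lemma gamma_smooth_truncate (g : cube R -> X) N : gamma_smooth g ->
  gamma_smooth (fun t => g (truncate N t)) /\
  forall j t, partial j (fun t => g (truncate N t)) t =
    if (j < N)%N then partial j g (truncate N t) else 0.
Proof.
move=> sg; have [cg _] := sg.
have D j t := is_partial_trunc N t (fun t => gamma_smooth_is_partial j t sg).
split; last by move=> j t; case: (is_partial_eq (D j t)).
set dt := fun (j : nat) t => if (j < N)%N then partial j g (truncate N t) else 0.
have ct := continuous_trunc (n := N) cg.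
refine (@gamma_smooth_intro _ _ _ dt ct D _).
move=> j; rewrite /dt; case: (j < N)%N.
  exact: (continuous_trunc (gamma_smooth_partial_continuous (j := j) sg)).
exact: continuous_cst_fun.
Qed.

Variables (L dl eps M : R) (d : X -> R).
Hypotheses (L0 : 0 <= L) (dl0 : 0 < dl) (eps0 : 0 < eps) (M0 : 0 <= M).
Hypotheses (ld : is_linear d) (dM : bounded_by M d).
Local Notation C := (bad_set G f L dl d eps).

Definition small_preimage (q : R) : set (gamma_space X) := [set g | m (g @^-1` C) < q].

Lemma small_preimage_open q : open (small_preimage q).
Proof.
move=> g gq; have cC : closed C := bad_set_closed ld dl0 L0 eps0 dM M0.
have [cg _] := gamma_funP g.
have [e e0 eP] := pr_preimage_usc cC cg gq.
exists 0%N, e; split => // h hg; apply: eP; first by case: (gamma_funP h).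
by move=> t; exact: gamma_ball0 hg.
Qed.

Lemma small_preimage_dense q : 0 < q -> dense (small_preimage q).
Proof.
move=> q0 O [g0 Og0] oO; apply: contrapT => nO.
have cC : closed C := bad_set_closed ld dl0 L0 eps0 dM M0.
have mq (g : gamma_space X) : O g -> q <= m (g @^-1` C).
  by move=> Og; rewrite leNgt; apply/negP => h; apply: nO; exists g.
pose A := [set m (g @^-1` C) | g in O].
have hA : has_inf A by split; [exists (m (g0 @^-1` C)), g0|exists q => _ [g Og <-]; exact: mq].
pose i : R := inf A; have qi : q <= i.
  by apply: lb_le_inf => [|_ [g Og <-]]; [case: hA|exact: mq].
have i7 : 0 < i / 7 by lra.
have [_ [g Og <-] gi] := inf_adherent i7 hA.
have {}gi : m (g @^-1` C) < 8 / 7 * i by move: gi; rewrite -/i; lra.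
have [sg cg] : gamma_smooth g /\ continuous g by have := gamma_funP g; case: (gamma_funP g).
have [e1 e10 e1P] := pr_preimage_usc cC cg gi.
have [n [e [e0 eO]]] := oO g Og.
pose b : R := Num.min e1 (e / 2).
have b0 : 0 < b by rewrite lt_min e10 divr_gt0.
have [be1 be] : b <= e1 /\ b <= e / 2 by rewrite !ge_min !lexx orbT.
have [N1 N1P] := trunc_approx cg b0.
have [N2 N2P] := @common_rank (fun j N => forall t, `|partial j g (truncate N t) - partial j g t| < b) n
  (fun j => trunc_approx (gamma_smooth_partial_continuous (j := j) sg) b0).
pose N := maxn n.+1 (maxn N1 N2).
have nN : (n < N)%N by rewrite leq_max leqnn.
have N1N : (N1 <= N)%N by rewrite !leq_max leqnn orbT.
have N2N : (N2 <= N)%N by rewrite !leq_max leqnn !orbT.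
have [sgN dgN] := gamma_smooth_truncate N sg.
pose gN := fun t => g (truncate N t).
have gN0 t : `|gN t - g t| < b by exact: N1P.
have gN1 j t : (j < n)%N -> `|partial j gN t - partial j g t| < b.
  by move=> jn; rewrite dgN (ltn_trans jn nN); exact: N2P.
have mgN : m (gN @^-1` C) < 8 / 7 * i.
  by apply: e1P => [|t]; [case: sgN|exact: lt_le_trans (gN0 t) be1].
have ball_O (h : gamma_space X) : (forall t, `|h t - gN t| <= e / 4) ->
    (forall j t, `|partial j h t - partial j gN t| <= e / 4) -> O h.
  move=> h0 h1; apply: eO; apply: (@gamma_ballI _ _ n e (3 / 4 * e)).
  - lra.
  - move=> t; have := ler_distD (gN t) (h t) (g t).
    by have := h0 t; have := gN0 t; lra.
  - move=> j t jn; have := ler_distD (partial j gN t) (partial j h t) (partial j g t).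
    by have := h1 j t; have := gN1 j t jn; lra.
have ilow (h : gamma_space X) : O h -> i <= m (h @^-1` C).
  by move=> Oh; apply: ge_inf; [case: hA|exists h].
have e40 : 0 < e / 4 by rewrite divr_gt0.
have igN : i <= m (gN @^-1` C).
  apply: (ilow (GammaSpace sgN)); apply: ball_O => /= [t|j t];
  by rewrite subrr normr0 ltW.
have mgN0 : 0 < m (gN @^-1` C) by lra.
have [h [sh h0 h1 h2]] := shrink convex_f sepX L0 dl0 eps0 M0 ld dM
  (leq_ltn_trans (leq0n n) nN : (0 < N)%N) e40 sgN
  (fun t => congr1 g (trunc_id N t)) mgN0.
have := ilow (GammaSpace sh) (ball_O (GammaSpace sh) h0 h1).
by rewrite /=; lra.
Qed.

End null_bad_sets.

Section frechet.
Variables (R : realType) (X : completeNormedModType R) (G : set X) (f : X -> R).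
Hypothesis convex_f : convex_on G f.

Lemma tame_mono L L' dl dl' x : L <= L' -> dl' <= dl -> tame G f L dl x -> tame G f L' dl' x.
Proof.
move=> LL dd [xG xL]; split=> [u udl|u v udl vdl]; first exact/xG/(lt_le_trans udl).
apply: le_trans (xL _ _ (lt_le_trans udl dd) (lt_le_trans vdl dd)) _.
by rewrite ler_wpM2r.
Qed.

Lemma convex_locally_lipschitz x : open G -> {within G, continuous (f : X -> R^o)} -> G x ->
  exists L dl : R, [/\ 0 <= L, 0 < dl & tame G f L dl x].
Proof.
move=> oG cf Gx.
have cx : {for x, continuous (f : X -> R^o)}.
  by move: cf; rewrite continuous_open_subspace// => /(_ x (mem_set Gx)).
have /nbhs_ballP[r1 /= r10 r1P] : nbhs x G by apply: open_nbhs_nbhs.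
have /nbhs_ballP[r2 /= r20 r2P] : nbhs x [set y | `|f x - f y| < 1].
  exact: (@cvgr_dist_lt _ _ _ _ _ _ _ cx).
pose dl : R := Num.min r1 r2 / 2.
have r0 : 0 < Num.min r1 r2 by rewrite lt_min r10.
have dl0 : 0 < dl by rewrite divr_gt0.
have inb u : `|u| < 2 * dl -> G (x + u) /\ `|f x - f (x + u)| < 1.
  have -> : 2 * dl = Num.min r1 r2 by rewrite /dl; field.
  rewrite lt_min => /andP[u1 u2]; split; [apply: r1P|apply: r2P];
  by rewrite -ball_normE /= opprD addrA subrr sub0r normrN.
exists (2 / dl), dl; split => //; first by rewrite divr_ge0// ltW.
split=> [u udl|]; first by case: (inb u) => //; lra.
suff key u v : `|u| < dl -> `|v| < dl -> f (x + u) - f (x + v) <= 2 / dl * `|u - v|.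
  move=> u v udl vdl; rewrite ler_norml; have := key u v udl vdl.
  by have := key v u vdl udl; rewrite (distrC v u) => h1 h2; apply/andP; split; lra.
move=> udl vdl; have [->|uv] := eqVneq u v; first by rewrite !subrr normr0 mulr0.
have n0 : 0 < `|u - v| by rewrite normr_gt0 subr_eq0.
set n := `|u - v| in n0 *.
pose w := u + (dl / n) *: (u - v).
have wdl : `|w| < 2 * dl.
  apply: le_lt_trans (ler_normD _ _) _.
  by rewrite normrZ gtr0_norm ?divr_gt0// divfK ?gt_eqF//; lra.
have vdl2 : `|v| < 2 * dl by lra.
pose l : R := n / (n + dl).
have nd0 : 0 < n + dl by rewrite addr_gt0.
have l01 : 0 <= l <= 1.
  rewrite /l; apply/andP; split; first by rewrite divr_ge0// ltW.
  by rewrite ler_pdivrMr// mul1r; lra.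
have ue : x + u = l *: (x + w) + (1 - l) *: (x + v).
  have le : l * (dl / n) = 1 - l by rewrite /l; field; rewrite !gt_eqF.
  rewrite /w; have -> : l *: (x + (u + (dl / n) *: (u - v))) + (1 - l) *: (x + v) =
    x + l *: u + (1 - l) *: v + (l * (dl / n)) *: (u - v) by vector_ring.
  by rewrite le; vector_ring.
have [Gw fw] := inb _ wdl; have [Gv fv] := inb _ vdl2.
have cvx : f (x + u) <= l * f (x + w) + (1 - l) * f (x + v).
  rewrite ue; apply: convex_f => // k /andP[k0 k1].
  have -> : k *: (x + w) + (1 - k) *: (x + v) = x + (k *: w + (1 - k) *: v) by vector_ring.
  apply: (inb _ _).1; apply: le_lt_trans (ler_normD _ _) _.
  rewrite !normrZ (ger0_norm k0) (ger0_norm (_ : 0 <= 1 - k)) ?subr_ge0//.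
  have h1 : k * `|w| <= k * (2 * dl) by rewrite ler_wpM2l// ltW.
  have [->|k1'] := eqVneq k 1; first by lra.
  have kp : 0 < 1 - k by rewrite subr_gt0 lt_neqAle k1'.
  have : (1 - k) * `|v| < (1 - k) * (2 * dl) by rewrite ltr_pM2l.
  by lra.
have h2 : f (x + u) - f (x + v) <= l * (f (x + w) - f (x + v)) by lra.
have h3 : f (x + w) - f (x + v) <= 2.
  by move: fw fv; rewrite !ltr_norml => /andP[? ?] /andP[? ?]; lra.
have l2 : l <= n / dl by rewrite ler_pM2l// lef_pV2 ?posrE//; lra.
have /andP[l0 _] := l01.
apply: le_trans h2 _; apply: (@le_trans _ _ (l * 2)); first by rewrite ler_wpM2l.
have -> : 2 / dl * n = 2 * (n / dl) by ring.
by rewrite mulrC ler_wpM2l.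
Qed.

Lemma frechet_differentiable (phi : X -> R) (M : R) x : is_linear phi -> bounded_by M phi ->
  (forall e : R, 0 < e -> exists2 r : R, 0 < r & forall u, `|u| < r ->
    `|f (x + u) - f x - phi u| <= e * `|u|) -> differentiable (f : X -> R^o) x.
Proof.
move=> lp pM h.
have lphi : linear (phi : X -> R^o) by move=> c u v; exact: lp.
pose phiL : {linear X -> R^o} := HB.pack (phi : X -> R^o) (@GRing.isLinear.Build _ _ _ _ (phi : X -> R^o) lphi).
have cphi : continuous phiL by exact: (@is_linear_continuous _ _ phiL M).
have o : (f : X -> R^o) \o shift x = cst (f x : R^o) + (phiL : X -> R^o) +o_ (0 : X) id.
  apply/eqaddoP => e e0; have [r r0 rP] := h e e0.
  apply/nbhs_ballP; exists r => //= u; rewrite -ball_normE /= sub0r normrN => ur.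
  have -> : (f \o shift x - (cst (f x : R^o) + (phiL : X -> R^o))) u = f (x + u) - f x - phi u.
    by rewrite [LHS]/= (addrC x u) -addrA -opprD.
  exact: rP.
apply/diff_locallyP; rewrite (diff_unique cphi o); split => //.
Qed.

Lemma nondifferentiable_bad (dn : nat -> X -> R) x : open G ->
  {within G, continuous (f : X -> R^o)} -> G x ->
  ~ differentiable (f : X -> R^o) x ->
  (forall (phi : X -> R) (M : R), is_linear phi -> bounded_by M phi -> forall e : R, 0 < e ->
   exists i, bounded_by e (fun u => phi u - dn i u)) ->
  exists i a b c : nat, bad_set G f a%:R b.+1%:R^-1 (dn i) c.+1%:R^-1 x.
Proof.
move=> oG cf Gx nd dnd.
have [L [dl [L0 dl0 tx]]] := convex_locally_lipschitz oG cf Gx.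
have [b _ bP] := near_infty_natSinv_lt (PosNum dl0).
have {}bP : b.+1%:R^-1 < dl := bP b (leqnn b).
have b0 : 0 < b.+1%:R^-1 :> R by rewrite invr_gt0.
have [a _ aL] := archimedean_ge L.
have ta := tame_mono aL (ltW bP) tx.
set r := b.+1%:R^-1 in bP b0 ta *.
have zl : is_linear (fun _ : X => 0 : R) by move=> c u v; rewrite mulr0 addr0.
have s0 : near_subgradient f r (fun _ : X => 0) a%:R x.
  move=> u ur; rewrite addr0; have := ta.2 u 0 ur; rewrite normr0 addr0 subr0 => /(_ b0).
  by rewrite ler_norml => /andP[+ _]; lra.
have [phi [lp [pM sphi]]] := subgradient_near convex_f zl b0 (ler0n R a) ta s0.
have {}pM : bounded_by a%:R phi by move=> u; have := pM u; rewrite subr0.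
have [e e0 eP] : exists2 e : R, 0 < e & forall s : R, 0 < s ->
    exists2 u, `|u| < s & e * `|u| < f (x + u) - f x - phi u.
  apply: contrapT => ne; apply: nd; apply: (frechet_differentiable lp pM) => e e0.
  have [s s0' sP] : exists2 s : R, 0 < s & forall u, `|u| < s -> f (x + u) - f x - phi u <= e * `|u|.
    apply: contrapT => ns; apply: ne; exists e => // s s0'.
    apply: contrapT => nu; apply: ns; exists s => // u us.
    by rewrite leNgt; apply/negP => lu; apply: nu; exists u.
  exists (Num.min s r); first by rewrite lt_min s0'.
  move=> u; rewrite lt_min => /andP[us ur]; rewrite ler_norml sP// andbT.
  have := sphi u ur; rewrite mul0r.
  by have : 0 <= e * `|u| by [rewrite mulr_ge0// ltW]; lra.
have e40 : 0 < e / 4 by rewrite divr_gt0.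
have [c _ cP] := near_infty_natSinv_lt (PosNum e40).
have {}cP : c.+1%:R^-1 < e / 4 := cP c (leqnn c).
have c0 : 0 < c.+1%:R^-1 :> R by rewrite invr_gt0.
set eps := c.+1%:R^-1 in cP c0 *.
have e44 : 0 < eps / 4 by rewrite divr_gt0.
have [i iP] := dnd phi _ lp pM _ e44.
exists i, a, b, c; split => //.
  move=> u ur; have := sphi u ur; have := iP u.
  by rewrite ler_norml => /andP[? _]; rewrite mul0r -/eps; lra.
move=> s be s0' sr bee; have [u us hu] := eP s s0'.
have [u0|u0] := eqVneq u 0.
  by move: hu; rewrite u0 normr0 mulr0 addr0 subrr sub0r is_linear0// oppr0 ltxx.
have nu : 0 < `|u| by rewrite normr_gt0.
pose k := s / `|u|; have k1 : 1 <= k by rewrite /k ler_pdivlMr// mul1r ltW.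
have k0 : 0 < k by lra.
have ku : `|k *: u| = s by rewrite normrZ gtr0_norm// divfK// gt_eqF.
exists (k *: u); first by rewrite ku.
have ki : 0 <= k^-1 <= 1.
  by rewrite invr_ge0 (ltW k0) /= invf_le1.
have kk : k^-1 * k = 1 by rewrite mulVf// gt_eqF.
have ue : x + u = k^-1 *: (x + k *: u) + (1 - k^-1) *: (x + 0).
  have -> : k^-1 *: (x + k *: u) + (1 - k^-1) *: (x + 0) = x + (k^-1 * k) *: u by vector_ring.
  by rewrite kk scale1r.
have cvx : f (x + u) <= k^-1 * f (x + k *: u) + (1 - k^-1) * f (x + 0).
  rewrite ue; apply: convex_f => // l /andP[l0 l1].
  have -> : l *: (x + k *: u) + (1 - l) *: (x + 0) = x + l *: (k *: u) by vector_ring.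
  apply: ta.1; rewrite normrZ ku ger0_norm//; apply: le_lt_trans sr.
  by rewrite ler_piMl// ltW.
rewrite addr0 in cvx.
have up : k * (f (x + u) - f x) <= f (x + k *: u) - f x.
  have : k * f (x + u) <= k * (k^-1 * f (x + k *: u) + (1 - k^-1) * f x) by rewrite ler_pM2l.
  have -> : k * (k^-1 * f (x + k *: u) + (1 - k^-1) * f x) =
     (k^-1 * k) * f (x + k *: u) + (k - k^-1 * k) * f x by ring.
  by rewrite kk; lra.
have dwn : - (k * phi u) <= f (x - k *: u) - f x.
  have := sphi (- (k *: u)); rewrite normrN ku is_linearN// is_linearZ// => /(_ sr).
  by rewrite mul0r; lra.
have h1 : k * (e * `|u|) <= k * (f (x + u) - f x - phi u) by rewrite ler_pM2l// ltW.
have h2 : k * (e * `|u|) = e * s by rewrite mulrCA /k divfK// gt_eqF.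
have h3 : be * s <= e * s by rewrite ler_pM2r//; move: bee; rewrite -/eps; lra.
by lra.
Qed.

End frechet.

Lemma small_preimage_null (R : realType) (X : completeNormedModType R) (C : set X)
    (g : cube R -> X) : closed C -> continuous g ->
  (forall j : nat, pr (cube_measure R) (g @^-1` C) < j.+1%:R^-1) ->
  (cube_measure R).-negligible (g @^-1` C).
Proof.
move=> cC cg h; have mC : measurable (g @^-1` C).
  by apply: closed_measurable; exact: closed_preimage.
exists (g @^-1` C); split => //; rewrite prE//; congr (_%:E).
apply/eqP; rewrite eq_le pr_ge0 andbT leNgt; apply/negP => p0.
have [N _ NP] := near_infty_natSinv_lt (PosNum p0).
by have := NP N (leqnn N); rewrite /= ltNge (ltW (h N)).
Qed.

Theorem corollary3p11 (R : realType) (X : completeNormedModType R)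
    (separable_dualX : separable_dual X)
    (G : set X) (openG : open G) (f : X -> R^o)
    (convex_f : convex_on G f) (continuous_f : {within G, continuous f}) :
  gamma_null [set x : X | G x /\ ~ differentiable f x].
Proof.
have [dn [dnl dnM dnd]] := separable_dual_seq separable_dualX.
pose C (k : nat) : set X :=
  if (choice.unpickle k : option (nat * nat * nat * nat)) is Some (i, a, b, c)
  then bad_set G f a%:R b.+1%:R^-1 (dn i) c.+1%:R^-1 else set0.
have cC k : closed (C k).
  rewrite /C; case: choice.unpickle => [[[[i a] b] c]|]; last exact: closed0.
  have [M M0 dM] := dnM i.
  by apply: (bad_set_closed (dnl i) _ _ _ dM M0) => //; rewrite invr_gt0.
exists (\bigcup_k C k); split; last first.
- move=> x [Gx nd]; have [i [a [b [c h]]]] :=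
    nondifferentiable_bad convex_f openG continuous_f Gx nd dnd.
  exists (choice.pickle (i, a, b, c)); first exact: Logic.I.
  by rewrite /C choice.pickleK.
- pose O (i : nat) : set (gamma_space X) :=
    if (choice.unpickle i : option (nat * nat)) is Some (k, j) then
    [set g | pr (cube_measure R) (g @^-1` C k) < j.+1%:R^-1] else setT.
  exists (\bigcap_i O i).
    exists (\bigcap_i O i) => //; exists O => // i.
    rewrite /O; case: choice.unpickle => [[k j]|]; last first.
      by split; [exact: openT|move=> U U0 _; rewrite setIT].
    have j0 : 0 < j.+1%:R^-1 :> R by rewrite invr_gt0.
    rewrite /C; case: choice.unpickle => [[[[l a] b] c]|].
      have [M M0 dM] := dnM l.
      have b0 : 0 < b.+1%:R^-1 :> R by rewrite invr_gt0.
      have c0 : 0 < c.+1%:R^-1 :> R by rewrite invr_gt0.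
      split; first exact: (small_preimage_open (ler0n R a) b0 c0 M0 (dnl l) dM).
      exact: (small_preimage_dense convex_f separable_dualX (ler0n R a) b0 c0 M0 (dnl l) dM j0).
    pose Q := [set g : gamma_space X | pr (cube_measure R) (g @^-1` set0) < j.+1%:R^-1].
    have QT : Q = setT by apply/seteqP; split => // g _; rewrite /Q /= preimage_set0 pr0.
    change (open Q /\ dense Q); rewrite QT.
    by split; [exact: openT|move=> U U0 _; rewrite setIT].
  move=> g gO; have [cg _] := gamma_funP g.
  have -> : [set t | (\bigcup_k C k) (g t)] = \bigcup_k (g @^-1` C k) by rewrite -preimage_bigcup.
  apply: measure_negligible.
    apply: bigcupT_measurable => k; apply: closed_measurable; exact: closed_preimage.
  apply: negligible_bigcup => k; apply: small_preimage_null => // j.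
  by have := gO (choice.pickle (k, j)) Logic.I; rewrite /O choice.pickleK.
- apply: sigma_algebra_bigcup => k; rewrite -[C k]setCK; apply: sigma_algebraC.
  by apply: sub_sigma_algebra; exact: closed_openC.
Qed.
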